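(* Let $(X,\mathsf d)$ and $\mathsf E:X\to\mathbb R\cup\{+\infty\}$ satisfy the standing assumptions (A1)–(A3), and fix $\varepsilon>0$. Then for all $x,y\in X$ $$\inf_{\gamma:\,x\leadsto y}\mathcal A_\varepsilon(\gamma)\ \ge\ \varepsilon\,\big|\mathsf E(x)-\mathsf E(y)\big|.$$ If either $y=\mathsf S_\varepsilon x$ or $x=\mathsf S_\varepsilon y$, then equality is achieved. In the case $y=\mathsf S_\varepsilon x$, the curve $[0,1]\ni t\mapsto\hat\gamma_t:=\mathsf S_{\varepsilon t}x$ is a minimizer of $\mathcal A_\varepsilon$ among curves from $x$ to $y$, and the optimal value is $$\inf_{\gamma:\,x\leadsto y}\mathcal A_\varepsilon(\gamma)=\varepsilon\big(\mathsf E(x)-\mathsf E(\mathsf S_\varepsilon x)\big).$$ Analogously, in the case $x=\mathsf S_\varepsilon y$, the curve $[0,1]\ni t\mapsto\mathsf S_{\varepsilon(1-t)}y$ is a minimizer and the optimal value is $\varepsilon\big(\mathsf E(y)-\mathsf E(\mathsf S_\varepsilon y)\big)$.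
   Context: Curves: for a metric space $(X,\mathsf d)$, $C([0,1],X)$ denotes the continuous curves $\gamma=(\gamma_t)_{t\in[0,1]}$, $|\dot\gamma_t|$ the metric speed of an absolutely continuous curve. Slope: $D(\mathsf E)=\{x\in X:\mathsf E(x)<\infty\}$. The slope $|\partial\mathsf E|(x)$ is $+\infty$ if $x\notin D(\mathsf E)$, $0$ if $x$ is isolated, and $|\partial\mathsf E|(x)=\limsup_{z\to x}\frac{[\mathsf E(x)-\mathsf E(z)]^+}{\mathsf d(x,z)}$ otherwise. $\mathrm{EVI}_\lambda$-gradient flow of $\mathsf E$ ($\lambda\in\mathbb R$) starting from $x$: a curve $(\gamma_t)_{t>0}$ in $AC_{loc}((0,\infty),X)$ with $\gamma_t\to x$ as $t\downarrow0$ and $\frac12\frac{d}{dt}\mathsf d^2(\gamma_t,z)+\frac\lambda2\mathsf d^2(\gamma_t,z)+\mathsf E(\gamma_t)\le\mathsf E(z)$ for all $z\in X$ and a.e. $t>0$. Standing assumptions: (A1) $(X,\mathsf d)$ is a complete separable metric space. (A2) $\mathsf E$ is lower semicontinuous, $\overline{D(\mathsf E)}=X$, and for every $\mathsf d$-bounded $B\subset X$ there is $c_B\in\mathbb R$ with $\mathsf E\ge c_B$ on $B$. (A3) There is $\lambda\in\mathbb R$ such that for every $x\in X$ there exists an $\mathrm{EVI}_\lambda$-gradient flow of $\mathsf E$ starting from $x$. Such flows are unique given the starting point, and $\mathsf S_tx$ denotes the value at time $t$ of the flow starting from $x$ (with $\mathsf S_0x=x$). Functionals on $C([0,1],X)$: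 $\mathcal A(\gamma)=\frac12\int_0^1|\dot\gamma_t|^2dt$ (equal to $+\infty$ if $\gamma$ is not absolutely continuous), $\mathcal I(\gamma)=\frac12\int_0^1|\partial\mathsf E|^2(\gamma_t)dt$, $\mathcal A_\varepsilon=\mathcal A+\varepsilon^2\mathcal I$. The notation $\gamma:x\leadsto y$ means $\gamma\in C([0,1],X)$ with $\gamma_0=x$, $\gamma_1=y$; the infimum over the empty set is $+\infty$. If $\mathsf E(x)=\mathsf E(y)=+\infty$, the expression $|\mathsf E(x)-\mathsf E(y)|$ is read as $0$. *)

(* Defs.v *)
From mathcomp Require Import all_boot all_order all_algebra.
From mathcomp Require Import all_classical all_reals all_analysis.

Set Implicit Arguments.
Unset Strict Implicit.
Unset Printing Implicit Defensive.

Import Order.TTheory GRing.Theory Num.Theory.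
Import numFieldNormedType.Exports.

Local Open Scope classical_set_scope.
Local Open Scope ring_scope.
Local Open Scope ereal_scope.

(* A curve defined on an interval of the line is represented by a total
   function R -> X; its values outside the interval are irrelevant. *)

Section MetricSpace.
Context {R : realType} (X : metricType R).

Definition complete_space : Prop :=
  forall F : set_system X, ProperFilter F -> cauchy F ->
    exists x : X, F --> x.

Definition separable_space : Prop :=
  exists D : set X, countable D /\ dense D.

Definition dist_bounded (B : set X) : Prop :=
  exists M : R, forall x y, B x -> B y -> (mdist x y <= M)%R.

End MetricSpace.

Section Curves.
Context {R : realType} {X : metricType R}.
Local Notation mu := (@lebesgue_measure R).
Implicit Types (g : R -> X) (x y : X).

Definition ac_on (a b : R) g : Prop :=
  exists2 m : R -> R, mu.-integrable `[a, b] (EFin \o m) &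
    forall s t : R, (a <= s)%R -> (s <= t)%R -> (t <= b)%R ->
      (mdist (g s) (g t))%:E <= \int[mu]_(r in `[s, t]) (m r)%:E.

Definition ac_loc_pos g : Prop :=
  forall a b : R, (0 < a)%R -> (a < b)%R -> ac_on a b g.

(* For an absolutely continuous curve the limit exists for almost every t;
   where it does not exist, [lim] takes a default value. *)
Definition metric_speed g (t : R) : R :=
  lim ((mdist (g (t + h)) (g t) / `|h|)%R @[h --> (0%R : R)^']).

Definition curves x y : set (R -> X) :=
  [set g : R -> X | {within `[0%R, 1%R], continuous g} /\ g 0%R = x /\ g 1%R = y].

Definition action g : \bar R :=
  if `[< ac_on 0%R 1%R g >] then
    (2^-1)%:E * \int[mu]_(t in `[0%R, 1%R]) (metric_speed g t ^+ 2)%:E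
  else +oo.

End Curves.

Section Functionals.
Context {R : realType} {X : metricType R}.
Local Notation mu := (@lebesgue_measure R).
Variable E : X -> \bar R.
Implicit Types (g : R -> X) (x y : X).

Definition dom : set X := [set x | E x < +oo].

Definition slope x : \bar R :=
  if `[< ~ dom x >] then +oo
  else if `[< isolated [set: X] x >] then 0
  else limf_esup (fun z => maxe (E x - E z) 0 * ((mdist x z)^-1)%:E) x^'.

(* The derivative exists for almost every t because s |-> d(g s, z)^2 is
   locally absolutely continuous. It is nevertheless required to exist here,
   since [derive1] has a default value at points of non-differentiability. *)
Definition evi_flow (lambda : R) x g : Prop :=
  [/\ ac_loc_pos g,
      g t @[t --> (0%R : R)^'+] --> x &
      forall z : X, {ae mu, forall t : R, (0 < t)%R ->
        let D : R -> R := fun s => (mdist (g s) z ^+ 2)%R in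
        derivable D t 1%R /\
        (2^-1 * derive1 D t)%:E + (lambda / 2 * D t)%:E + E (g t) <= E z}].

(* A flow is selected by choice; when E has EVI_lambda flows from all points, it is unique on t > 0. *)
Definition evi_semigroup (lambda t : R) x : X :=
  if t == 0%R then x else xget (fun=> x) (evi_flow lambda x) t.

Definition slope_action g : \bar R :=
  (2^-1)%:E * \int[mu]_(t in `[0%R, 1%R]) (slope (g t) ^+ 2).

Definition action_eps (eps : R) g : \bar R :=
  action g + (eps ^+ 2)%:E * slope_action g.

Definition min_cost (eps : R) x y : \bar R :=
  ereal_inf [set action_eps eps g | g in curves x y].

Definition minimizer (eps : R) x y g : Prop :=
  curves x y g /\
  forall h, curves x y h -> action_eps eps g <= action_eps eps h.

(* |E x - E y|, where oo - oo is read as 0 (in \bar R, +oo - +oo is -oo). *)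
Definition energy_gap x y : \bar R :=
  if (E x == +oo) && (E y == +oo) then 0 else `|E x - E y|.

Definition bounded_below_on_bounded : Prop :=
  forall B : set X, dist_bounded B ->
    exists c : R, forall x, B x -> c%:E <= E x.

End Functionals.

(* Main.v *)
Require Import Defs.
From HB Require Import structures.
From mathcomp Require Import all_boot all_order all_algebra.
From mathcomp Require Import all_classical all_reals all_analysis.
From mathcomp Require Import measurable_realfun lebesgue_integral ring lra.

(** Lower bound. For a curve [gam] of speed [n], Young's inequality gives
[action_eps E eps gam >= eps * \int n * slope E gam], and the right-hand side should
control [eps * `|E (gam 0) - E (gam 1)|], because the slope is an upper gradient. That
it is one comes from the flows: [slope_leP] shows that [slope E x <= sg] holds exactly
when [E x <= E z + sg * d - lambda / 2 * d ^+ 2] for all [z], with [d = mdist x z]. This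
is obtained by running the flow from [x], whose displacement over a short time is
controlled by the slope, and reading the evolution inequality along it. It also makes
the slope lower semicontinuous. The energy may fail to be absolutely continuous along
[gam], so [energy_drop_le] does not differentiate it: the finite-difference version of
the inequality, between the times [s] and [s + h], is integrated in [s], where it
telescopes, and [h] tends to 0. Applied to [gam] and to its reversal, this is
[energy_gap_le_action].

Equality. Along a flow the evolution inequality with the reference point [gam s], on the
interval [[s, s + h]], bounds [mdist (gam (s + h)) (gam s) ^+ 2] by the energy
dropped on that interval; integrating in [s], telescoping once more and letting [h] tend
to 0, one finds that the integral of the squared speed is at most the total energy drop
([evi_increment_sq_le], [speed_sq_le]). The slope is at most the speed
([slope_le_speed]). Run on [[0, 1]] at rate [eps], forwards or backwards, the flow
therefore has [action_eps] at most [eps] times its energy drop ([affine_flow_cost]), and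
by the lower bound it is optimal. The energy is finite at positive times
([flow_energy_finite]), so the formulas keep their meaning when the flow starts from a
point of infinite energy.

The speed of an absolutely continuous curve, needed in both parts, is constructed in
[metric_derivative] from the distances to a dense sequence of points of the curve.
*)

Set Implicit Arguments.
Unset Strict Implicit.
Unset Printing Implicit Defensive.

Import Order.TTheory GRing.Theory Num.Theory.
Import numFieldNormedType.Exports.

Local Open Scope classical_set_scope.
Local Open Scope ring_scope.

(** * Integrals up to null sets and under affine changes of variable *)

Section lower_integral.
Context d (T : measurableType d) {R : realType} (mu : {measure set T -> \bar R}).
Local Open Scope ereal_scope.
Import HBNNSimple.

(** Also holds for non-measurable integrands, since the integral of a nonnegative
function is a supremum over the simple functions below it, and cutting such a
function off the null set does not change its integral. This matters because
[metric_speed] is given by a choice of limit wherever the limit does not exist. *)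
Lemma ge0_le_integral_null (D N : set T) (f g : T -> \bar R) :
  measurable N -> mu N = 0 ->
  (forall x, D x -> 0 <= f x) -> (forall x, D x -> 0 <= g x) ->
  (forall x, D x -> ~ N x -> f x <= g x) ->
  \int[mu]_(x in D) f x <= \int[mu]_(x in D) g x.
Proof.
move=> mN N0 f0 g0 fg.
rewrite (ge0_integralE mu f0) (ge0_integralE mu g0).
apply: ge_ereal_sup => /= _ [h hf <-].
have h0 x : 0 <= (h x)%:E by rewrite lee_fin fun_ge0.
pose k := mul_nnsfun h (indic_nnsfun R (measurableC mN)).
have -> : sintegral mu h = sintegral mu k.
  rewrite -!integralT_nnsfun.
  apply: ge0_ae_eq_integral => //; [exact/measurable_EFinP|exact/measurable_EFinP| |].
    by move=> x _; rewrite lee_fin fun_ge0.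
  exists N; split => // x /=.
  apply: contra_notP => Nx _.
  by rewrite /= mindicE mem_set ?mulr1.
apply: ereal_sup_ubound; exists k => // x.
rewrite /= mindicE.
have [Nx|Nx] := pselect (N x).
  rewrite memNset ?mulr0; last by move=> /(_ Nx).
  by rewrite /patch; case: ifPn => // /set_mem /g0.
rewrite mem_set// mulr1; apply: le_trans (hf x) _.
by rewrite /patch; case: ifPn => // /set_mem Dx; exact: fg.
Qed.

Lemma ge0_eq_integral_null (D N : set T) (f g : T -> \bar R) :
  measurable N -> mu N = 0 ->
  (forall x, D x -> 0 <= f x) -> (forall x, D x -> 0 <= g x) ->
  (forall x, D x -> ~ N x -> f x = g x) ->
  \int[mu]_(x in D) f x = \int[mu]_(x in D) g x.
Proof.
move=> mN N0 f0 g0 fg; apply/eqP; rewrite eq_le; apply/andP; split;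
  by apply: (ge0_le_integral_null mN N0) => // x Dx Nx; rewrite fg.
Qed.

End lower_integral.

Section affine_change.
Context {R : realType}.
Local Notation mu := (@lebesgue_measure R).
Local Open Scope ereal_scope.

Definition affine (al be : R) (x : R) : R := (al * x + be)%R.

Lemma measurable_affine (al be : R) : measurable_fun setT (affine al be).
Proof.
by apply: measurable_funD => //; exact: measurable_funM.
Qed.

Let pushforward_affine (al be : R) : {measure set (measurableTypeR R) -> \bar R} :=
  measure_function_pushforward__canonical__measure_function_Measure mu
    (measurable_affine al be :
      measurable_fun setT (affine al be : measurableTypeR R -> measurableTypeR R)).

Lemma affine_preimage_itv (al be : R) (x y : R) : (0 < al)%R ->
  affine al be @^-1` `]x, y] = `]((x - be) / al)%R, ((y - be) / al)%R]%classic.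
Proof.
move=> al0; apply/seteqP; split => z /=; rewrite !in_itv/= /affine;
  by rewrite ltr_pdivrMr// ler_pdivlMr// ltrBlDr lerBrDr (mulrC z).
Qed.

Lemma lebesgue_measure_affine_pos (al be : R) : (0 < al)%R ->
  forall A : set R, measurable A ->
  mu A = al%:E * mu (affine al be @^-1` A).
Proof.
move=> al0 A mA.
pose nu := mscale (NngNum (ltW al0)) (pushforward_affine al be).
apply: (@lebesgue_measure_unique R nu) => //= _ [[a b]] _ <- /=.
rewrite /nu /mscale/= /pushforward affine_preimage_itv// !lebesgue_measure_itv/=.
rewrite !lte_fin ltr_pM2r ?invr_gt0// ltrD2r.
case: ifPn => ab; last by rewrite mule0.
rewrite -EFinB -EFinM; congr EFin; field; exact: lt0r_neq0.
Qed.

Lemma lebesgue_measure_affine (al be : R) : (al != 0)%R ->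
  forall A : set R, measurable A ->
  mu A = `|al|%:E * mu (affine al be @^-1` A).
Proof.
rewrite neq_lt => /orP[al0|al0] A mA; last first.
  by rewrite (lebesgue_measure_affine_pos be al0)// gtr0_norm.
rewrite ltr0_norm// -(lebesgue_measureN mA) /pushforward.
have al0' : (0 < - al)%R by rewrite oppr_gt0.
have mA' : measurable ((-%R : R -> R) @^-1` A).
  by rewrite -[X in measurable X]setTI; exact: oppr_measurable.
rewrite (lebesgue_measure_affine_pos (- be) al0' mA').
congr (_ * mu _); apply/seteqP; split => x /=; rewrite /affine;
 by rewrite mulNr -opprD opprK.
Qed.

Lemma null_set_affine (al be : R) (N : set R) : (al != 0)%R ->
  measurable N -> mu N = 0 ->
  measurable (affine al be @^-1` N) /\ mu (affine al be @^-1` N) = 0.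
Proof.
move=> al0 mN N0; split.
  by rewrite -[X in measurable X]setTI; exact: measurable_affine.
have := lebesgue_measure_affine be al0 mN.
rewrite N0 => /esym/eqP; rewrite mule_eq0 eqe normr_eq0 (negbTE al0)/=.
by move/eqP.
Qed.

Lemma ge0_integral_affine (al be : R) (D : set R) (f : R -> \bar R) :
  (al != 0)%R -> measurable D -> measurable_fun D f ->
  (forall x, D x -> 0 <= f x) ->
  \int[mu]_(x in D) f x =
  `|al|%:E * \int[mu]_(x in affine al be @^-1` D) f (affine al be x).
Proof.
move=> al0 mD mf f0.
have mphi : measurable_fun setT (affine al be : measurableTypeR R -> measurableTypeR R).
  exact: measurable_affine.
rewrite -(ge0_integral_pushforward mphi)//; last by move=> y /set_mem; exact: f0.
pose k := NngNum (normr_ge0 al).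
rewrite -(ge0_integral_mscale (pushforward_affine al be) mD k)//.
apply: eq_measure_integral => A mA _.
exact: lebesgue_measure_affine.
Qed.

Lemma ge0_integral_itv_split (a b c : R) (f : R -> \bar R) :
  (a <= b)%R -> (b <= c)%R -> measurable_fun `[a, c] f ->
  (forall x, (a <= x <= c)%R -> 0 <= f x) ->
  \int[mu]_(x in `[a, c]) f x =
  \int[mu]_(x in `[a, b]) f x + \int[mu]_(x in `[b, c]) f x.
Proof.
move=> ab bc mf f0.
have -> : `[a, c]%classic = `[a, b] `|` `]b, c] :> set R.
  by rewrite -(@itv_bndbnd_setU _ _ (BLeft a) (BRight b) (BRight c)) ?bnd_simp.
have sub1 : (`[a, b]%classic : set R) `<=` (`[a, c]%classic : set R).
  by apply: subset_itvl; rewrite bnd_simp.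
have sub2 : (`]b, c]%classic : set R) `<=` (`[a, c]%classic : set R).
  by apply: subset_itvr; rewrite bnd_simp.
rewrite ge0_integral_setU//.
- congr (_ + _); rewrite -integral_itv_obnd_cbnd//.
  exact: measurable_funS sub2 mf.
- by rewrite measurable_funU//; split; [exact: measurable_funS sub1 mf|exact: measurable_funS sub2 mf].
- by move=> x [/sub1|/sub2]/=; rewrite in_itv/=; exact: f0.
- apply/disj_setPS => x /= []; rewrite !in_itv/= => /andP[_ xb] /andP[bx _].
  by move: (le_lt_trans xb bx); rewrite ltxx.
Qed.

Lemma ge0_integral_shift (a b h : R) (f : R -> \bar R) :
  measurable_fun `[(a + h)%R, (b + h)%R] f ->
  (forall x, (a + h <= x <= b + h)%R -> 0 <= f x) ->
  \int[mu]_(x in `[a, b]) f (x + h)%R = \int[mu]_(x in `[(a + h)%R, (b + h)%R]) f x.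
Proof.
move=> mf f0.
rewrite [RHS](@ge0_integral_affine 1 h)//.
rewrite normr1 mul1e.
have -> : affine 1 h @^-1` `[(a + h)%R, (b + h)%R]%classic = `[a, b]%classic.
  by apply/seteqP; split => x /=; rewrite !in_itv/= /affine mul1r !lerD2r.
by apply: eq_integral => x _; rewrite /affine mul1r.
Qed.

(** Both sides are the integral of [f] over [[a, b + h]], split at [a + h] on the left
and at [b] on the right. Averaging a finite difference over [[a, b]] thus leaves
only two integrals over intervals of length [h]. *)
Lemma ge0_integral_shift_swap (a b h : R) (f : R -> \bar R) :
  (a <= b)%R -> (0 <= h)%R ->
  measurable_fun `[a, (b + h)%R] f ->
  (forall x, (a <= x <= b + h)%R -> 0 <= f x) ->
  \int[mu]_(x in `[a, b]) f (x + h)%R + \int[mu]_(x in `[a, (a + h)%R]) f x =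
  \int[mu]_(x in `[a, b]) f x + \int[mu]_(x in `[b, (b + h)%R]) f x.
Proof.
move=> ab h0 mf f0.
have sub2 : (`[(a + h)%R, (b + h)%R]%classic : set R) `<=` (`[a, (b + h)%R]%classic : set R).
  by apply: subset_itvr; rewrite bnd_simp lerDl.
rewrite ge0_integral_shift; last 2 first.
- exact: measurable_funS sub2 mf.
- by move=> x xb; apply: f0; have := sub2 x; rewrite /= !in_itv/=; exact.
rewrite addeC -!ge0_integral_itv_split//; first by rewrite lerDl.
- by rewrite lerDl.
- by rewrite lerD2r.
Qed.

End affine_change.

(** * Densities of absolutely continuous functions *)

Section clamp.
Context {R : realDomainType}.
Implicit Types a b x y : R.

(** Composing with the projection onto [[a, b]] turns a curve on an interval into a
curve on the line that is constant outside. *)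
Definition clamp a b x : R := Num.max a (Num.min x b).

Lemma clamp_ge a b x : a <= clamp a b x.
Proof. by rewrite /clamp le_max lexx. Qed.

Lemma clamp_le a b x : a <= b -> clamp a b x <= b.
Proof. by move=> ab; rewrite /clamp ge_max ab ge_min lexx orbT. Qed.

Lemma clamp_id a b x : a <= x -> x <= b -> clamp a b x = x.
Proof. by move=> ax xb; rewrite /clamp min_l// max_r. Qed.

Lemma clamp_above a b x : a <= b -> b <= x -> clamp a b x = b.
Proof. by move=> ab bx; rewrite /clamp min_r// max_r. Qed.

Lemma clamp_below a b x : a <= b -> x <= a -> clamp a b x = a.
Proof. by move=> ab xa; rewrite /clamp min_l ?(le_trans xa)// max_l. Qed.

Lemma clamp_homo a b x y : x <= y -> clamp a b x <= clamp a b y.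
Proof.
move=> xy; rewrite /clamp ge_max !le_max lexx/=; apply/orP; right.
by rewrite le_min !ge_min xy lexx orbT.
Qed.

(** The clamped interval is either reduced to a point or contained in the original
one, hence increments that are dominated on [[a, b]] stay dominated after clamping. *)
Lemma clamp_expand a b x y : a <= b -> x <= y ->
  clamp a b x = clamp a b y \/ (x <= clamp a b x /\ clamp a b y <= y).
Proof.
move=> ab xy; have [ay|ya] := leP a y; last first.
  by left; rewrite !clamp_below// ltW// (le_lt_trans xy).
have [xb|bx] := leP x b; last first.
  by left; rewrite !clamp_above// ltW// (lt_le_trans bx).
right; split; first by rewrite /clamp min_l// le_max lexx orbT.
by rewrite /clamp ge_max ay ge_min lexx.
Qed.

End clamp.

Section primitives.
Context {R : realType}.
Local Notation mu := (@lebesgue_measure R).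
Implicit Types (f g k m : R -> R) (a b s t x y : R).

Lemma integrable_sub_itv f (D : set R) (i : interval R) :
  measurable D -> mu.-integrable D (EFin \o f) -> [set` i] `<=` D ->
  mu.-integrable [set` i] (EFin \o f).
Proof.
move=> mD fi iD; have mi : measurable [set` i] by exact: measurable_itv.
exact: (@integrableS _ (measurableTypeR R) R mu D [set` i] (EFin \o f)).
Qed.

Lemma Rintegral_itv_cat a b c f : a <= b -> b <= c ->
  mu.-integrable `[a, c] (EFin \o f) ->
  \int[mu]_(x in `[a, c]) f x =
  \int[mu]_(x in `[a, b]) f x + \int[mu]_(x in `[b, c]) f x.
Proof.
move=> ab bc fi.
have := @Rintegral_itvB R f (BLeft a) (BRight c) b fi.
rewrite !bnd_simp => /(_ ab bc) /eqP.
rewrite subr_eq => /eqP ->; rewrite addrC; congr (_ + _).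
rewrite Rintegral_itv_obnd_cbnd//.
apply: (integrable_sub_itv _ fi) => //.
by apply: subset_itvr; rewrite bnd_simp.
Qed.

Lemma Rintegral_itv_oc a b f : mu.-integrable `[a, b] (EFin \o f) ->
  \int[mu]_(x in `]a, b]) f x = \int[mu]_(x in `[a, b]) f x.
Proof.
move=> fi; rewrite Rintegral_itv_obnd_cbnd//.
apply: (integrable_sub_itv _ fi) => //; exact: subset_itv_oc_cc.
Qed.

Lemma primitive_increment k x y : mu.-integrable setT (EFin \o k) -> x <= y ->
  \int[mu]_(t in `]-oo, y]) k t - \int[mu]_(t in `]-oo, x]) k t =
  \int[mu]_(t in `]x, y]) k t.
Proof.
move=> ki xy; have ky : mu.-integrable `]-oo, y] (EFin \o k).
  exact: (integrable_sub_itv _ ki).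
exact: (@Rintegral_itvB R k (BInfty _ true) (BRight y) x ky isT).
Qed.

Lemma primitive_continuous k : mu.-integrable setT (EFin \o k) ->
  continuous (fun x => \int[mu]_(t in `]-oo, x]) k t).
Proof.
move=> ki x.
pose a := x - 1; pose b := x + 1.
have ab : a < b by rewrite /a /b; lra.
have ki' : mu.-integrable `[a, b] (EFin \o k) by exact: (integrable_sub_itv _ ki).
have /(continuous_within_itvP _ ab)[+ _ _] :=
  parameterized_integral_continuous (ltW ab) ki'.
have xab : x \in `]a, b[ by rewrite in_itv/= /a /b; lra.
move=> /(_ x xab) cx.
have E : \forall y \near x, \int[mu]_(t in `]-oo, y]) k t =
    \int[mu]_(t in `]-oo, a]) k t + parameterized_integral mu a y k.
  near=> y.
  have ay : a <= y.
    apply: ltW; near: y; apply: lt_nbhsr; rewrite /a; lra.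
  have ky : mu.-integrable `]-oo, y] (EFin \o k) by exact: (integrable_sub_itv _ ki).
  have := @Rintegral_itvB R k (BInfty _ true) (BRight y) a ky isT.
  rewrite bnd_simp => /(_ ay) /eqP; rewrite subr_eq => /eqP ->.
  rewrite addrC; congr (_ + _); rewrite Rintegral_itv_oc//.
  exact: (integrable_sub_itv _ ki).
rewrite /continuous_at (nbhs_singleton E).
apply: cvg_trans (cvgD (cvg_cst _) cx).
by apply: near_eq_cvg; near=> y; apply/esym; near: y.
Unshelve. all: by end_near. Qed.

Lemma stieltjes_ocitv (F : cumulative R R) a b : a <= b ->
  lebesgue_stieltjes_measure F `]a, b]%classic = (F b - F a)%:E.
Proof.
move=> ab.
rewrite /lebesgue_stieltjes_measure/= /measure_extension measurable_mu_extE/=; last first.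
  exact: is_ocitv.
by rewrite wlength_itv_bnd.
Qed.

(** Both [F] and the difference of a primitive of [k] with [F] are nondecreasing and
right-continuous, so they define Stieltjes measures whose sum is the measure of
density [k]. The measure of [F] is therefore absolutely continuous, and its
Radon-Nikodym derivative is the density sought. *)
Lemma density_of_dominated_increments k (F : R -> R) :
  mu.-integrable setT (EFin \o k) -> (forall x, 0 <= k x) ->
  (forall x y, x <= y -> 0 <= F y - F x <= \int[mu]_(t in `]x, y]) k t) ->
  exists g : R -> R, mu.-integrable setT (EFin \o g) /\
    forall x y, x <= y -> F y - F x = \int[mu]_(t in `]x, y]) g t.
Proof.
move=> ki k0 Fk.
pose K x := \int[mu]_(t in `]-oo, x]) k t.
have KE x y : x <= y -> K y - K x = \int[mu]_(t in `]x, y]) k t.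
  exact: primitive_increment.
have Kc : continuous K by exact: primitive_continuous.
have Fc : right_continuous F.
  apply/right_continuousW => x; apply/cvgrPdist_le => e e0.
  have := Kc x => /cvgrPdist_le /(_ _ e0); apply: filterS => y.
  have [xy|/ltW yx] := leP x y.
    rewrite (distrC (K x)) (distrC (F x)); have := Fk _ _ xy; rewrite -(KE _ _ xy) => /andP[h1 h2].
    by rewrite !ger0_norm// ?(le_trans h1)//; apply: le_trans.
  have := Fk _ _ yx; rewrite -(KE _ _ yx) => /andP[h1 h2].
  by rewrite !ger0_norm// ?(le_trans h1)//; apply: le_trans.
have Fnd : nondecreasing F.
  by move=> x y xy; have /andP[+ _] := Fk _ _ xy; rewrite subr_ge0.
have Gnd : nondecreasing (K \- F).
  move=> x y xy /=; have /andP[_] := Fk _ _ xy; rewrite -(KE _ _ xy).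
  by rewrite -subr_ge0 => h; rewrite -subr_ge0; apply: le_trans h _; lra.
have Knd : nondecreasing K.
  move=> x y xy; rewrite -subr_ge0 KE//; apply: Rintegral_ge0 => t _; exact: k0.
have Kr : right_continuous K by exact: right_continuousW.
have Gr : right_continuous (K \- F).
  by move=> x; apply: cvgB; [exact: Kr|exact: Fc].
pose cF : cumulative R R := HB.pack F (isCumulative.Build R _ R F Fnd Fc).
pose cG : cumulative R R := HB.pack (K \- F) (isCumulative.Build R _ R (K \- F) Gnd Gr).
pose cK : cumulative R R := HB.pack K (isCumulative.Build R _ R K Knd Kr).
pose nuF := lebesgue_stieltjes_measure cF.
pose nuG := lebesgue_stieltjes_measure cG.
have k0' (A : set (measurableTypeR R)) : (0 <= induced_charge ki A)%E.
  by apply: integral_ge0 => x _; rewrite lee_fin.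
pose kap : {measure set (measurableTypeR R) -> \bar R} := measure_of_charge _ k0'.
have kapE A : measurable A -> kap A = (nuF A + nuG A)%E.
  move=> mA; rewrite -measure_addE.
  have kK : forall X, ocitv X -> lebesgue_stieltjes_measure cK X = kap X.
    move=> _ [[x y] _ <-]/=; have [xy|yx] := leP x y; last first.
      by rewrite set_itv_ge ?measure0// bnd_simp -leNgt ltW.
    rewrite stieltjes_ocitv//= /kap /measure_of_charge /= KE//.
    rewrite /Rintegral fineK//; apply: integrable_fin_num => //.
    exact: (integrable_sub_itv _ ki).
  rewrite -(lebesgue_stieltjes_measure_unique kK mA).
  apply: (@lebesgue_stieltjes_measure_unique _ cK (measure_add nuF nuG)) => //.
  move=> _ [[x y] _ <-]; rewrite [RHS]measure_addE /fst /snd.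
  have [xy|yx] := leP x y; last first.
    by rewrite set_itv_ge ?measure0 ?adde0// bnd_simp -leNgt ltW.
  transitivity ((F y - F x)%:E + ((K y - F y) - (K x - F x))%:E)%E; last first.
    by congr (_ + _)%E; apply/esym/(stieltjes_ocitv _ xy).
  by rewrite stieltjes_ocitv//= -EFinD; congr EFin; ring.
have nuF_le A : measurable A -> (nuF A <= kap A)%E.
  by move=> mA; rewrite kapE// leeDl.
have nuF_fin : fin_num_fun nuF.
  move=> A mA; rewrite ge0_fin_numE//; apply: le_lt_trans (nuF_le _ mA) _.
  rewrite -ge0_fin_numE//; apply: integrable_fin_num => //.
  exact: (integrableS measurableT).
pose nu : {finite_measure set (measurableTypeR R) -> \bar R} :=
  HB.pack nuF (Measure_isFinite.Build _ _ _ nuF nuF_fin).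
have nu_mu : nu `<< mu.
  apply/null_content_dominatesP => A mA A0; apply/eqP.
  rewrite eq_le measure_ge0 andbT; apply: le_trans (nuF_le _ mA) _.
  by change (\int[mu]_(x in A) (k x)%:E <= 0)%E; rewrite null_set_integral//; exact: measurable_funTS (measurable_int _ ki).
have [g [g0 gfin gi gE]] := radon_nikodym_sigma_finite nu_mu.
have gfE : EFin \o (fine \o g) = g.
  by apply/funext => x /=; rewrite fineK.
exists (fine \o g); split; first by rewrite gfE.
move=> x y xy; rewrite /Rintegral.
under eq_integral do rewrite /= fineK//.
by rewrite -gE// /nu/= /nuF stieltjes_ocitv.
Qed.

(** An absolutely continuous [f] becomes nondecreasing once a primitive of the
dominating [m] is added to it; the increments of the sum are dominated by [2 m]. *)
Lemma absolutely_continuous_density a b f m : a <= b ->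
  mu.-integrable `[a, b] (EFin \o m) ->
  (forall s t, a <= s -> s <= t -> t <= b ->
     `|f t - f s| <= \int[mu]_(r in `[s, t]) m r) ->
  exists g : R -> R, mu.-integrable setT (EFin \o g) /\
    forall s t, a <= s -> s <= t -> t <= b -> f t - f s = \int[mu]_(r in `[s, t]) g r.
Proof.
move=> ab mi fm.
pose k := (fun x => `|m x|) \_ `[a, b].
have ki : mu.-integrable setT (EFin \o k).
  rewrite /k -restrict_EFin -integrable_mkcond//.
  exact: integrable_norm.
have k0 x : 0 <= k x.
  by rewrite /k patchE; case: ifP.
have kI s t : a <= s -> s <= t -> t <= b ->
    \int[mu]_(r in `[s, t]) m r <= \int[mu]_(r in `]s, t]) k r.
  move=> sa st tb.
  have sub : `[s, t]%classic `<=` (`[a, b]%classic : set R).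
    by apply: subset_itv; rewrite bnd_simp.
  rewrite Rintegral_itv_oc; last exact: (integrable_sub_itv _ ki).
  apply: le_Rintegral => //.
  - exact: (integrable_sub_itv _ mi).
  - exact: (integrable_sub_itv _ ki).
  - move=> x xst; rewrite /k patchE mem_set//; last exact: sub.
    exact: ler_norm.
pose c x := clamp a b x.
pose K x := \int[mu]_(t in `]-oo, x]) k t.
have KE x y : x <= y -> K y - K x = \int[mu]_(t in `]x, y]) k t.
  exact: primitive_increment.
have cK x y : x <= y -> `|f (c y) - f (c x)| <= K y - K x.
  move=> xy.
  have Kxy : 0 <= K y - K x by rewrite KE//; apply: Rintegral_ge0 => t _; exact: k0.
  have [cE|[h3 h4]] := clamp_expand ab xy; first by rewrite /c cE subrr normr0.
  have h1 : a <= c x := clamp_ge a b x.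
  have h2 : c y <= b := clamp_le y ab.
  have cxy : c x <= c y := clamp_homo a b xy.
  apply: le_trans (fm _ _ h1 cxy h2) _.
  apply: le_trans (kI _ _ h1 cxy h2) _.
  rewrite -KE//.
  have m1 : 0 <= K y - K (c y) by rewrite KE//; apply: Rintegral_ge0 => t _; exact: k0.
  have m2 : 0 <= K (c x) - K x by rewrite KE//; apply: Rintegral_ge0 => t _; exact: k0.
  lra.
have k2i : mu.-integrable setT (EFin \o (fun x => 2 * k x)).
  by have := integrableZl measurableT 2 ki; apply: eq_integrable.
have k20 x : 0 <= 2 * k x by rewrite mulr_ge0.
have [|g [gi gE]] := @density_of_dominated_increments (fun x => 2 * k x) (fun x => f (c x) + K x) k2i k20.
  move=> x y xy; rewrite RintegralZl//; last exact: (integrable_sub_itv _ ki).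
  by have := cK _ _ xy; rewrite -KE// ler_norml; lra.
exists (g \- k); split.
  by have := integrableB measurableT gi ki; apply: eq_integrable.
move=> s t sa st tb.
have gi' := integrable_sub_itv measurableT gi (@subsetT _ `[s, t]%classic).
have ki' := integrable_sub_itv measurableT ki (@subsetT _ `[s, t]%classic).
rewrite RintegralB//.
rewrite -!Rintegral_itv_oc// -gE// -KE//.
have cs x : a <= x -> x <= b -> c x = x.
  exact: clamp_id.
by rewrite !cs//; try lra; rewrite ?(le_trans sa)// ?(le_trans st).
Qed.

End primitives.

Section almost_everywhere_tools.
Context d (T : measurableType d) {R : realType} (mu : {measure set T -> \bar R}).
Implicit Types P Q : T -> Prop.

Lemma ae_imp P Q : (forall t, P t -> Q t) ->
  {ae mu, forall t, P t} -> {ae mu, forall t, Q t}.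
Proof. by move=> PQ; apply: negligibleS => t /= nQ /PQ. Qed.

Lemma ae_and P Q : {ae mu, forall t, P t} -> {ae mu, forall t, Q t} ->
  {ae mu, forall t, P t /\ Q t}.
Proof.
move=> p q; have := negligibleU p q.
by apply: negligibleS => t /= /not_andP.
Qed.

Lemma ae_null P : {ae mu, forall t, P t} ->
  exists N, [/\ measurable N, mu N = 0%E & forall t, ~ N t -> P t].
Proof.
move=> [N [mN N0 PN]]; exists N; split => // t Nt.
by apply: contrapT => nP; apply/Nt/PN.
Qed.

Lemma null_ae P (N : set T) : measurable N -> mu N = 0%E ->
  (forall t, ~ N t -> P t) -> {ae mu, forall t, P t}.
Proof.
move=> mN N0 NP; exists N; split => // t /= nP.
by apply: contrapT => /NP.
Qed.

End almost_everywhere_tools.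

Section lebesgue_points.
Context {R : realType}.
Local Notation mu := (@lebesgue_measure R).
Implicit Types (f g k m : R -> R) (a b s t x y : R).

Lemma derivable_quotient f x : derivable f x 1 ->
  (f (x + h) - f x) / h @[h --> 0^'] --> f^`()%classic x.
Proof.
move=> fx; rewrite /derive1 /=.
have -> : (fun h : R => (f (x + h) - f x) / h) =
          (fun h : R => h^-1 *: (f (h + x) - f x)).
  by apply/funext => h; rewrite mulrC (addrC x h).
move: fx; rewrite /derivable.
suff -> : (fun h : R => h^-1 *: ((f \o shift x) (h *: (1 : R)) - f x)) =
          (fun h : R => h^-1 *: (f (h + x) - f x)) by [].
by apply/funext => h /=; rewrite /GRing.scale/= mulr1.
Qed.

(** Lets the endpoints of an interval be discarded, where quotients are one-sided. *)
Lemma ae_neq s : {ae mu, forall r, r != s}.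
Proof.
exists [set s]; split => //=; first exact: lebesgue_measure_set1.
by move=> r /= /negP; rewrite negbK => /eqP.
Qed.

Lemma ae_quotient_primitive g : mu.-integrable setT (EFin \o g) ->
  {ae mu, forall t,
    (\int[mu]_(r in `]-oo, (t + h)%R]) g r - \int[mu]_(r in `]-oo, t]) g r) / h
      @[h --> 0^'] --> g t}.
Proof.
move=> gi.
have := @FTC1Ny R g (fun y => integrable_sub_itv measurableT gi (@subsetT _ _))
  (open_integrable_locally openT gi).
apply: ae_imp => t [+ <-].
exact: (@derivable_quotient (fun x => \int[mu]_(r in `]-oo, x]) g r)).
Qed.

Lemma ae_quotient_density a b f g : mu.-integrable setT (EFin \o g) ->
  (forall s t, a <= s -> s <= t -> t <= b -> f t - f s = \int[mu]_(r in `[s, t]) g r) ->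
  {ae mu, forall t, a < t < b -> (f (t + h) - f t) / h @[h --> 0^'] --> g t}.
Proof.
move=> gi fg; apply: ae_imp (ae_quotient_primitive gi) => t cg /andP[at_ tb].
apply: cvg_trans cg; apply: near_eq_cvg.
pose G x := \int[mu]_(r in `]-oo, x]) g r.
have GE x y : x <= y -> G y - G x = \int[mu]_(r in `[x, y]) g r.
  move=> xy; rewrite -Rintegral_itv_oc; last exact: (integrable_sub_itv _ gi).
  apply: (@Rintegral_itvB R g (BInfty _ true) (BRight y) x) => //.
  exact: (integrable_sub_itv _ gi).
near=> h; congr (_ / _).
have [h1 h2] : a <= t + h /\ t + h <= b.
  have : `|h| <= Num.min (t - a) (b - t).
    near: h; apply: dnbhs0_le; rewrite lt_min; lra.
  rewrite le_min => /andP[].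
  by rewrite !ler_norml; lra.
rewrite -/(G _) -/(G _).
have [h0|h0] := leP 0 h.
  by rewrite GE ?fg//; lra.
have e1 : f t - f (t + h) = G t - G (t + h) by rewrite GE ?fg//; lra.
by rewrite -opprB -e1 opprB.
Unshelve. all: by end_near. Qed.

End lebesgue_points.

(** * Absolutely continuous curves and their speed *)

Section metric_derivative.
Context {R : realType} {X : metricType R}.
Local Notation mu := (@lebesgue_measure R).
Implicit Types (gam : R -> X) (f g m : R -> R) (a b s t x y : R).

Lemma ac_onP a b gam : ac_on a b gam -> exists m, [/\ (forall r, 0 <= m r),
  mu.-integrable setT (EFin \o m) &
  forall s t, a <= s -> s <= t -> t <= b ->
    mdist (gam s) (gam t) <= \int[mu]_(r in `[s, t]) m r].
Proof.
move=> [m mi gm]; pose k := (fun x => `|m x|) \_ `[a, b].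
have ki : mu.-integrable setT (EFin \o k).
  rewrite /k -restrict_EFin -integrable_mkcond//.
  exact: integrable_norm.
have k0 x : 0 <= k x.
  by rewrite /k patchE; case: ifP.
exists k; split => // s t sa st tb.
have sub : `[s, t]%classic `<=` (`[a, b]%classic : set R).
  by apply: subset_itv; rewrite bnd_simp.
have mi' : mu.-integrable `[s, t] (EFin \o m) by exact: (integrable_sub_itv _ mi).
apply: (@le_trans _ _ (\int[mu]_(r in `[s, t]) m r)).
  rewrite -lee_fin; apply: le_trans (gm _ _ sa st tb) _.
  by rewrite /Rintegral fineK//; apply: integrable_fin_num.
apply: le_Rintegral => //.
- exact: (integrable_sub_itv _ ki).
- move=> x xst; rewrite /k patchE mem_set//; last exact: sub.
  exact: ler_norm.
Qed.

Lemma mdist_triangleB (x y z : X) : `|mdist x z - mdist y z| <= mdist x y.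
Proof.
have h1 := metric_triangle x y z; have h2 := metric_triangle y x z.
by move: h2; rewrite (metric_sym y x) ler_norml; lra.
Qed.

Lemma rational_sequence a b : a < b -> exists q : nat -> R,
  (forall i, a <= q i <= b) /\
  (forall s t, a <= s -> s < t -> t <= b -> exists i, s < q i < t).
Proof.
move=> ab.
exists (fun k => clamp a b (ratr (odflt 0 (unpickle k : option rat)))); split.
  by move=> k; rewrite clamp_ge clamp_le// ltW.
move=> s t sa st tb; have [r] := rat_in_itvoo st; rewrite in_itv/= => /andP[sr rt].
exists (pickle r); rewrite pickleK /= clamp_id ?sr//.
  by rewrite ltW// (le_lt_trans sa).
by rewrite ltW// (lt_le_trans rt).
Qed.

Lemma incr_sym a b f (F m : R -> R) :
  (forall s t, a <= s -> s <= t -> t <= b -> `|f t - f s| <= \int[mu]_(r in `[s, t]) m r) ->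
  (forall s t, a <= s -> s <= t -> t <= b -> F t - F s = \int[mu]_(r in `[s, t]) m r) ->
  forall u v, a <= u <= b -> a <= v <= b -> `|f v - f u| <= `|F v - F u|.
Proof.
move=> fm FE u v /andP[au ub] /andP[av vb].
have [uv|/ltW vu] := leP u v.
  by apply: le_trans (fm _ _ au uv vb) _; rewrite -FE// ler_norm.
rewrite distrC (distrC (F v)).
by apply: le_trans (fm _ _ av vu ub) _; rewrite -FE// ler_norm.
Qed.

Lemma incr_sym_dist a b gam (F m : R -> R) :
  (forall s t, a <= s -> s <= t -> t <= b -> mdist (gam s) (gam t) <= \int[mu]_(r in `[s, t]) m r) ->
  (forall s t, a <= s -> s <= t -> t <= b -> F t - F s = \int[mu]_(r in `[s, t]) m r) ->
  forall u v, a <= u <= b -> a <= v <= b -> mdist (gam u) (gam v) <= `|F v - F u|.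
Proof.
move=> fm FE u v /andP[au ub] /andP[av vb].
have [uv|/ltW vu] := leP u v.
  by apply: le_trans (fm _ _ au uv vb) _; rewrite -FE// ler_norm.
rewrite distrC metric_sym.
by apply: le_trans (fm _ _ av vu ub) _; rewrite -FE// ler_norm.
Qed.

(** For a dense sequence of times [q k], the distances to the points [gam (q k)] are
real absolutely continuous functions, with densities [g k]. The supremum [n] of the
[`|g k|] bounds the increments of [gam], because the distance to [gam (q k)] with
[q k] close to [s] recovers [mdist (gam s) (gam t)]; and each [`|g k t|] bounds the
lower limit of the quotients from below. Hence the limit exists and equals [n]
almost everywhere. *)
Lemma metric_derivative a b gam : a < b -> ac_on a b gam ->
  exists n : R -> R, [/\ (forall t, 0 <= n t), mu.-integrable setT (EFin \o n),
    (forall s t, a <= s -> s <= t -> t <= b ->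
      mdist (gam s) (gam t) <= \int[mu]_(r in `[s, t]) n r) &
    {ae mu, forall t, a < t < b ->
      mdist (gam (t + h)) (gam t) / `|h| @[h --> 0^'] --> n t}].
Proof.
move=> ab /ac_onP[m [m0 mi gm]].
have [q [qab qd]] := rational_sequence ab.
pose phi k t := mdist (gam t) (gam (q k)).
have phil k s t : a <= s -> s <= t -> t <= b ->
    `|phi k t - phi k s| <= \int[mu]_(r in `[s, t]) m r.
  move=> sa st tb; apply: le_trans (gm _ _ sa st tb).
  by rewrite distrC; exact: mdist_triangleB.
have iab f : mu.-integrable setT (EFin \o f) ->
    forall s t, mu.-integrable `[s, t] (EFin \o f).
  by move=> fi s t; exact: (integrable_sub_itv _ fi).
have /choice[g gP] k := absolutely_continuous_density (ltW ab) (iab _ mi a b) (phil k).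
pose M t := \int[mu]_(r in `[a, t]) m r.
have ME s t : a <= s -> s <= t -> t <= b -> M t - M s = \int[mu]_(r in `[s, t]) m r.
  move=> sa st _; rewrite /M (@Rintegral_itv_cat _ a s t)//; last exact: iab.
  by rewrite addrAC subrr add0r.
(* Truncating at m, which changes the supremum on a null set only, keeps it finite
   at every point. *)
pose n t := sups (fun k => Num.min `|g k t| (m t)) 0.
have nub t : has_ubound (range (fun k => Num.min `|g k t| (m t))).
  by exists (m t) => _ [k _ <-]; rewrite ge_min lexx orbT.
have n_ge k t : Num.min `|g k t| (m t) <= n t.
  by apply: ub_le_sup; [exact: has_ubound_sdrop|exists k].
have n_le t : n t <= m t.
  apply: ge_sup; first by exists (Num.min `|g 0%N t| (m t)); exists 0%N.
  by move=> _ [k _ <-]; rewrite ge_min lexx orbT.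
have n0 t : 0 <= n t.
  by apply: le_trans (n_ge 0%N t); rewrite le_min normr_ge0 m0.
have mn : measurable_fun setT n.
  apply: measurable_fun_sups => // k; apply: measurable_minr.
    apply: measurableT_comp => //.
    by have [/measurable_int/measurable_EFinP + _] := gP k.
  by move: mi => /measurable_int/measurable_EFinP.
have ni : mu.-integrable setT (EFin \o n).
  apply: le_integrable mi => //; first exact/measurable_EFinP.
  by move=> t _ /=; rewrite lee_fin !ger0_norm.
pose N t := \int[mu]_(r in `[a, t]) n r.
have NE s t : a <= s -> s <= t -> t <= b -> N t - N s = \int[mu]_(r in `[s, t]) n r.
  move=> sa st _; rewrite /N (@Rintegral_itv_cat _ a s t)//; last exact: iab.
  by rewrite addrAC subrr add0r.
have A1 : {ae mu, forall t, forall k, a < t < b ->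
    (phi k (t + h) - phi k t) / h @[h --> 0^'] --> g k t}.
  apply: ae_foralln => k; have [gi gE] := gP k.
  exact: ae_quotient_density gi gE.
have A2 := ae_quotient_density mi ME.
have A3 := ae_quotient_density ni NE.
have near_ab t : a < t < b -> \forall h \near 0^', h != 0 /\ (a <= t + h <= b).
  move=> /andP[at_ tb]; near=> h; split; first by near: h; exact: nbhs_dnbhs_neq.
  have : `|h| <= Num.min (t - a) (b - t).
    near: h; apply: dnbhs0_le; rewrite lt_min; lra.
  rewrite le_min => /andP[].
  by rewrite !ler_norml; lra.
have g_le_n : {ae mu, forall t, a < t < b -> forall k, `|g k t| <= n t}.
  apply: ae_imp (ae_and A1 A2) => t [c1 c2] tab k.
  suff gm' : `|g k t| <= m t.
    by have := n_ge k t; rewrite min_l.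
  have tab' : a <= t <= b by case/andP: tab => /ltW -> /ltW ->.
  rewrite -[m t]ger0_norm//.
  apply: (ler_cvg_to (cvg_norm (c1 k tab)) (cvg_norm (c2 tab))).
  near=> h.
  have [h0 thab] : h != 0 /\ (a <= t + h <= b) by near: h; exact: near_ab.
  by rewrite !normrM ler_wpM2r// (incr_sym (phil k) ME).
have dn s t : a <= s -> s <= t -> t <= b ->
    mdist (gam s) (gam t) <= \int[mu]_(r in `[s, t]) n r.
  move=> sa; rewrite le_eqVlt => /predU1P[->|st] tb.
    by rewrite mdistxx; apply: Rintegral_ge0 => r _; exact: n0.
  rewrite -(NE _ _ sa (ltW st) tb); apply/ler_addgt0Pr => e e0.
  have Mc : continuous (fun x => \int[mu]_(r in `]-oo, x]) m r) by exact: primitive_continuous.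
  (* A time q k just after s: reaching it from s costs at most e. *)
  have [q0 [sq qt Mq]] : exists k, [/\ s < q k, q k < t & M (q k) - M s <= e].
    have /cvgrPdist_le /(_ _ e0) := Mc s.
    move=> /nbhs_ballP[de /= de0 deM].
    have [k /andP[sk kt]] : exists k, s < q k < Num.min t (s + de).
      by apply: qd => //; rewrite ?lt_min ?st ?ltrDl// ge_min tb.
    move: kt; rewrite lt_min => /andP[kt kde].
    exists k; split => //.
    have := deM (q k); rewrite /ball/= ltr_norml => /(_ _).
    rewrite ME//; [|lra|by case/andP: (qab k)].
    move=> /(_ ltac:(lra)); rewrite distrC ler_norml => /andP[_].
    rewrite -(@Rintegral_itv_oc _ s); last exact: iab.
    rewrite (@Rintegral_itvB R m (BInfty _ true) (BRight (q k)) s)//; last by rewrite bnd_simp ltW.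
    exact: (integrable_sub_itv _ mi).
  have qkab := qab q0.
  apply: le_trans (metric_triangle _ (gam (q q0)) _) _; rewrite addrC lerD//.
    have -> : mdist (gam (q q0)) (gam t) = phi q0 t - phi q0 (q q0).
      by rewrite /phi mdistxx subr0 metric_sym.
    have [gi gE] := gP q0.
    rewrite gE; [|lra|lra|lra].
    apply: (@le_trans _ _ (\int[mu]_(r in `[(q q0), t]) n r)); last first.
      rewrite -!NE//; try lra.
      rewrite lerD2l lerN2 -subr_ge0 NE//; try lra.
      by apply: Rintegral_ge0 => r _; exact: n0.
    apply: le_trans (ler_norm _) _.
    apply: le_trans (le_normr_Rintegral _ _) _ => //; first exact: iab.
    rewrite /Rintegral fine_le//.
    - by apply: integrable_fin_num => //; apply: integrable_norm; exact: iab.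
    - by apply: integrable_fin_num => //; exact: iab.
    - have [Nu [mNu Nu0 NuP]] := ae_null g_le_n.
      pose Nu' := Nu `|` [set b].
      have mNu' : measurable Nu' by exact: measurableU.
      have Nu'0 : mu Nu' = 0%E.
        by rewrite measureU0//; exact: lebesgue_measure_set1.
      apply: (ge0_le_integral_null mNu' Nu'0) => r /=; rewrite ?lee_fin//.
      rewrite in_itv/= => /andP[h1 h2] /not_orP[Nur rb]; apply: NuP => //.
      apply/andP; split; first lra.
      by rewrite lt_neqAle (le_trans h2 tb) andbT; apply/eqP.
  apply: le_trans (gm _ _ sa (ltW sq) _) _; first lra.
  by rewrite -ME//; lra.
exists n; split => //.
have dN := incr_sym_dist dn NE.
apply: ae_imp (ae_and A1 (ae_and g_le_n A3)) => t [c1 [gn c3]] tab.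
have tab' : a <= t <= b by case/andP: tab => /ltW -> /ltW ->.
apply/cvgrPdist_le => e e0.
have [_ [k _ <-] nk] : exists2 x, range (fun k => Num.min `|g k t| (m t)) x & n t - e / 2 < x.
  have -> : n t = sup (range (fun k => Num.min `|g k t| (m t))).
    by rewrite /n /sups/=; congr sup; apply/seteqP; split => x [j _ <-]; exists j.
  apply: sup_adherent; first lra.
  by split; [exists (Num.min `|g 0%N t| (m t)); exists 0%N|exact: nub].
have {}nk : n t - e / 2 < `|g k t| by apply: lt_le_trans nk _; rewrite ge_min lexx.
have e20 : 0 < e / 2 by lra.
have CB1 : `|(phi k (t + h) - phi k t) / h| @[h --> 0^'] --> `|g k t| by apply: cvg_norm; exact: c1.
have {CB1} B1 := (cvgrPdist_le _ _).1 CB1 _ e20; have {}B1 := B1 (dnbhs_filter _).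
have CB2 : `|(N (t + h) - N t) / h| @[h --> 0^'] --> `|n t| by apply: cvg_norm; exact: c3.
have {CB2} B2 := (cvgrPdist_le _ _).1 CB2 _ e0; have {}B2 := B2 (dnbhs_filter _).
near=> h.
have [h0 thab] : h != 0 /\ (a <= t + h <= b) by near: h; exact: near_ab.
have B1' : `| `|g k t| - `|(phi k (t + h) - phi k t) / h| | <= e / 2 by near: h.
have B2' : `| `|n t| - `|(N (t + h) - N t) / h| | <= e by near: h.
have D1 : mdist (gam (t + h)) (gam t) / `|h| <= `|(N (t + h) - N t) / h|.
  by rewrite normrM normfV ler_wpM2r ?invr_ge0// metric_sym dN.
have D2 : `|(phi k (t + h) - phi k t) / h| <= mdist (gam (t + h)) (gam t) / `|h|.
  by rewrite normrM normfV ler_wpM2r ?invr_ge0// mdist_triangleB.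
move: B1' B2'; rewrite (ger0_norm (n0 t)) !ler_norml; lra.
Unshelve. all: by end_near. Qed.

End metric_derivative.

Section integrable_real.
Context d (T : measurableType d) {R : realType} (mu : {measure set T -> \bar R}).

Lemma integrable_EFinD (D : set T) (f g : T -> R) : measurable D ->
  mu.-integrable D (EFin \o f) -> mu.-integrable D (EFin \o g) ->
  mu.-integrable D (EFin \o (fun x => f x + g x)).
Proof. by move=> mD fi gi; have := integrableD mD fi gi; apply: eq_integrable. Qed.

Lemma integrable_EFinZ (D : set T) (c : R) (f : T -> R) : measurable D ->
  mu.-integrable D (EFin \o f) -> mu.-integrable D (EFin \o (fun x => c * f x)).
Proof. by move=> mD fi; have := integrableZl mD c fi; apply: eq_integrable. Qed.

Lemma ae_le_Rintegral (D : set T) (f g : T -> R) : measurable D ->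
  mu.-integrable D (EFin \o f) -> mu.-integrable D (EFin \o g) ->
  {ae mu, forall x, D x -> f x <= g x} ->
  \int[mu]_(x in D) f x <= \int[mu]_(x in D) g x.
Proof.
move=> mD fi gi fg.
have mf : measurable_fun D f by move: fi => /measurable_int/measurable_EFinP.
have mg : measurable_fun D g by move: gi => /measurable_int/measurable_EFinP.
have mx : measurable_fun D (f \max g) by exact: measurable_maxr.
have E : ae_eq mu D (EFin \o g) (EFin \o (f \max g)).
  apply: ae_imp fg => x fgx Dx /=; congr EFin.
  by rewrite max_r// fgx.
have xi : mu.-integrable D (EFin \o (f \max g)).
  have fgi : mu.-integrable D (EFin \o (fun x => `|f x| + `|g x|)).
    by apply: integrable_EFinD => //; exact: integrable_norm.
  apply: le_integrable fgi => //; first exact/measurable_EFinP.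
  move=> x Dx /=; rewrite lee_fin [leRHS]ger0_norm ?addr_ge0//.
  rewrite /Num.max; case: ifP => _; [by rewrite lerDr|by rewrite lerDl].
have -> : \int[mu]_(x in D) g x = \int[mu]_(x in D) (f \max g) x.
  congr fine; apply: ae_eq_integral => //; exact/measurable_EFinP.
by apply: le_Rintegral => // x Dx /=; rewrite le_max lexx.
Qed.

End integrable_real.

Section ac_tools.
Context {R : realType}.
Local Notation mu := (@lebesgue_measure R).
Implicit Types (f g m : R -> R) (a b s t x y : R).

Lemma Rintegral_linear (c0 c1 s t : R) : s <= t ->
  \int[mu]_(r in `[s, t]) (c0 + c1 * r) = c0 * (t - s) + c1 * (t ^+ 2 - s ^+ 2) / 2.
Proof.
rewrite le_eqVlt => /predU1P[->|st].
  by rewrite set_itv1 Rintegral_set1; ring.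
pose F x := c0 * x + c1 / 2 * x ^+ 2.
have dF x : is_derive x (1 : R) F (c0 + c1 * x).
  rewrite /F; apply: is_derive_eq; rewrite /GRing.scale/=; by field.
have cf : continuous (fun r : R => c0 + c1 * r).
  move=> x; apply: cvgD; first exact: cvg_cst.
  by apply: cvgM; [exact: cvg_cst|exact: cvg_id].
rewrite /Rintegral (@continuous_FTC2 _ _ F)//.
- by rewrite -EFinB/= /F; field.
- exact: continuous_subspaceT.
- have cF x : {for x, continuous F}.
    by apply/differentiable_continuous/derivable1_diffP; exact: ex_derive.
  split; first by move=> x _; exact: ex_derive.
  + by apply: cvg_at_right_filter; exact: cF.
  + by apply: cvg_at_left_filter; exact: cF.
- by move=> x _; rewrite derive1E; apply: derive_val.
Qed.

Lemma integrable_continuous_itv f s t : {within `[s, t], continuous f} ->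
  mu.-integrable `[s, t] (EFin \o f).
Proof. by move=> cf; apply: continuous_compact_integrable => //; exact: segment_compact. Qed.

Lemma continuous_clamp a b : continuous (clamp a b).
Proof.
move=> x; apply: (@continuous_max _ _ (cst a) (fun x => Num.min x b)); first exact: cvg_cst.
by apply: (@continuous_min _ _ id (cst b)); [exact: cvg_id|exact: cvg_cst].
Qed.

End ac_tools.

Section ac_curves.
Context {R : realType} {X : metricType R}.
Local Notation mu := (@lebesgue_measure R).
Implicit Types (gam : R -> X) (f g m : R -> R) (a b s t : R) (z : X).

(** [N] is a primitive of an integrable bound of the speed. *)
Lemma ac_on_modulus a b gam : ac_on a b gam ->
  exists N : R -> R, [/\ continuous N, nondecreasing N &
    forall s t, a <= s -> s <= t -> t <= b -> mdist (gam s) (gam t) <= N t - N s].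
Proof.
move=> /ac_onP[m [m0 mi gm]].
exists (fun x => \int[mu]_(t in `]-oo, x]) m t).
have E s t : s <= t ->
    \int[mu]_(r in `]-oo, t]) m r - \int[mu]_(r in `]-oo, s]) m r = \int[mu]_(r in `]s, t]) m r.
  exact: primitive_increment.
split; first exact: primitive_continuous.
- by move=> s t st; rewrite -subr_ge0 E//; apply: Rintegral_ge0 => r _; exact: m0.
- move=> s t sa st tb; rewrite E// Rintegral_itv_oc; last exact: (integrable_sub_itv _ mi).
  exact: gm.
Qed.

Lemma ac_on_continuous_clamp a b gam : a <= b -> ac_on a b gam ->
  continuous (gam \o clamp a b).
Proof.
move=> ab /ac_on_modulus[N [Nc Nnd gN]] t.
have Ncl : continuous (N \o clamp a b).
  by move=> r; apply: continuous_comp; [exact: continuous_clamp|exact: Nc].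
apply/metricType_numDomainType.cvgrPdist_le => e e0.
have /cvgrPdist_le/(_ _ e0) := Ncl t; apply: filterS => s /=.
apply: le_trans.
have [ts|/ltW st] := leP t s.
  rewrite distrC ger0_norm; last by rewrite subr_ge0 Nnd// clamp_homo.
  by apply: gN; rewrite ?clamp_ge ?clamp_le ?clamp_homo.
rewrite ger0_norm; last by rewrite subr_ge0 Nnd// clamp_homo.
by rewrite metric_sym; apply: gN; rewrite ?clamp_ge ?clamp_le ?clamp_homo.
Qed.

Lemma mdist_continuous z : continuous (fun x => mdist x z).
Proof.
move=> x; apply/cvgrPdist_le => e e0.
have /metricType_numDomainType.cvgrPdist_le/(_ _ e0) : (fun y : X => y) y @[y --> x] --> x by exact: cvg_id.
by apply: filterS => y; apply: le_trans; exact: mdist_triangleB.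
Qed.

(** The squared distance to [z] is absolutely continuous since the curve is bounded,
so the differential inequality defining the flow can be integrated. *)
Lemma dist_sq_density a b gam z : a <= b -> ac_on a b gam ->
  exists g : R -> R, mu.-integrable setT (EFin \o g) /\
    forall s t, a <= s -> s <= t -> t <= b ->
      mdist (gam t) z ^+ 2 - mdist (gam s) z ^+ 2 = \int[mu]_(r in `[s, t]) g r.
Proof.
move=> ab acg; have [m [m0 mi gm]] := ac_onP acg.
pose I := \int[mu]_(r in `[a, b]) m r.
pose B := mdist (gam a) z + I.
have mi' s t : mu.-integrable `[s, t] (EFin \o m) by exact: (integrable_sub_itv _ mi).
have I0 s t : 0 <= \int[mu]_(r in `[s, t]) m r by apply: Rintegral_ge0 => r _; exact: m0.
have Bd t : a <= t -> t <= b -> mdist (gam t) z <= B.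
  move=> at_ tb; have := metric_triangle (gam t) (gam a) z.
  rewrite (metric_sym (gam t) (gam a)); move/le_trans; apply; rewrite addrC lerD2l.
  apply: le_trans (gm _ _ (lexx a) at_ tb) _.
  rewrite /I (@Rintegral_itv_cat _ a t b)// lerDl; exact: I0.
apply: (@absolutely_continuous_density _ a b _ (fun r => 2 * B * m r)) => //.
  exact: integrable_EFinZ.
move=> s t sa st tb; rewrite RintegralZl//.
rewrite subr_sqr normrM mulrC.
have B1 := Bd s sa (le_trans st tb); have B2 := Bd t (le_trans sa st) tb.
apply: ler_pM => //.
  by rewrite ger0_norm ?addr_ge0 ?mdist_ge0// mulrDl mul1r lerD.
apply: le_trans (gm _ _ sa st tb); rewrite (metric_sym (gam s) (gam t)).
exact: mdist_triangleB.
Qed.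

End ac_curves.

(** * The evolution variational inequality over short times *)

Section evi.
Context {R : realType} {X : metricType R}.
Variables (E : X -> \bar R) (lambda : R).
Local Notation mu := (@lebesgue_measure R).
Hypothesis E_proper : forall x, E x != -oo%E.
Hypothesis E_lsc : lower_semicontinuous E.
Implicit Types (gam : R -> X) (a b s t : R) (x y z : X).

Lemma near_right_itv (P : R -> Prop) a : (\forall r \near a^'+, P r) ->
  exists2 d : R, 0 < d & forall r, a < r -> r <= a + d -> P r.
Proof.
move=> [d /= d0 dP]; exists (d / 2); first by rewrite divr_gt0.
move=> r ar rd; apply: dP => //=; rewrite distrC ger0_norm; lra.
Qed.

Lemma evi_flow_cvg x gam t : evi_flow E lambda x gam -> 0 < t ->
  gam r @[r --> t] --> gam t.
Proof.
move=> [acg _ _] t0.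
have h0 : t / 2 < t + 1 by lra.
have acg' := acg (t / 2) (t + 1) ltac:(lra) h0.
have cg := ac_on_continuous_clamp (ltW h0) acg'; have := cg t.
rewrite /continuous_at /= clamp_id; [|lra|lra].
apply: cvg_trans; apply: near_eq_cvg; near=> r.
rewrite /= clamp_id//.
  by apply: ltW; near: r; apply: lt_nbhsr; lra.
by apply: ltW; near: r; apply: lt_nbhsl; lra.
Unshelve. all: by end_near. Qed.

(** The integrated form of the evolution inequality, with a pointwise bound that is
affine in time in place of the energy. It allows [a = 0], where the flow is only
known to converge: the inequality is integrated on [[s, t]] and [s] tends to [a]. *)
Lemma evi_bound x gam z (c : R) a t x0 (A B : R) :
  evi_flow E lambda x gam -> 0 <= a -> a < t ->
  gam r @[r --> a^'+] --> x0 -> E z = c%:E ->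
  {ae mu, forall r, a < r <= t -> E (gam r) \is a fin_num ->
    c - fine (E (gam r)) - lambda / 2 * mdist (gam r) z ^+ 2 <= A + B * (r - a)} ->
  mdist (gam t) z ^+ 2 - mdist x0 z ^+ 2 <= 2 * A * (t - a) + B * (t - a) ^+ 2.
Proof.
move=> [acg _ evi] a0 at_ gx0 Ez hae.
have main s : a < s -> s < t -> mdist (gam t) z ^+ 2 - mdist (gam s) z ^+ 2 <=
    2 * A * (t - s) + B * ((t - a) ^+ 2 - (s - a) ^+ 2).
  move=> as_ st; have s0 : 0 < s by exact: le_lt_trans as_.
  have acst := acg s t s0 st.
  have [g [gi gE]] := dist_sq_density z (ltW st) acst.
  rewrite gE//; last exact: ltW.
  have [c0 c0E] : exists c0, c0 = 2 * A - 2 * B * a by eexists.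
  have [c1 c1E] : exists c1, c1 = 2 * B by eexists.
  have -> : 2 * A * (t - s) + B * ((t - a) ^+ 2 - (s - a) ^+ 2) =
      c0 * (t - s) + c1 * (t ^+ 2 - s ^+ 2) / 2 by rewrite c0E c1E; field.
  rewrite -Rintegral_linear; last exact: ltW.
  apply: ae_le_Rintegral => //.
  - exact: (integrable_sub_itv _ gi).
  - apply: integrable_continuous_itv; apply: continuous_subspaceT => r.
    by apply: cvgD; [exact: cvg_cst|apply: cvgM; [exact: cvg_cst|exact: cvg_id]].
  have dq := ae_quotient_density gi gE.
  have st0 : {ae mu, forall r : R, r != s /\ r != t} by exact: ae_and (ae_neq s) (ae_neq t).
  apply: ae_imp (ae_and st0 (ae_and dq (ae_and hae (evi z)))) => r [[rs rt] [dqr [haer evr]]].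
  rewrite /= in_itv/= => /andP[sr rt'].
  have sr' : s < r by rewrite lt_neqAle eq_sym rs.
  have rt'' : r < t by rewrite lt_neqAle rt.
  have [dr] := evr (lt_trans s0 sr').
  set D := fun s => mdist (gam s) z ^+ 2.
  have -> : derive1 D r = g r.
    apply: (cvg_unique _ (derivable_quotient dr)) => //.
    by apply: dqr; rewrite sr'.
  rewrite Ez => ev.
  have efin : E (gam r) \is a fin_num.
    move: ev (E_proper (gam r)); case: (E (gam r)) => //=.
  have := haer _ efin; rewrite (lt_trans as_ sr') ltW// => /(_ isT).
  move: ev; rewrite -(fineK efin) -!EFinD lee_fin /D c0E c1E /=.
  lra.
have cD : (fun s => 2 * A * (t - s) + B * ((t - a) ^+ 2 - (s - a) ^+ 2) +
    mdist (gam s) z ^+ 2) s @[s --> a^'+] -->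
    2 * A * (t - a) + B * ((t - a) ^+ 2 - (a - a) ^+ 2) + mdist x0 z ^+ 2.
  have ida : s @[s --> a^'+] --> a by apply: cvg_at_right_filter; exact: cvg_id.
  have idc (k : R) : k @[_ --> a^'+] --> k by exact: cvg_cst.
  have dz : mdist (gam s) z @[s --> a^'+] --> mdist x0 z.
    apply: (@cvg_comp _ _ _ gam (fun x : X => mdist x z) _ _ _ gx0).
    exact: mdist_continuous.
  apply: cvgD; last exact: (cvgM dz dz).
  apply: cvgD; first by apply: cvgM; [exact: idc|apply: cvgB].
  apply: cvgM; first exact: idc.
  by apply: cvgB; [exact: idc|apply: cvgM; apply: cvgB].
suff : mdist (gam t) z ^+ 2 <= 2 * A * (t - a) + B * ((t - a) ^+ 2 - (a - a) ^+ 2) + mdist x0 z ^+ 2.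
  by rewrite subrr expr0n/= subr0; lra.
apply: (ler_cvg_to (cvg_cst _) cD); near=> s.
rewrite -lerBlDr; apply: main.
- by near: s; exact: nbhs_right_gt.
- by near: s; exact: nbhs_right_lt.
Unshelve. all: by end_near. Qed.

Lemma lsc_near (Y : topologicalType) (F : Y -> \bar R) (y : Y) (c : R) :
  lower_semicontinuous F -> (c%:E < F y)%E -> \forall w \near y, (c%:E < F w)%E.
Proof. by move=> Fl /Fl[V Vy VF]; apply: filterS Vy. Qed.

(** Written between [a] and [a + h], the evolution inequality bounds
[mdist (gam (a + h)) z ^+ 2 - mdist x0 z ^+ 2] by about [2 h (c - c0 - lambda / 2 d^2)],
where [d = mdist x0 z]. If the curve has moved by at most [k h], the left-hand side
is at least about [- 2 k h d]; now divide by [2 h]. *)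
Lemma slope_of_short_time x gam a x0 (c0 k : R) :
  evi_flow E lambda x gam -> 0 <= a -> gam r @[r --> a^'+] --> x0 ->
  E x0 = c0%:E -> 0 <= k ->
  (forall h0, 0 < h0 -> exists h, [/\ 0 < h, h < h0 & mdist (gam (a + h)) x0 <= k * h]) ->
  forall z c, E z = c%:E ->
    c0 - c <= k * mdist x0 z - lambda / 2 * mdist x0 z ^+ 2.
Proof.
move=> evi a0 gx0 Ex0 k0 short z c Ez.
have D0 := mdist_ge0 x0 z; move: D0; set d0 := mdist x0 z => d00.
suff main d : 0 < d -> c0 - c <= k * d0 - lambda / 2 * d0 ^+ 2 + (1 + `|lambda| / 2) * d.
  apply/ler_addgt0Pr => e e0.
  have K0 : 0 < 1 + `|lambda| / 2 by rewrite ltr_wpDr// divr_ge0.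
  have := main (e / (1 + `|lambda| / 2)) (divr_gt0 e0 K0).
  by rewrite [(1 + _) * (e / _)]mulrC divfK// gt_eqF.
move=> d0'.
have N1 : \forall r \near a^'+, ((c0 - d)%:E < E (gam r))%E.
  have : \forall y \near x0, ((c0 - d)%:E < E y)%E.
    by apply: lsc_near => //; rewrite Ex0 lte_fin; lra.
  exact: gx0.
have cdz : mdist (gam r) z ^+ 2 @[r --> a^'+] --> d0 ^+ 2.
  have dz : mdist (gam r) z @[r --> a^'+] --> d0.
    apply: (@cvg_comp _ _ _ gam (fun x : X => mdist x z) _ _ _ gx0).
    exact: mdist_continuous.
  exact: (cvgM dz dz).
have N2 : \forall r \near a^'+, `|d0 ^+ 2 - mdist (gam r) z ^+ 2| <= d.
  by have /cvgrPdist_le := cdz; apply.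
have [h1 h10 H1] := near_right_itv N1.
have [h2 h20 H2] := near_right_itv N2.
have h120 : 0 < Num.min h1 h2 by rewrite lt_min h10.
have [h [h0 + sh]] := short _ h120.
rewrite lt_min => /andP[hh1 hh2].
have [A AE] : exists A, A = c - c0 + d - lambda / 2 * d0 ^+ 2 + `|lambda| / 2 * d by eexists.
have ah : a < a + h by rewrite ltrDl.
have := @evi_bound x gam z c a (a + h) x0 A 0 evi a0 ah gx0 Ez.
have -> : 2 * A * (a + h - a) + 0 * (a + h - a) ^+ 2 = 2 * A * h by ring.
rewrite -/d0; set dz := mdist (gam (a + h)) z.
have -> : dz ^+ 2 - d0 ^+ 2 = (dz - d0) * (dz + d0) by ring.
move=> bnd.
have {}bnd : (dz - d0) * (dz + d0) <= 2 * A * h.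
  apply: bnd; apply: aeW => r /andP[ar rh] fE.
  have := H1 r ar ltac:(lra); rewrite -(fineK fE) lte_fin => e1.
  have e2 := H2 r ar ltac:(lra).
  have : `|lambda / 2 * (d0 ^+ 2 - mdist (gam r) z ^+ 2)| <= `|lambda| / 2 * d.
    by rewrite normrM normrM (ger0_norm (_ : 0 <= 2^-1))// ler_wpM2l// divr_ge0.
  rewrite ler_norml AE; lra.
have dz0 : 0 <= dz := mdist_ge0 _ _.
have tri : d0 - dz <= k * h.
  apply: le_trans sh.
  have := mdist_triangleB x0 (gam (a + h)) z.
  by rewrite ler_norml (metric_sym x0 (gam _)) => /andP[_]; rewrite -/d0 -/dz.
(* The distance to z has decreased by at most k h. *)
have low : - (2 * k * h * d0) <= (dz - d0) * (dz + d0).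
  have [dd|dd] := leP d0 dz.
    apply: (@le_trans _ _ 0); first by rewrite oppr_le0 !mulr_ge0// ltW.
    by apply: mulr_ge0; [rewrite subr_ge0|exact: addr_ge0].
  rewrite -opprB mulNr lerN2.
  apply: (@le_trans _ _ (k * h * (dz + d0))); first by rewrite ler_wpM2r// addr_ge0.
  rewrite (_ : 2 * k * h * d0 = k * h * (d0 + d0)); last by ring.
  by rewrite ler_wpM2l ?mulr_ge0// ?lerD2r ltW.
have : - (k * d0) <= A.
  rewrite -(ler_pM2l (_ : 0 < 2 * h)); last by rewrite mulr_gt0.
  rewrite (_ : 2 * h * - (k * d0) = - (2 * k * h * d0)); last by ring.
  by rewrite (_ : 2 * h * A = 2 * A * h); [exact: le_trans low bnd|ring].
rewrite AE; lra.
Qed.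

(** Self-improvement: a bound of the squares by a multiple of the supremum bounds the
supremum itself. *)
Lemma sup_le_of_sqr_le (S : set R) (C : R) : 0 <= C -> has_sup S ->
  (forall u, S u -> 0 <= u) -> (forall u, S u -> u ^+ 2 <= C * sup S) -> sup S <= C.
Proof.
move=> C0 Ss S0 SC; have [S1 Sub] := Ss.
rewrite leNgt; apply/negP => CS.
have S0' : 0 < sup S by exact: le_lt_trans CS.
have : sup S <= Num.sqrt (C * sup S).
  apply: ge_sup => // u Su; rewrite -(ger0_norm (S0 _ Su)) -sqrtr_sqr.
  by rewrite ler_wsqrtr// SC.
apply/negP; rewrite -ltNge -[ltRHS](ger0_norm (ltW S0')) -sqrtr_sqr.
by rewrite ltr_sqrt ?exprn_gt0// expr2 ltr_pM2r.
Qed.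

(** A local slope bound at [x0] is turned into a global one by running the flow from
[x0]. The evolution inequality with [z = x0] says that the squared displacement [v ^+ 2]
grows at most like the integral of twice the energy drop, which the local bound
controls by [(sg + 2 d) v]. Hence [v t <= (sg + 2 d) t] for small [t], and
[slope_of_short_time] concludes. *)
Lemma slope_global x0 gam (c0 sg : R) : evi_flow E lambda x0 gam ->
  E x0 = c0%:E -> 0 <= sg ->
  (forall d, 0 < d -> \forall z \near x0, (E x0 <= E z + ((sg + d) * mdist x0 z)%:E)%E) ->
  forall z c, E z = c%:E ->
    c0 - c <= sg * mdist x0 z - lambda / 2 * mdist x0 z ^+ 2.
Proof.
move=> evi Ex0 sg0 loc z c Ez.
have gx0 : gam r @[r --> 0^'+] --> x0 by case: evi.
suff main d : 0 < d ->
    c0 - c <= (sg + 2 * d) * mdist x0 z - lambda / 2 * mdist x0 z ^+ 2.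
  apply/ler_addgt0Pr => e e0; have D0 := mdist_ge0 x0 z.
  have K0 : 0 < 2 * (mdist x0 z + 1) by lra.
  have := main (e / (2 * (mdist x0 z + 1))) (divr_gt0 e0 K0).
  have : 2 * (e / (2 * (mdist x0 z + 1))) * mdist x0 z <= e.
    rewrite (_ : 2 * _ * _ = e * (mdist x0 z / (mdist x0 z + 1))); last first.
      by field; rewrite gt_eqF// ltr_wpDl.
    by rewrite ger_pMr// ler_pdivrMr ?ltr_wpDl// mul1r lerDl.
  lra.
move=> d0.
have [s2 s2E] : exists s2, s2 = sg + 2 * d by eexists.
have s20 : 0 < s2 by lra.
pose v r := mdist (gam r) x0.
have v0 r : 0 <= v r by exact: mdist_ge0.
have cv : v r @[r --> 0^'+] --> (0 : R).
  suff : v r @[r --> 0^'+] --> mdist x0 x0 by rewrite mdistxx.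
  apply: (@cvg_comp _ _ _ gam (fun x : X => mdist x x0) _ _ _ gx0).
  exact: mdist_continuous.
have N1 : \forall r \near 0^'+, (E x0 <= E (gam r) + ((sg + d) * v r)%:E)%E.
  pose P z := (E x0 <= E z + ((sg + d) * mdist x0 z)%:E)%E.
  have : \forall r \near 0^'+, P (gam r) by exact: gx0 _ (loc d d0).
  by apply: filterS => r; rewrite /P /v metric_sym.
have [w w0 wP] : exists2 w, 0 < w & `|lambda| * w <= 2 * d.
  have K0 : 0 < `|lambda| + 1 by rewrite ltr_wpDl.
  exists (2 * d / (`|lambda| + 1)); first by rewrite divr_gt0// mulr_gt0.
  rewrite mulrCA ger_pMr ?mulr_gt0// ler_pdivrMr// mul1r lerDl//.
have N2 : \forall r \near 0^'+, v r <= w.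
  have /cvgrPdist_le /(_ _ w0) := cv; apply: filterS => r.
  by rewrite sub0r normrN ger0_norm.
have [h0 h00 H] := near_right_itv (filterI N1 N2).
have H1 r : 0 < r -> r <= h0 -> (E x0 <= E (gam r) + ((sg + d) * v r)%:E)%E.
  by move=> r0 rh; have [|//] := H r r0; rewrite add0r.
have H2 r : 0 < r -> r <= h0 -> v r <= w.
  by move=> r0 rh; have [|//] := H r r0; rewrite add0r.
have step (A B t : R) : 0 < t -> t <= h0 ->
    (forall r, 0 < r -> r <= t -> s2 * v r <= A + B * r) ->
    v t ^+ 2 <= 2 * A * t + B * t ^+ 2.
  move=> t0 th vAB.
  have := @evi_bound x0 gam x0 c0 0 t x0 A B evi (lexx 0) t0 gx0 Ex0.
  rewrite mdistxx expr0n/= !subr0; apply; apply: aeW => r /andP[r0 rt] fE.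
  have rh := le_trans rt th.
  have := H1 r r0 rh; rewrite Ex0 -(fineK fE) -EFinD lee_fin => e1.
  have vr := H2 r r0 rh.
  rewrite subr0 -/(v r) /=; apply: le_trans (vAB r r0 rt).
  have : - (lambda / 2 * v r ^+ 2) <= d * v r.
    apply: le_trans (ler_norm _) _; rewrite normrN !normrM.
    rewrite (ger0_norm (_ : 0 <= 2^-1))// (ger0_norm (v0 r)) mulrA ler_wpM2r//.
    have : `|lambda| * v r <= 2 * d by apply: le_trans wP; rewrite ler_wpM2l.
    lra.
  rewrite s2E; lra.
(* The bound is obtained in two rounds: a rough linear one first, which makes the
   supremum of v r / r finite, so that it can be improved to the sharp constant. *)
have lin t : 0 < t -> t <= h0 -> v t <= 2 * s2 * t.
  move=> t0 th.
  pose S := [set v r | r in [set r | 0 < r /\ r <= t]].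
  have Ssup : has_sup S.
    split; first by exists (v t); exists t.
    by exists w => _ [r [r0 rt] <-]; apply: H2 => //; exact: le_trans th.
  have vS r : 0 < r -> r <= t -> v r <= sup S.
    by move=> r0 rt; apply: ub_le_sup; [exact: Ssup.2|exists r].
  apply: le_trans (vS t t0 (lexx t)) _.
  apply: sup_le_of_sqr_le => //; first by rewrite !mulr_ge0// ltW.
    by move=> _ [r _ <-].
  move=> _ [r [r0 rt] <-].
  have := @step (s2 * sup S) 0 r r0 (le_trans rt th) _.
  rewrite mul0r addr0 => /(_ _)/le_trans; apply.
    by move=> q q0 qr; rewrite mul0r addr0 ler_pM2l//; apply: vS => //; exact: le_trans rt.
  have S0 : 0 <= sup S by apply: le_trans (vS t t0 (lexx t)).
  rewrite (_ : 2 * s2 * t * sup S = 2 * (s2 * sup S) * t); last by ring.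
  by rewrite ler_wpM2l// !mulr_ge0// ltW.
have sharp t : 0 < t -> t <= h0 -> v t <= s2 * t.
  move=> t0 th.
  pose S := [set v r / r | r in [set r | 0 < r /\ r <= h0]].
  have Ssup : has_sup S.
    split; first by exists (v t / t); exists t.
    by exists (2 * s2) => _ [r [r0 rt] <-]; rewrite ler_pdivrMr//; exact: lin.
  have vS r : 0 < r -> r <= h0 -> v r / r <= sup S.
    by move=> r0 rt; apply: ub_le_sup; [exact: Ssup.2|exists r].
  rewrite -ler_pdivrMr//; apply: le_trans (vS t t0 th) _.
  apply: sup_le_of_sqr_le => //; first exact: ltW.
    by move=> _ [r [r0 _] <-]; rewrite divr_ge0// ltW.
  move=> _ [r [r0 rt] <-].
  have := @step 0 (s2 * sup S) r r0 rt.
  rewrite mulr0 mul0r add0r => bd.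
  rewrite expr_div_n ler_pdivrMr ?exprn_gt0//; apply: bd => q q0 qr.
  rewrite add0r -mulrA ler_pM2l// -ler_pdivrMr//; apply: vS => //; exact: le_trans rt.
rewrite -s2E.
apply: (@slope_of_short_time x0 gam 0 x0 c0 s2 evi (lexx 0) gx0 Ex0 (ltW s20)) => // h1 h10.
exists (Num.min h0 h1 / 2).
have m0 : 0 < Num.min h0 h1 by rewrite lt_min h00.
have m1 : Num.min h0 h1 <= h0 by rewrite ge_min lexx.
have m2 : Num.min h0 h1 <= h1 by rewrite ge_min lexx orbT.
split; [lra|lra|].
by rewrite add0r; apply: sharp; lra.
Qed.

End evi.

(** * The slope is a global quantity *)

Section slope.
Context {R : realType} {X : metricType R}.
Variables (E : X -> \bar R) (lambda : R).
Hypothesis E_proper : forall x, E x != -oo%E.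
Hypothesis E_lsc : lower_semicontinuous E.
Hypothesis E_evi : forall x, exists g, evi_flow E lambda x g.
Implicit Types (x y z : X).

Let quot x z : \bar R := (maxe (E x - E z) 0 * ((mdist x z)^-1)%:E)%E.

Lemma not_isolated_dnbhs x : ~ isolated [set: X] x -> ~ (x^' : set_system X) set0.
Proof.
move=> ni h; apply: ni; split; first by rewrite inE.
exists [set x]; last by rewrite setIT.
have h' : nbhs x (fun y => y != x -> set0 y) by exact: h.
by apply: filterS h' => y /= xy; apply: contrapT => /eqP/xy.
Qed.

Lemma quot_ge0 x z : (0 <= quot x z)%E.
Proof.
by rewrite /quot mule_ge0 ?le_max ?lexx ?orbT// lee_fin invr_ge0 mdist_ge0.
Qed.

Lemma slope_ge0 x : (0 <= slope E x)%E.
Proof.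
rewrite /slope; case: ifPn => // _; case: ifPn => // /asboolPn ni.
by apply: limf_esup_ge0 => [|z]; [exact: not_isolated_dnbhs|exact: quot_ge0].
Qed.

Lemma slope_local x (c0 sg : R) : E x = c0%:E -> (slope E x <= sg%:E)%E ->
  forall d, 0 < d -> \forall z \near x, (E x <= E z + ((sg + d) * mdist x z)%:E)%E.
Proof.
move=> Ex + d d0; rewrite /slope asboolF; last first.
  by move=> h; apply: h; rewrite /dom /= Ex ltry.
case: ifPn => [/asboolP[_ [V Vx VE]] _|/asboolPn ni sl].
  apply: filterS Vx => z Vz.
  have -> : z = x by have : (V `&` setT) z by []; rewrite VE.
  by rewrite mdistxx mulr0 adde0.
have : (limf_esup (quot x) x^' < (sg + d)%:E)%E.
  by apply: le_lt_trans sl _; rewrite lte_fin ltrDl.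
rewrite limf_esupE => /ereal_inf_lt[_ [V Vx <-]] /ltW supV.
have Vx' : nbhs x (fun z => z != x -> V z) by exact: Vx.
apply: filterS Vx' => z /= Vz.
have [->|zx] := eqVneq z x; first by rewrite mdistxx mulr0 adde0.
have : (quot x z <= (sg + d)%:E)%E.
  by apply: le_trans supV; apply: ereal_sup_ubound; exists z => //; exact: Vz.
have D0 : 0 < mdist x z by rewrite mdist_gt0 eq_sym.
rewrite /quot Ex; case: (E z) (E_proper z) => [r _|_ _|//]; last by rewrite addye ?leey.
move=> h; have {h} : ((c0 - r)%:E * ((mdist x z)^-1)%:E <= (sg + d)%:E)%E.
  apply: le_trans h; rewrite lee_wpmul2r ?lee_fin ?invr_ge0 ?mdist_ge0//.
  by rewrite EFinB le_max lexx.
by rewrite -EFinM lee_fin ler_pdivrMr// -EFinD lee_fin; lra.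
Qed.

(** The local slope of an energy that has EVI flows is the global one, the supremum over
[z] of the positive part of [(E x - E z) / d + lambda / 2 * d] with [d = mdist x z]. From
local to global this is [slope_global]; conversely the quadratic term is negligible
near [x]. *)
Lemma slope_leP x (c0 sg : R) : E x = c0%:E -> 0 <= sg ->
  (slope E x <= sg%:E)%E <->
  (forall z, (E x <= E z + (sg * mdist x z - lambda / 2 * mdist x z ^+ 2)%:E)%E).
Proof.
move=> Ex sg0; split=> [sl z|gl].
  have [g evi] := E_evi x.
  case Ez : (E z) (E_proper z) => [c| |] //= _; last by rewrite addye ?leey.
  have := slope_global E_proper E_lsc evi Ex sg0 (slope_local Ex sl) Ez.
  by rewrite Ex -EFinD lee_fin; lra.
rewrite /slope asboolF; last first.
  by move=> h; apply: h; rewrite /dom /= Ex ltry.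
case: ifPn => [_|/asboolPn ni]; first by rewrite lee_fin.
apply/lee_addgt0Pr => e e0.
have K0 : 0 < `|lambda| + 1 by rewrite ltr_wpDl.
pose r := 2 * e / (`|lambda| + 1).
have r0 : 0 < r by rewrite divr_gt0// mulr_gt0.
rewrite limf_esupE; apply: (@le_trans _ _ (ereal_sup (quot x @` (ball x r `\ x)))).
  apply: ereal_inf_lbound; exists (ball x r `\ x) => //.
  rewrite /dnbhs /within /=; have := nbhsx_ballx x r r0.
  by apply: filterS => z xz zx; split => //; apply/eqP.
apply: ge_ereal_sup => _ [z [xz /eqP zx] <-].
have D0 : 0 < mdist x z by rewrite mdist_gt0 eq_sym.
have Dr : mdist x z < r by move: xz; rewrite ballEmdist.
have se : (0 <= sg%:E + e%:E)%E by rewrite -EFinD lee_fin addr_ge0// ltW.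
have := gl z; rewrite /quot Ex.
case: (E z) (E_proper z) => [c _|_ _|//]; last first.
  by rewrite /= max_r ?mul0e// leNye.
rewrite -EFinD lee_fin -EFinB => h.
have [cc|cc] := leP (c0 - c)%:E 0%E; first by rewrite mul0e.
rewrite -EFinM -EFinD lee_fin ler_pdivrMr//.
have : - (lambda / 2 * mdist x z ^+ 2) <= e * mdist x z.
  apply: le_trans (ler_norm _) _; rewrite normrN !normrM.
  rewrite (ger0_norm (_ : 0 <= 2^-1))// (ger0_norm (ltW D0)) mulrA ler_wpM2r//; first exact: ltW.
  have : `|lambda| * mdist x z <= 2 * e.
    apply: (@le_trans _ _ (`|lambda| * r)); first by rewrite ler_wpM2l// ltW.
    by rewrite /r mulrCA ger_pMr ?mulr_gt0// ler_pdivrMr// mul1r lerDl.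
  lra.
lra.
Qed.

(** By [slope_leP] the slope is, where the energy is finite, a supremum over [z] of
functions of [x] that are lower semicontinuous. *)
Lemma lower_semicontinuous_slope : dom E !=set0 -> lower_semicontinuous (slope E).
Proof.
move=> [z0 dz0] x a ax.
have [a0|a0] := ltP a 0.
  exists setT; first exact: filterT.
  by move=> y _; apply: lt_le_trans (slope_ge0 y); rewrite lte_fin.
have [z zx] : exists z, (E z + (a * mdist x z - lambda / 2 * mdist x z ^+ 2)%:E < E x)%E.
  case Ex : (E x) (E_proper x) => [c0| |] //= _.
    apply: contrapT => /forallNP nz; move: ax; apply/negP; rewrite -leNgt.
    by apply/(slope_leP Ex a0) => z; rewrite leNgt Ex; apply/negP.
  exists z0; move: dz0 (E_proper z0); rewrite /dom/=.
  by case: (E z0) => //= r _ _; rewrite -EFinD ltry.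
case Ez : (E z) zx (E_proper z) => [c| |] //= zx _; last first.
  by move: zx; rewrite addye// ltNge leey.
pose G y := a * mdist y z - lambda / 2 * mdist y z ^+ 2.
have [b b1 b2] : exists2 b, c + G x < b & (b%:E < E x)%E.
  move: zx; rewrite -EFinD -/(G x); case: (E x) (E_proper x) => [c0| |] // _.
    by rewrite lte_fin => h; exists ((c + G x + c0) / 2); rewrite ?lte_fin; lra.
  by move=> _; exists (c + G x + 1); rewrite ?ltry//; lra.
have cG : G y @[y --> x] --> G x.
  have md := @mdist_continuous R X z x.
  by apply: cvgB; apply: cvgM => //; [exact: cvg_cst|exact: cvg_cst|exact: (cvgM md md)].
have N1 : \forall y \near x, c + G y < b.
  have bx : G x < b - c by lra.
  have : \forall y \near x, G y < b - c by apply: (cvgr_lt _ cG).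
  by apply: filterS => y; lra.
have N2 := lsc_near E_lsc b2.
exists [set y | c + G y < b /\ (b%:E < E y)%E]; first exact: filterI N1 N2.
move=> y [y1 y2]; rewrite ltNge; apply/negP => sy.
case Ey : (E y) y2 (E_proper y) => [c0| |] //= y2 _; last first.
  move: sy; rewrite /slope asboolT ?leye_eq//.
  by rewrite /dom /= Ey ltxx.
have := (slope_leP Ey a0).1 sy z.
rewrite Ez Ey -EFinD lee_fin -/(G y); move: y2; rewrite lte_fin; lra.
Qed.

End slope.

(** * The slope controls energy drops along curves *)

Section upper_gradient.
Context {R : realType} {X : metricType R}.
Local Notation mu := (@lebesgue_measure R).
Variables (E : X -> \bar R) (lambda : R).
Hypothesis E_proper : forall x, E x != -oo%E.
Hypothesis E_lsc : lower_semicontinuous E.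
Hypothesis E_dom : dom E !=set0.
Hypothesis E_evi : forall x, exists g, evi_flow E lambda x g.
Implicit Types (x y z : X) (gam : R -> X).
Local Open Scope ereal_scope.

Lemma lsc_comp (Y Z : topologicalType) (F : Y -> \bar R) (g : Z -> Y) :
  lower_semicontinuous F -> continuous g -> lower_semicontinuous (F \o g).
Proof.
move=> Fl cg z a /Fl[V Vz VF]; exists (g @^-1` V); first exact: cg.
by move=> w; exact: VF.
Qed.

(** The global slope inequality between two points at squared distance at most [h Q],
with the product of slope and distance split by Young's inequality; the weights are
those for which the time step [h] factors out of the slope term. *)
Lemma slope_young x z (c0 c ep h Q : R) : E x = c0%:E -> E z = c%:E ->
  (0 < ep)%R -> (0 < h)%R -> (mdist x z ^+ 2 <= h * Q)%R ->
  c0%:E <= c%:E + ((2 * ep)^-1 * Q + `|lambda| / 2 * h * Q)%:E + (h * ep / 2)%:E * slope E x ^+ 2.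
Proof.
move=> Ex Ez ep0 h0 dQ.
have sl0 := slope_ge0 E x.
case sl : (slope E x) sl0 => [sg| |]//; last first.
  move=> _; rewrite expe2 mulyy gt0_muley ?addey ?leey//.
  by rewrite lte_fin !divr_gt0// mulr_gt0.
rewrite lee_fin => sg0.
have := (slope_leP E_proper E_lsc E_evi Ex sg0).1; rewrite sl => /(_ (lexx _) z).
rewrite Ex Ez -EFinD lee_fin => main.
rewrite -EFin_expe -EFinM -!EFinD lee_fin.
have D0 := mdist_ge0 x z.
have h1 : (- (lambda / 2 * mdist x z ^+ 2) <= `|lambda| / 2 * h * Q)%R.
  apply: (@le_trans _ _ (`|lambda| / 2 * mdist x z ^+ 2)%R).
    rewrite -mulNr ler_wpM2r ?exprn_ge0// -mulNr ler_wpM2r// ?invr_ge0//.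
    by rewrite -normrN ler_norm.
  by rewrite -[leRHS]mulrA ler_wpM2l// divr_ge0.
have h2 : (sg * mdist x z <= (2 * ep)^-1 * Q + h * ep / 2 * sg ^+ 2)%R.
  have he : (0 < 2 * (h * ep))%R by rewrite !mulr_gt0.
  rewrite -(ler_pM2l he).
  have -> : (2 * (h * ep) * ((2 * ep)^-1 * Q + h * ep / 2 * sg ^+ 2) = h * Q + (h * ep * sg) ^+ 2)%R.
    by field; rewrite gt_eqF.
  apply: (@le_trans _ _ (mdist x z ^+ 2 + (h * ep * sg) ^+ 2)%R); last by rewrite lerD2r.
  rewrite -subr_ge0.
  have -> : (mdist x z ^+ 2 + (h * ep * sg) ^+ 2 - 2 * (h * ep) * (sg * mdist x z) = (mdist x z - h * ep * sg) ^+ 2)%R by ring.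
  exact: sqr_ge0.
move: main h1 h2; set A := ((2 * ep)^-1 * Q)%R; set B := (`|lambda| / 2 * h * Q)%R.
set D := (h * ep / 2 * _)%R; set G := (sg * _)%R; set H := (lambda / 2 * _)%R.
by clearbody A B D G H; lra.
Qed.

Lemma measurable_energy gam : continuous gam -> measurable_fun setT (E \o gam).
Proof. by move=> cg; apply: lower_semicontinuous_measurable; exact: lsc_comp. Qed.

Lemma measurable_slope_sq gam : continuous gam ->
  measurable_fun setT (fun t => slope E (gam t) ^+ 2).
Proof.
move=> cg; have ms : measurable_fun setT (slope E \o gam).
  apply: lower_semicontinuous_measurable; apply: lsc_comp => //.
  exact: lower_semicontinuous_slope E_evi E_dom.
have := emeasurable_funM ms ms; apply: eq_measurable_fun => t _.
by rewrite expe2.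
Qed.

(** The upper gradient property of the slope, in the form adapted to the action. The
chain rule along the curve is avoided, because [E \o gam] need not be absolutely
continuous: [slope_young] compares the energies at [s] and [s + h], and this
inequality is integrated over [0 <= s <= 1]. By [ge0_integral_shift_swap] what is
left of the energy is its integral over [[0, h]] and over [[1, 1 + h]]. The curve is
constant after time 1, and lower semicontinuity bounds the energy from below near
time 0; after division by [h], let [h] tend to 0. Here [P] plays the role of a
primitive of the squared speed. *)
Lemma energy_drop_le gam (P : R -> R) (c ep : R) : (0 < ep)%R ->
  continuous gam -> (forall t, (1 <= t)%R -> gam t = gam 1%R) ->
  (forall t, c%:E <= E (gam t)) ->
  nondecreasing P ->
  (forall s t, (s <= t)%R -> (mdist (gam s) (gam t) ^+ 2 <= (t - s) * (P t - P s))%R) ->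
  (forall t, (1 <= t)%R -> P t = P 1%R) ->
  E (gam 0%R) <= E (gam 1%R) + ((2 * ep)^-1 * (P 1 - P 0))%:E +
    (ep / 2)%:E * \int[mu]_(t in `[0%R, 1%R]) (slope E (gam t) ^+ 2).
Proof.
move=> ep0 cg g1 cE Pnd dP P1.
set J := \int[mu]_(t in _) _.
have sl0 t : 0 <= slope E (gam t) ^+ 2 by rewrite expe_ge0// slope_ge0.
have J0 : 0 <= J by exact: integral_ge0.
have msl : measurable_fun setT (fun t => slope E (gam t) ^+ 2) by exact: measurable_slope_sq.
case e1 : (E (gam 1%R)) (E_proper (gam 1%R)) => [c1| |] // _; last first.
  have : 0 <= (ep / 2)%:E * J by rewrite mule_ge0// lee_fin divr_ge0// ltW.
  by case: (_ * J) => [v| |]// _; rewrite leey.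
have [Joo|Jfin] := eqVneq J +oo.
  by rewrite Joo gt0_muley ?addey ?leey// lte_fin divr_gt0.
have {}Jfin : J < +oo by rewrite ltey.
pose Q t := (P t - P 0)%R.
have Q0 t : (0 <= t)%R -> (0 <= Q t)%R by move=> t0; rewrite subr_ge0 Pnd.
have mQ : measurable_fun setT Q.
  by apply: measurable_funB => //; exact: nondecreasing_measurable.
pose f t := E (gam t) - c%:E.
have f0 t : 0 <= f t by rewrite sube_ge0.
have mf : measurable_fun setT f.
  by apply: emeasurable_funB => //; exact: measurable_energy.
(* The energy at time 0 may be infinite, so it is approached from below. *)
suff main a : a%:E < E (gam 0%R) -> a%:E <= c1%:E + ((2 * ep)^-1 * Q 1)%:E + (ep / 2)%:E * J.
  case e0 : (E (gam 0%R)) (E_proper (gam 0%R)) main => [r| |] // _ main.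
    apply/lee_addgt0Pr => e e_0; rewrite -leeBlDr// -EFinB.
    by apply: main; rewrite lte_fin; lra.
  rewrite leye_eq; apply/eqP/eqyP => A A0.
  by apply: main; rewrite ltry.
move=> aE.
have [h0 h00 ha] : exists2 h0, (0 < h0)%R & forall t, (0 <= t <= h0)%R -> a%:E < E (gam t).
  have : \forall t \near (0%R : R), a%:E < E (gam t).
    by apply: (lsc_near (lsc_comp E_lsc cg)).
  move=> [d /= d0 dP']; exists (d / 2)%R; first by rewrite divr_gt0.
  move=> t /andP[t0 td]; apply: dP' => /=; rewrite sub0r normrN ger0_norm//; lra.
have Q10 : (0 <= Q 1)%R by exact: Q0.
case eJ : J J0 Jfin => [j| |] // ; rewrite lee_fin => j0 _.
have cc1 : (c <= c1)%R by rewrite -lee_fin -e1.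
have {}eJ : \int[mu]_(t in `[0%R, 1%R]) (slope E (gam t) ^+ 2) = j%:E by [].
have Zl (k : R) : (0 <= k)%R ->
    \int[mu]_(t in `[0%R, 1%R]) (k%:E * slope E (gam t) ^+ 2) = k%:E * j%:E.
  by move=> k0; rewrite -eJ; apply: ge0_integralZl => //; exact: measurable_funTS.
have ep2 : (0 <= (2 * ep)^-1)%R by rewrite invr_ge0 mulr_ge0// ltW.
have la2 : (0 <= `|lambda| / 2)%R by rewrite divr_ge0.
have key h : (0 < h)%R -> (h <= h0)%R -> (h <= 1)%R ->
    (a <= c1 + ((2 * ep)^-1 * Q 1 + `|lambda| / 2 * h * Q 1) + ep / 2 * j)%R.
  move=> hp hh h1.
  pose C := ((2 * ep)^-1 + `|lambda| / 2 * h)%R.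
  have C0 : (0 <= C)%R by rewrite addr_ge0 ?invr_ge0 ?mulr_ge0// ltW.
  (* Adding C Q t absorbs the increments of P, which telescope as the energy does. *)
  pose F t := f t + (C * Q t)%:E.
  have F0 t : (0 <= t)%R -> 0 <= F t.
    by move=> t0; rewrite adde_ge0// lee_fin mulr_ge0// Q0.
  have mF : measurable_fun setT F.
    apply: emeasurable_funD => //; apply/measurable_EFinP.
    by apply: measurable_funM.
  have comp s t (h' : R) : (0 <= s)%R -> (s < t)%R -> (t - s <= h')%R -> (0 < h')%R ->
      f s <= f t + ((2 * ep)^-1 * (P t - P s) + `|lambda| / 2 * h' * (P t - P s))%:E +
        (h' * ep / 2)%:E * slope E (gam s) ^+ 2.
    move=> s0 st tsh h'0.
    have Pts : (0 <= P t - P s)%R by rewrite subr_ge0 Pnd// ltW.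
    have dst : (mdist (gam s) (gam t) ^+ 2 <= h' * (P t - P s))%R.
      by apply: le_trans (dP _ _ (ltW st)) _; rewrite ler_wpM2r.
    have RHS0 : 0 <= (h' * ep / 2)%:E * slope E (gam s) ^+ 2.
      by rewrite mule_ge0// lee_fin !mulr_ge0// ?invr_ge0// ltW.
    rewrite /f; case et : (E (gam t)) (E_proper (gam t)) => [ct| |] // _; last first.
      by case: (_ * _) RHS0 => [v| |]// _; rewrite leey.
    case es : (E (gam s)) (E_proper (gam s)) => [cs| |] // _; last first.
      have -> : slope E (gam s) = +oo by rewrite /slope asboolT// /dom/= es.
      rewrite expe2 mulyy gt0_muley ?addey ?leey//.
      by rewrite lte_fin !divr_gt0// mulr_gt0.
    have := slope_young es et ep0 h'0 dst.
    rewrite -EFinB -EFinB -!EFinD.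
    case: (_ * _) RHS0 => [v| |] //; last by rewrite !addey ?leey.
    by rewrite -!EFinD !lee_fin; lra.
  have Fh s : (0 <= s <= 1)%R -> F s <= F (s + h)%R + (h * ep / 2)%:E * slope E (gam s) ^+ 2.
    move=> /andP[s0 s1].
    have cm := comp s (s + h)%R h s0 ltac:(lra) ltac:(lra) hp.
    rewrite /F; apply: le_trans (leeD2r (C * Q s)%:E cm) _.
    rewrite addeAC leeD2r// -addeA leeD2l// -EFinD lee_fin /Q /C.
    rewrite le_eqVlt; apply/orP; left; apply/eqP; ring.
  have mF' : measurable_fun setT (fun s : R => F (s + h)%R).
    by apply: (measurableT_comp mF); apply: measurable_funD.
  have sub (i : interval R) : measurable_fun [set` i] F by exact: measurable_funTS.
  have IF : \int[mu]_(s in `[0%R, 1%R]) F s < +oo.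
    pose K := (c1 - c + ((2 * ep)^-1 + `|lambda| / 2) * Q 1 + C * Q 1)%R.
    have K0 : (0 <= K)%R.
      apply: addr_ge0; last exact: mulr_ge0.
      by apply: addr_ge0; [rewrite subr_ge0|apply: mulr_ge0 => //; exact: addr_ge0].
    have FK s : (0 <= s <= 1)%R -> F s <= K%:E + (1 * ep / 2)%:E * slope E (gam s) ^+ 2.
      move=> /andP[s0 s1].
      have cm := comp s (s + 1)%R 1%R s0 ltac:(lra) ltac:(lra) ltr01.
      rewrite /F; apply: le_trans (leeD2r (C * Q s)%:E cm) _.
      rewrite addeAC leeD2r// /f g1 ?e1; last lra.
      rewrite -!EFinD lee_fin (P1 (s + 1)%R); last lra.
      have q1 : (Q s <= Q 1)%R by rewrite lerD2r Pnd.
      have q2 : (P 1 - P s <= Q 1)%R by rewrite lerD2l lerN2 Pnd.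
      rewrite mulr1 -mulrDl /K lerD// ?ler_wpM2l//.
      by rewrite lerD2l ler_wpM2l// addr_ge0.
    apply: (@le_lt_trans _ _ (\int[mu]_(s in `[0%R, 1%R]) (K%:E + (1 * ep / 2)%:E * slope E (gam s) ^+ 2))).
      apply: ge0_le_integral => //.
      - by move=> s; rewrite /= in_itv/= => /andP[s0 _]; exact: F0.
      - exact: measurable_funTS.
      - by apply: emeasurable_funD => //; apply: measurable_funeM; exact: measurable_funTS.
    rewrite ge0_integralD//; last 2 first.
    - by move=> s _; rewrite mule_ge0// lee_fin !mulr_ge0// ?invr_ge0// ltW.
    - by apply: measurable_funeM; exact: measurable_funTS.
    rewrite integral_cst//= lebesgue_measure_itv/= lte01 Zl; last by rewrite !mulr_ge0// ltW.
    by rewrite -EFinB -!EFinM -EFinD ltry.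
  have step1 : \int[mu]_(s in `[0%R, 1%R]) F s <=
      \int[mu]_(s in `[0%R, 1%R]) F (s + h)%R + (h * ep / 2)%:E * j%:E.
    rewrite -Zl; last by rewrite !mulr_ge0// ltW.
    rewrite -ge0_integralD//; last 4 first.
    - by move=> s; rewrite /= in_itv/= => /andP[s0 _]; apply: F0; lra.
    - exact: measurable_funTS.
    - by move=> s _; rewrite mule_ge0// lee_fin !mulr_ge0// ?invr_ge0// ltW.
    - by apply: measurable_funeM; exact: measurable_funTS.
    apply: ge0_le_integral => //.
    - by move=> s; rewrite /= in_itv/= => /andP[s0 _]; exact: F0.
    - exact: measurable_funTS.
    - by apply: emeasurable_funD; [exact: measurable_funTS|apply: measurable_funeM; exact: measurable_funTS].
  have shift := @ge0_integral_shift_swap R 0 1 h F ler01 (ltW hp) (sub _) (fun s s01 => F0 s (proj1 (andP s01))).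
  have [ac|ca] := leP a c.
    apply: (le_trans ac); apply: (le_trans cc1); rewrite -addrA lerDl.
    apply: addr_ge0; last by rewrite !mulr_ge0// ltW.
    by apply: addr_ge0; rewrite mulr_ge0// mulr_ge0// ltW.
  have U : \int[mu]_(s in `[1%R, (1 + h)%R]) F s = ((c1 - c + C * Q 1) * h)%:E.
    rewrite (eq_integral (cst (c1 - c + C * Q 1)%:E)); last first.
      move=> s; rewrite inE /= in_itv/= => /andP[s1 _].
      by rewrite /F /f g1// e1 /Q P1// -EFinB -EFinD.
    rewrite integral_cst//= lebesgue_measure_itv/= lte_fin ltrDl hp -EFinD -EFinM.
    by congr EFin; ring.
  have L : ((a - c) * h)%:E <= \int[mu]_(s in `[0%R, (0 + h)%R]) F s.
    rewrite add0r.
    have -> : ((a - c) * h)%:E = \int[mu]_(s in `[0%R, h]) (a - c)%:E.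
      rewrite integral_cst//= lebesgue_measure_itv/= lte_fin hp -EFinD -EFinM.
      by congr EFin; ring.
    apply: ge0_le_integral => //.
    - by move=> s _; rewrite lee_fin subr_ge0 ltW.
    - exact: measurable_funTS.
    - move=> s; rewrite /= in_itv/= => /andP[s0 sh].
      have aEs : a%:E <= E (gam s) by rewrite ltW// ha// s0 (le_trans sh).
      rewrite /F /f EFinB; apply: (@le_trans _ _ (E (gam s) - c%:E)); first by rewrite leeB.
      by rewrite leeDl// lee_fin mulr_ge0// Q0.
  have I0 : 0 <= \int[mu]_(s in `[0%R, 1%R]) F s.
    by apply: integral_ge0 => s; rewrite /= in_itv/= => /andP[s0 _]; exact: F0.
  have S0 : 0 <= \int[mu]_(s in `[0%R, 1%R]) F (s + h)%R.
    by apply: integral_ge0 => s; rewrite /= in_itv/= => /andP[s0 _]; apply: F0; lra.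
  move: IF I0 S0 step1 shift L; rewrite U.
  case: (\int[mu]_(s in `[0%R, 1%R]) F s) => [i| |] // _ i0.
  case: (\int[mu]_(s in `[0%R, 1%R]) F (s + h)%R) => [u| |] // u0; last first.
    by move=> _; case: (integral _ _ _).
  case: (\int[mu]_(s in `[0%R, (0 + h)%R]) F s) => [l| |] //.
  rewrite -EFinM -!EFinD !lee_fin => s1 [s2] l0.
  have : ((a - c) * h <= (c1 - c + C * Q 1 + ep / 2 * j) * h)%R.
    apply: (le_trans l0); rewrite mulrDl (_ : ep / 2 * j * h = h * ep / 2 * j)%R; last by ring.
    lra.
  rewrite ler_pM2r// /C mulrDl; lra.
rewrite -EFinM -!EFinD lee_fin; apply/ler_addgt0Pr => e e_0.
have K0 : (0 < `|lambda| * Q 1 + 1)%R by rewrite ltr_wpDl// mulr_ge0.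
pose h : R := Num.min (Num.min h0 1%R : R) (e / (`|lambda| * Q 1 + 1))%R.
have hp : (0 < h)%R by rewrite !lt_min h00 ltr01 divr_gt0.
have hh0 : (h <= h0)%R by rewrite !ge_min lexx.
have hh1 : (h <= 1)%R by rewrite !ge_min lexx orbT.
have hhe : (h <= e / (`|lambda| * Q 1 + 1))%R by rewrite ge_min lexx orbT.
have := key h hp hh0 hh1.
have : (`|lambda| / 2 * h * Q 1 <= e)%R.
  move: hhe; rewrite ler_pdivlMr// => hhe.
  have : (0 <= h * (`|lambda| * Q 1))%R by rewrite mulr_ge0 ?mulr_ge0// ltW.
  lra.
lra.
Qed.

End upper_gradient.

(** * The lower bound for the cost *)

Section cauchy_schwarz.
Context {R : realType}.
Local Notation mu := (@lebesgue_measure R).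

(** Integrate [2 c n <= n ^+ 2 + c ^+ 2] with [c] the mean of [n]. *)
Lemma Rintegral_cauchy_schwarz (n : R -> R) (s t : R) : s <= t ->
  mu.-integrable `[s, t] (EFin \o n) ->
  mu.-integrable `[s, t] (EFin \o (fun r => n r ^+ 2)) ->
  (\int[mu]_(r in `[s, t]) n r) ^+ 2 <= (t - s) * \int[mu]_(r in `[s, t]) (n r ^+ 2).
Proof.
rewrite le_eqVlt => /predU1P[<-|st] ni n2i.
  rewrite subrr mul0r (_ : \int[mu]_(r in _) n r = 0) ?expr0n//.
  by rewrite set_itv1 Rintegral_set1.
set I := \int[mu]_(r in _) n r; set Q := \int[mu]_(r in _) _.
have key c : 2 * c * I <= Q + c ^+ 2 * (t - s).
  have mitv : measurable (`[s, t]%classic : set R) by [].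
  have ci : mu.-integrable `[s, t] (EFin \o (fun=> c ^+ 2)).
    by apply: integrable_continuous_itv; apply: continuous_subspaceT; exact: cst_continuous.
  have -> : 2 * c * I = \int[mu]_(r in `[s, t]) (2 * c * n r).
    by rewrite RintegralZl.
  have -> : Q + c ^+ 2 * (t - s) = \int[mu]_(r in `[s, t]) (n r ^+ 2 + c ^+ 2).
    rewrite RintegralD// Rintegral_cst//; congr (_ + _ * _).
    have := @lebesgue_measure_itv R `[s, t]; rewrite /= lte_fin st => st_mu.
    exact: esym (congr1 fine st_mu).
  apply: ae_le_Rintegral => //.
  - exact: integrable_EFinZ.
  - exact: integrable_EFinD.
  - apply: aeW => r _; rewrite -subr_ge0.
    rewrite (_ : _ - _ = (n r - c) ^+ 2) ?sqr_ge0//; ring.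
have ts : 0 < t - s by rewrite subr_gt0.
have := key (I / (t - s)).
rewrite -(ler_pM2l ts) (_ : (t - s) * (2 * (I / (t - s)) * I) = 2 * I ^+ 2); last first.
  by field; rewrite gt_eqF.
rewrite (_ : (t - s) * (Q + (I / (t - s)) ^+ 2 * (t - s)) = (t - s) * Q + I ^+ 2); last first.
  by field; rewrite gt_eqF.
by move: (I ^+ 2) (_ * Q) => u v; lra.
Qed.

End cauchy_schwarz.

Section action.
Context {R : realType} {X : metricType R}.
Local Notation mu := (@lebesgue_measure R).
Implicit Types (g : R -> X).
Local Open Scope ereal_scope.

(** Only almost every quotient is controlled, and nothing is known about the default
value of [lim] elsewhere; see [ge0_le_integral_null]. *)
Lemma action_density g (n : R -> R) :
  ac_on 0 1 g ->
  {ae mu, forall t : R, (0 < t < 1)%R ->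
    ((mdist (g (t + h)) (g t) / `|h|)%R @[h --> (0%R : R)^'] --> n t)} ->
  action g = (2^-1)%:E * \int[mu]_(t in `[0%R, 1%R]) (n t ^+ 2)%:E.
Proof.
move=> ac gn; rewrite /action asboolT//; congr (_ * _).
have [N [mN N0 NP]] := ae_null (ae_and (ae_and (ae_neq (0 : R)%R) (ae_neq (1 : R)%R)) gn).
apply: (ge0_eq_integral_null mN N0) => t.
- by rewrite lee_fin sqr_ge0.
- by rewrite lee_fin sqr_ge0.
rewrite /= in_itv/= => /andP[t0 t1] /NP[[tn0 tn1] lt].
congr (_ ^+ 2)%:E; apply: cvg_lim; first exact: Rhausdorff.
by apply: lt; rewrite !lt_neqAle eq_sym tn0 t0 tn1 t1.
Qed.

Lemma action_ge0 g : 0 <= action g.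
Proof.
rewrite /action; case: ifP => _; last by rewrite leey.
rewrite mule_ge0// ?lee_fin ?invr_ge0//; apply: integral_ge0 => t _.
by rewrite lee_fin sqr_ge0.
Qed.

Lemma ac_on_dist_bounded (a b : R) g : (a <= b)%R -> ac_on a b g ->
  dist_bounded (range (g \o clamp a b)).
Proof.
move=> ab /ac_on_modulus[N [_ Nnd gN]]; exists (N b - N a)%R.
suff H s t : (s <= t)%R -> (mdist ((g \o clamp a b) s) ((g \o clamp a b) t) <= N b - N a)%R.
  move=> _ _ [s _ <-] [t _ <-]; have [st|/ltW ts] := leP s t; first exact: H.
  by rewrite metric_sym; exact: H.
move=> st; apply: le_trans (gN _ _ (clamp_ge _ _ _) (clamp_homo _ _ st) (clamp_le _ ab)) _.
by rewrite lerB// Nnd// ?clamp_ge ?clamp_le.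
Qed.

End action.

Section lower_bound.
Context {R : realType} {X : metricType R}.
Local Notation mu := (@lebesgue_measure R).
Variables (E : X -> \bar R) (lambda : R).
Hypothesis E_proper : forall x, E x != -oo%E.
Hypothesis E_lsc : lower_semicontinuous E.
Hypothesis E_dom : dom E !=set0.
Hypothesis E_bounded_below : bounded_below_on_bounded E.
Hypothesis E_evi : forall x, exists g, evi_flow E lambda x g.
Implicit Types (x y z : X) (gam : R -> X).
Local Open Scope ereal_scope.

Lemma action_eps_scale (ep p : R) (J : \bar R) : (0 < ep)%R -> (0 <= p)%R -> 0 <= J ->
  (ep^-1)%:E * ((2^-1)%:E * p%:E + (ep ^+ 2)%:E * ((2^-1)%:E * J)) =
  ((2 * ep)^-1 * p)%:E + (ep / 2)%:E * J.
Proof.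
move=> ep0 p0 J0; rewrite ge0_muleDr; last 2 first.
- by rewrite -EFinM lee_fin mulr_ge0 ?invr_ge0.
- by rewrite !mule_ge0// lee_fin ?sqr_ge0 ?invr_ge0.
rewrite !muleA -!EFinM; congr (_%:E + _%:E * _); first by field; rewrite gt_eqF.
by field; rewrite gt_eqF.
Qed.

Lemma energy_gap_le x y (K : \bar R) : 0 <= K -> E x <= E y + K -> E y <= E x + K ->
  energy_gap E x y <= K.
Proof.
move=> K0; rewrite /energy_gap.
case: (E x) (E_proper x) => [a| |]// _; case: (E y) (E_proper y) => [b| |]// _ /=;
  case: K K0 => [k| |]//= k0; rewrite ?leey//.
by rewrite -!EFinD !lee_fin => h1 h2; rewrite ler_norml; apply/andP; split; lra.
Qed.

Lemma slope_action_ge0 gam : 0 <= slope_action E gam.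
Proof.
rewrite mule_ge0// ?lee_fin ?invr_ge0//; apply: integral_ge0 => t _.
by rewrite expe_ge0// slope_ge0.
Qed.

Lemma action_eps_ge0 (ep : R) gam : 0 <= action_eps E ep gam.
Proof.
by rewrite adde_ge0 ?action_ge0// mule_ge0 ?slope_action_ge0// lee_fin sqr_ge0.
Qed.

(** [energy_drop_le] for the curve and for its reversal, with [P] the primitive of the
squared speed; both curves have the same action and the same slope integral. *)
Lemma energy_gap_le_action (ep : R) gam : (0 < ep)%R ->
  ep%:E * energy_gap E (gam 0%R) (gam 1%R) <= action_eps E ep gam.
Proof.
move=> ep0.
have ge0_neNy : (ep ^+ 2)%:E * slope_action E gam != -oo.
  have : 0 <= (ep ^+ 2)%:E * slope_action E gam.
    by rewrite mule_ge0 ?slope_action_ge0// lee_fin sqr_ge0.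
  by case: (_ * _).
set J := \int[mu]_(t in `[0%R, 1%R]) (slope E (gam t) ^+ 2).
have J0 : 0 <= J by apply: integral_ge0 => t _; rewrite expe_ge0// slope_ge0.
have [ac|nac] := pselect (ac_on 0%R 1%R gam); last first.
  rewrite /action_eps /action asboolF// addye ?leey//.
have [n [n0 ni gn nlim]] := metric_derivative ltr01 ac.
have actn := action_density ac nlim.
have Qge0 : 0 <= \int[mu]_(t in `[0%R, 1%R]) (n t ^+ 2)%:E.
  by apply: integral_ge0 => t _; rewrite lee_fin sqr_ge0.
have mn : measurable_fun setT n by apply/measurable_EFinP; exact: measurable_int ni.
have [Qfin|] := ltP (\int[mu]_(t in `[0%R, 1%R]) (n t ^+ 2)%:E) +oo; last first.
  rewrite leye_eq => /eqP Qoo; rewrite /action_eps actn Qoo gt0_muley// ?lte_fin ?invr_gt0//.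
  rewrite addye ?leey//.
have n2i : mu.-integrable `[0%R, 1%R] (EFin \o (fun r => n r ^+ 2)%R).
  apply/integrableP; split.
    by apply: measurable_funTS; apply/measurable_EFinP; exact: measurable_funX.
  apply: le_lt_trans Qfin; rewrite le_eqVlt; apply/orP; left; apply/eqP.
  by apply: eq_integral => t _ /=; rewrite ger0_norm// sqr_ge0.
pose cl := clamp (0 : R) 1.
have le01 : (0 <= 1 :> R)%R by [].
pose P (t : R) : R := (\int[mu]_(r in `[0%R, cl t]) (n r ^+ 2))%R.
have PB s t : (s <= t)%R -> (P t - P s = \int[mu]_(r in `[cl s, cl t]) (n r ^+ 2))%R.
  move=> st; rewrite /P (@Rintegral_itv_cat _ 0 (cl s) (cl t)) ?clamp_ge//.
  - by rewrite addrC addKr.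
  - exact: clamp_homo.
  - apply: (integrable_sub_itv _ n2i) => //.
    by apply: subset_itvl; rewrite bnd_simp clamp_le.
have Pnd : nondecreasing P.
  by move=> s t st; rewrite -subr_ge0 PB//; apply: Rintegral_ge0 => r _; exact: sqr_ge0.
have cg : continuous (gam \o cl) by exact: ac_on_continuous_clamp.
have dP s t : (s <= t)%R ->
    (mdist ((gam \o cl) s) ((gam \o cl) t) ^+ 2 <= (t - s) * (P t - P s))%R.
  move=> st; have cst' : (cl s <= cl t)%R by exact: clamp_homo.
  have isub f : mu.-integrable `[0%R, 1%R] (EFin \o f) -> mu.-integrable `[cl s, cl t] (EFin \o f).
    move=> fi; apply: (integrable_sub_itv _ fi) => //.
    by apply: subset_itv; rewrite bnd_simp ?clamp_le ?clamp_ge.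
  have ni' : mu.-integrable `[0%R, 1%R] (EFin \o n).
    by apply: (integrable_sub_itv _ ni).
  apply: (@le_trans _ _ ((\int[mu]_(r in `[cl s, cl t]) n r) ^+ 2)%R).
    by rewrite ler_pXn2r// ?nnegrE ?mdist_ge0 ?Rintegral_ge0// gn ?clamp_ge ?clamp_le.
  apply: le_trans (Rintegral_cauchy_schwarz cst' (isub _ ni') (isub _ n2i)) _.
  rewrite PB// ler_wpM2r//; first by apply: Rintegral_ge0 => r _; exact: sqr_ge0.
  have [scl|[h1 h2]] := clamp_expand le01 st; first by rewrite (scl : cl s = cl t) subrr subr_ge0.
  exact: lerB.
have P1 t : (1 <= t)%R -> P t = P 1%R by move=> t1; rewrite /P /cl !clamp_above.
have P0 t : (t <= 0)%R -> P t = P 0%R by move=> t1; rewrite /P /cl !clamp_below.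
have Qval : \int[mu]_(t in `[0%R, 1%R]) (n t ^+ 2)%:E = (P 1 - P 0)%:E.
  have -> : (P 1 - P 0 = \int[mu]_(r in `[0%R, 1%R]) (n r ^+ 2))%R.
    by rewrite (PB 0%R 1%R le01) {1}/cl clamp_id// /cl clamp_id.
  by apply: esym; apply: fineK; rewrite ge0_fin_numE.
clearbody P.
have [c cE] := E_bounded_below (ac_on_dist_bounded le01 ac).
have clhi t : (1 <= t)%R -> cl t = 1%R by move=> t1; rewrite /cl clamp_above.
have cllo t : (t <= 0)%R -> cl t = 0%R by move=> t1; rewrite /cl clamp_below.
have Jcl : J = \int[mu]_(t in `[0%R, 1%R]) (slope E ((gam \o cl) t) ^+ 2).
  apply: eq_integral => t; rewrite inE/= in_itv/= => /andP[t0 t1].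
  by rewrite /cl clamp_id.
have action_value : (ep^-1)%:E * action_eps E ep gam =
    ((2 * ep)^-1 * (P 1 - P 0))%:E + (ep / 2)%:E * J.
  have P10 : (0 <= P 1 - P 0)%R by rewrite subr_ge0 Pnd.
  rewrite -(action_eps_scale ep0 P10 J0).
  by rewrite /action_eps actn -Qval.
have drop (gm : R -> X) (Pm : R -> R) : continuous gm -> (forall t, c%:E <= E (gm t)) ->
   (forall t, (1 <= t)%R -> gm t = gm 1%R) -> nondecreasing Pm ->
   (forall s t, (s <= t)%R -> (mdist (gm s) (gm t) ^+ 2 <= (t - s) * (Pm t - Pm s))%R) ->
   (forall t, (1 <= t)%R -> Pm t = Pm 1%R) -> (Pm 1 - Pm 0 = P 1 - P 0)%R ->
   \int[mu]_(t in `[0%R, 1%R]) (slope E (gm t) ^+ 2) = J ->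
   E (gm 0%R) <= E (gm 1%R) + (ep^-1)%:E * action_eps E ep gam.
  move=> cgm cEm gm1 Pmnd dPm Pm1 PmP Jm.
  rewrite action_value -PmP -Jm addeA.
  exact: (energy_drop_le E_proper E_lsc E_dom E_evi ep0 cgm gm1 cEm Pmnd dPm Pm1).
have A0 := action_eps_ge0 ep gam.
clear J0 Qge0 Qfin Qval n2i nlim actn action_value.
set A := action_eps E ep gam in drop A0 *; clearbody A J.
have {}cE t : c%:E <= E (gam (cl t)) by apply: cE; exists t.
clearbody cl.
suff : energy_gap E (gam 0%R) (gam 1%R) <= (ep^-1)%:E * A.
  by rewrite lee_pdivlMl.
apply: energy_gap_le.
- by apply: mule_ge0; [rewrite lee_fin invr_ge0; exact: ltW|exact: A0].
- have := @drop (gam \o cl) P cg.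
  rewrite /= clhi// cllo//; apply => //.
  + by move=> t t1; rewrite !clhi.
- have c1 : continuous (fun t : R => 1 - t : R)%R.
    by move=> t; apply: cvgB; [exact: cvg_cst|exact: cvg_id].
  have cgr : continuous (fun t : R => gam (cl (1 - t)%R)).
    by move=> t; exact: (@continuous_comp _ _ _ _ (gam \o cl) t (c1 t) (cg _)).
  have := @drop (fun t => gam (cl (1 - t)))%R (fun t => - P (1 - t))%R.
  rewrite subrr subr0 (clhi 1%R (lexx _)) (cllo 0%R (lexx _)); apply.
  + exact: cgr.
  + by move=> t; exact: cE.
  + by move=> t t1; rewrite cllo//; lra.
  + by move=> s t st; rewrite lerN2 Pnd//; lra.
  + move=> s t st; rewrite metric_sym.
    have := dP (1 - t)%R (1 - s)%R; rewrite /= => /(_ ltac:(lra)) H.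
    apply: (le_trans H); rewrite le_eqVlt; apply/orP; left; apply/eqP; ring.
  + by move=> t t1; rewrite P0//; lra.
  + by ring.
  + rewrite Jcl (@ge0_integral_affine R (-1) 1)//.
    * rewrite normrN1 mul1e (_ : affine (-1) 1 @^-1` `[0%R, 1%R] = `[0%R, 1%R]%classic); last first.
        apply/seteqP; split=> t; rewrite /affine /= !in_itv/= => /andP[h1 h2];
          by apply/andP; split; lra.
      apply: eq_integral => t _; rewrite /affine /=.
      by rewrite mulN1r opprD opprK addrCA subrr addr0.
    * by apply: measurable_funTS; exact: measurable_slope_sq cgr.
    * by move=> t _; rewrite expe_ge0// slope_ge0.
Qed.

Lemma energy_gap_le_min_cost (ep : R) x y : (0 < ep)%R ->
  ep%:E * energy_gap E x y <= min_cost E ep x y.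
Proof.
move=> ep0; apply: le_ereal_inf_tmp => _ [gam [_ [<- <-]] <-].
exact: energy_gap_le_action.
Qed.

End lower_bound.

(** * Energy dissipation along a flow *)

Section dissipation.
Context {R : realType} {X : metricType R}.
Local Notation mu := (@lebesgue_measure R).
Variables (E : X -> \bar R) (lambda : R).
Hypothesis E_proper : forall x, E x != -oo%E.
Hypothesis E_lsc : lower_semicontinuous E.
Implicit Types (x y z : X) (gam : R -> X).
Local Open Scope ereal_scope.

Lemma ge0_Rintegral_max (s t : R) (g : R -> R) : mu.-integrable `[s, t] (EFin \o g) ->
  {ae mu, forall r : R, r \in `[s, t] -> (0 <= g r)%R} ->
  \int[mu]_(r in `[s, t]) (Num.max 0 (g r))%:E = (\int[mu]_(r in `[s, t]) g r)%:E.
Proof.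
move=> gi g0.
have mg : measurable_fun `[s, t] (EFin \o g) := measurable_int _ gi.
have gfin : \int[mu]_(r in `[s, t]) (g r)%:E \is a fin_num by apply: integrable_fin_num.
rewrite /Rintegral fineK//.
apply: ae_eq_integral => //.
- apply/measurable_EFinP; apply: measurable_maxr => //; exact/measurable_EFinP.
apply: ae_imp g0 => r g0 rst; rewrite max_r//; exact: g0.
Qed.

(** The evolution inequality with [z = gam s] as reference point. The squared distance
starts from 0, so that it is bounded by the energy dropped since time [s], up to a
term that is of higher order when [t - s] is small. *)
Lemma evi_integrated x gam (s t c cl k : R) : evi_flow E lambda x gam ->
  (0 < s)%R -> (s < t)%R -> E (gam s) = c%:E ->
  measurable_fun `[s, t] (fun r => E (gam r) - cl%:E) ->
  (forall r, (s <= r <= t)%R -> cl%:E <= E (gam r)) ->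
  (forall r, (s <= r <= t)%R -> (mdist (gam r) (gam s) <= k)%R) ->
  (mdist (gam t) (gam s) ^+ 2)%:E + 2%:E * \int[mu]_(r in `[s, t]) (E (gam r) - cl%:E) <=
  (2 * (t - s) * (c - cl) + `|lambda| * (t - s) * k ^+ 2)%:E.
Proof.
move=> evi s0 st Es mE cE kb; have [acg _ eviz] := evi.
have acst := acg s t s0 st.
have [g [gi gE]] := dist_sq_density (gam s) (ltW st) acst.
pose h r := (2 * (c - cl) + `|lambda| * k ^+ 2 + -1 * g r)%R.
have k0 : (0 <= k)%R by apply: le_trans (kb s _); rewrite ?mdist_ge0 ?lexx ?ltW.
have dq := ae_quotient_density gi gE.
have [N [mN N0 NP]] := ae_null (ae_and (ae_and (ae_neq s) (ae_neq t)) (ae_and dq (eviz (gam s)))).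
have fh r : (s <= r <= t)%R -> ~ N r -> 2%:E * (E (gam r) - cl%:E) <= (h r)%:E.
  move=> /andP[sr rt] /NP[[rs rt'] [dqr evr]].
  have sr' : (s < r)%R by rewrite lt_neqAle eq_sym rs.
  have rt'' : (r < t)%R by rewrite lt_neqAle rt'.
  have [dr] := evr (lt_trans s0 sr').
  set D := fun s : R => _.
  have -> : derive1 D r = g r.
    apply: (cvg_unique _ (derivable_quotient dr)) => //.
    by apply: dqr; rewrite sr'.
  rewrite Es; have := E_proper (gam r); case: (E (gam r)) => [er| |] //= _.
  rewrite -!EFinD -EFinM !lee_fin /h /D => ev.
  have : (- (lambda * mdist (gam r) (gam s) ^+ 2) <= `|lambda| * k ^+ 2)%R.
    apply: le_trans (ler_norm _) _; rewrite normrN normrM ler_wpM2l// ger0_norm ?sqr_ge0//.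
    by rewrite ler_pXn2r ?nnegrE ?mdist_ge0// kb// sr.
  lra.
have f1 r : (s <= r <= t)%R -> 0 <= E (gam r) - cl%:E.
  by move=> srt; rewrite sube_ge0// cE.
have f0 r : (s <= r <= t)%R -> 0 <= 2%:E * (E (gam r) - cl%:E).
  by move=> srt; rewrite mule_ge0// sube_ge0// cE.
have gi' : mu.-integrable `[s, t] (EFin \o g) by exact: (integrable_sub_itv _ gi).
have gi1 : mu.-integrable `[s, t] (EFin \o (fun r => -1 * g r)%R) by exact: integrable_EFinZ.
have ci : mu.-integrable `[s, t] (EFin \o (fun=> 2 * (c - cl) + `|lambda| * k ^+ 2)%R).
  by apply: integrable_continuous_itv; apply: continuous_subspaceT; exact: cst_continuous.
have hi : mu.-integrable `[s, t] (EFin \o h) by exact: integrable_EFinD.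
have Ih : (\int[mu]_(r in `[s, t]) h r = 2 * (t - s) * (c - cl) + `|lambda| * (t - s) * k ^+ 2
    - mdist (gam t) (gam s) ^+ 2)%R.
  rewrite /h RintegralD// RintegralZl// Rintegral_cst//.
  have := gE s t (lexx _) (ltW st) (lexx _); rewrite mdistxx expr0n/= subr0 => <-.
  have := @lebesgue_measure_itv R `[s, t]; rewrite /= lte_fin st => st_mu.
  rewrite (congr1 fine st_mu) /=; ring.
rewrite -ge0_integralZl//.
rewrite -leeBrDl// -EFinB -Ih -ge0_Rintegral_max//.
  apply: (ge0_le_integral_null mN N0) => r.
  - by rewrite /= in_itv/=; exact: f0.
  - by move=> _; rewrite lee_fin le_max lexx.
  rewrite /= in_itv/= => srt Nr; apply: le_trans (fh r srt Nr) _.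
  by rewrite lee_fin le_max lexx orbT.
apply: (null_ae mN N0) => r Nr; rewrite in_itv/= => srt.
by rewrite -lee_fin; apply: le_trans (f0 r srt) (fh r srt Nr).
Qed.

End dissipation.

Section uniform_increment.
Context {R : realType}.
Local Notation mu := (@lebesgue_measure R).

(** Uniform continuity of [N] on [[a, b]], by compactness. *)
Lemma continuous_uniform_increment (N : R -> R) (a b d : R) :
  continuous N -> 0 < d ->
  exists2 h0 : R, 0 < h0 & forall h s, 0 < h -> h <= h0 -> a <= s -> s <= b ->
    N (s + h) - N s <= d.
Proof.
move=> cN d0.
have /compact_near_coveringP cov := @segment_compact R a b.
have := cov R (nbhs (0 : R)) (fun h s => N (s + h) - N s <= d) _ _.
case=> [s _|e /= e0 He].
  have d2 : 0 < d / 2 by rewrite divr_gt0.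
  have /cvgrPdist_le /(_ _ d2) N1 := cN s.
  have N2 : \forall p \near (nbhs s, nbhs (0 : R)), `|N s - N (p.1 + p.2)| <= d / 2.
    have addc : (fun p : R * R => p.1 + p.2) @ filter_prod (nbhs s) (nbhs (0 : R)) --> s + 0.
      by apply: cvgD; [exact: cvg_fst|exact: cvg_snd].
    rewrite addr0 in addc.
    have /cvgrPdist_le /(_ _ d2) := cvg_comp _ _ addc (cN s).
    exact.
  have N1' : \forall p \near (nbhs s, nbhs (0 : R)), `|N s - N p.1| <= d / 2.
    exact: (@cvg_fst _ _ (nbhs s) (nbhs (0 : R)) _ _ N1).
  near=> p.
  have h1 : `|N s - N p.1| <= d / 2 by near: p.
  have h2 : `|N s - N (p.1 + p.2)| <= d / 2 by near: p.
  by move: h1 h2; rewrite !ler_norml; lra.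
exists (e / 2); first by rewrite divr_gt0.
move=> h s h0 he as_ sb; apply: (He h); last by rewrite /= in_itv/= as_.
by rewrite /= sub0r normrN gtr0_norm//; lra.
Unshelve. all: by end_near. Qed.

Lemma integral_linear (c0 c1 s t : R) : s <= t ->
  (\int[mu]_(r in `[s, t]) (c0 + c1 * r)%:E = (c0 * (t - s) + c1 * (t ^+ 2 - s ^+ 2) / 2)%:E)%E.
Proof.
move=> st; rewrite -Rintegral_linear// /Rintegral fineK//.
apply: integrable_fin_num => //.
apply: (@integrable_continuous_itv _ (fun r => c0 + c1 * r)).
apply: continuous_subspaceT => r.
by apply: cvgD; [exact: cvg_cst|apply: cvgM; [exact: cvg_cst|exact: cvg_id]].
Qed.

End uniform_increment.

Section telescoping.
Context {R : realType}.
Local Notation mu := (@lebesgue_measure R).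
Local Open Scope ereal_scope.

Lemma integral_nondecreasing_fin (P : R -> R) (s t : R) : (s <= t)%R ->
  measurable_fun setT P -> (forall r, 0 <= P r)%R -> nondecreasing P ->
  exists2 i : R, \int[mu]_(r in `[s, t]) (P r)%:E = i%:E & (i <= (t - s) * P t)%R.
Proof.
move=> st mP P0 Pnd.
have I0 : 0 <= \int[mu]_(r in `[s, t]) (P r)%:E.
  by apply: integral_ge0 => r _; rewrite lee_fin.
have Ile : \int[mu]_(r in `[s, t]) (P r)%:E <= ((t - s) * P t)%:E.
  have -> : ((t - s) * P t)%:E = \int[mu]_(r in `[s, t]) (P t + 0 * r)%:E.
    by rewrite integral_linear// mul0r mul0r addr0 mulrC.
  apply: ge0_le_integral => //.
  - by move=> r _; rewrite lee_fin.
  - by apply: measurable_funTS; apply/measurable_EFinP.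
  - by apply: measurable_funTS; apply/measurable_EFinP; apply: measurable_funD => //; exact: measurable_funM.
  - by move=> r; rewrite /= in_itv/= => /andP[_ rt]; rewrite mul0r addr0 lee_fin Pnd.
move: I0 Ile; case: (integral _ _ _) => [i| |] // _; rewrite lee_fin => ile.
by exists i.
Qed.

(** The integral over [[a, b]] of [Phi (s + h) - Phi s] is a difference of integrals of
[Phi] over [[b, b + h]] and [[a, a + h]]. [Phi] and [Psi] stand on both sides of the
pointwise hypothesis so that every integrand is nonnegative. *)
Lemma telescoping_integral_le (a b h k w al be : R) (Phi Psi : R -> R)
    (q f : R -> \bar R) :
  (a <= b)%R -> (0 < h)%R -> (0 <= k)%R ->
  (forall r, 0 <= Phi r)%R -> nondecreasing Phi ->
  (forall r, 0 <= Psi r)%R -> nondecreasing Psi ->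
  measurable_fun `[a, b] q -> (forall s, 0 <= q s) ->
  measurable_fun `[a, b] f -> (forall s, (a <= s <= b)%R -> 0 <= f s) ->
  \int[mu]_(s in `[a, b]) f s = w%:E ->
  (forall s, (a <= s <= b)%R ->
    q s + (Phi (s + h) + Psi s)%:E <= (Phi s + Psi (s + h))%:E + k%:E * f s) ->
  \int[mu]_(s in `[a, (a + h)%R]) (Phi s)%:E <= al%:E ->
  be%:E <= \int[mu]_(s in `[b, (b + h)%R]) (Phi s)%:E ->
  \int[mu]_(s in `[a, b]) q s <= (al - be + h * Psi (b + h) + k * w)%:E.
Proof.
move=> ab hp k0 Phi0 Phind Psi0 Psind mq q0 mf f0 If pointwise alle bele.
have mPhi : measurable_fun setT Phi by exact: nondecreasing_measurable.
have mPsi : measurable_fun setT Psi by exact: nondecreasing_measurable.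
have mshift (P : R -> R) : measurable_fun setT P -> measurable_fun setT (fun s : R => P (s + h)%R).
  by move=> mP; apply: (measurableT_comp mP); exact: measurable_funD.
have ndshift (P : R -> R) : nondecreasing P -> nondecreasing (fun s : R => P (s + h)%R).
  by move=> Pnd s t st; apply: Pnd; rewrite lerD2r.
have mE (P : R -> R) (i : interval R) : measurable_fun setT P -> measurable_fun [set` i] (EFin \o P).
  by move=> mP; apply: measurable_funTS; exact/measurable_EFinP.
have {}f0 s : `[a, b]%classic s -> 0 <= f s by rewrite /= in_itv; exact: f0.
have aah : (a <= a + h)%R by rewrite lerDl ltW.
have bbh : (b <= b + h)%R by rewrite lerDl ltW.
have [u Iu _] := integral_nondecreasing_fin ab mPhi Phi0 Phind.
have [w1 Iw _] := integral_nondecreasing_fin ab mPsi Psi0 Psind.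
have [u' Iu' _] := integral_nondecreasing_fin ab (mshift _ mPhi) (fun _ => Phi0 _) (ndshift _ Phind).
have [w' Iw' _] := integral_nondecreasing_fin ab (mshift _ mPsi) (fun _ => Psi0 _) (ndshift _ Psind).
have [al' Ial _] := integral_nondecreasing_fin aah mPhi Phi0 Phind.
have [be' Ibe _] := integral_nondecreasing_fin bbh mPhi Phi0 Phind.
have [m1 Im1 _] := integral_nondecreasing_fin aah mPsi Psi0 Psind.
have [m2 Im2 m2le] := integral_nondecreasing_fin bbh mPsi Psi0 Psind.
have m10 : (0 <= m1)%R.
  by rewrite -lee_fin -Im1; apply: integral_ge0 => r _; rewrite lee_fin.
have swap1 : (u' + al' = u + be')%R.
  have := @ge0_integral_shift_swap R a b h (EFin \o Phi) ab (ltW hp) (mE _ _ mPhi) (fun s _ => Phi0 s).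
  by rewrite /= Iu' Iu Ial Ibe -!EFinD => -[].
have swap2 : (w' + m1 = w1 + m2)%R.
  have := @ge0_integral_shift_swap R a b h (EFin \o Psi) ab (ltW hp) (mE _ _ mPsi) (fun s _ => Psi0 s).
  by rewrite /= Iw' Iw Im1 Im2 -!EFinD => -[].
move: alle bele; rewrite Ial Ibe !lee_fin => alle bele.
have : \int[mu]_(s in `[a, b]) q s + (u' + w1)%:E <= (u + w')%:E + (k * w)%:E.
  have Zf : (k * w)%:E = \int[mu]_(s in `[a, b]) (k%:E * f s).
    by rewrite EFinM -If; apply: esym; apply: ge0_integralZl.
  have sum2 (P Q : R -> R) (i j : R) : measurable_fun setT P -> measurable_fun setT Q ->
      (forall r, 0 <= P r)%R -> (forall r, 0 <= Q r)%R ->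
      \int[mu]_(s in `[a, b]) (P s)%:E = i%:E -> \int[mu]_(s in `[a, b]) (Q s)%:E = j%:E ->
      \int[mu]_(s in `[a, b]) (P s + Q s)%:E = (i + j)%:E.
    move=> mP mQ P0 Q0 iE jE; rewrite EFinD -iE -jE -ge0_integralD//.
    - by move=> s _; rewrite lee_fin.
    - exact: mE.
    - by move=> s _; rewrite lee_fin.
    - exact: mE.
  rewrite Zf -(sum2 _ _ _ _ (mshift _ mPhi) mPsi (fun _ => Phi0 _) Psi0 Iu' Iw).
  rewrite -(sum2 _ _ _ _ mPhi (mshift _ mPsi) Phi0 (fun _ => Psi0 _) Iu Iw').
  have mS1 : measurable_fun `[a, b] (fun s : R => (Phi (s + h) + Psi s)%:E).
    by apply: (mE (fun s : R => Phi (s + h) + Psi s)%R); apply: measurable_funD => //; exact: mshift.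
  have mS2 : measurable_fun `[a, b] (fun s : R => (Phi s + Psi (s + h))%:E).
    by apply: (mE (fun s : R => Phi s + Psi (s + h))%R); apply: measurable_funD => //; exact: mshift.
  have mf2 : measurable_fun `[a, b] (fun s : R => k%:E * f s) by exact: measurable_funeM.
  have S10 s : 0 <= (Phi (s + h) + Psi s)%:E by rewrite lee_fin addr_ge0.
  have S20 s : 0 <= (Phi s + Psi (s + h))%:E by rewrite lee_fin addr_ge0.
  have f20 s : `[a, b]%classic s -> 0 <= k%:E * f s by move=> /f0 ?; rewrite mule_ge0.
  rewrite -!ge0_integralD//.
  apply: ge0_le_integral => //.
  - by move=> s _; apply: adde_ge0.
  - exact: emeasurable_funD.
  - exact: emeasurable_funD.
move: m2le; rewrite (_ : (b + h - b = h)%R); last by ring.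
move=> m2le; clear - swap1 swap2 alle bele m2le m10.
case: (integral _ _ _) => [A| |] //; last by move=> _; rewrite leNye.
rewrite -!EFinD !lee_fin; lra.
Qed.

End telescoping.

Section energy_dissipation.
Context {R : realType} {X : metricType R}.
Local Notation mu := (@lebesgue_measure R).
Variables (E : X -> \bar R) (lambda : R).
Hypothesis E_proper : forall x, E x != -oo%E.
Hypothesis E_lsc : lower_semicontinuous E.
Hypothesis E_bounded_below : bounded_below_on_bounded E.
Implicit Types (x y z : X) (gam : R -> X).
Local Open Scope ereal_scope.

Lemma mdist_continuous2 (g1 g2 : R -> X) : continuous g1 -> continuous g2 ->
  continuous (fun r => mdist (g1 r) (g2 r)).
Proof.
move=> c1 c2 t; apply/cvgrPdist_le => e e0.
have d1 : mdist (g1 r) (g1 t) @[r --> t] --> (0 : R)%R.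
  rewrite -(mdistxx (g1 t)).
  exact: (@cvg_comp _ _ _ g1 (fun x : X => mdist x (g1 t)) _ _ _ (c1 t) (@mdist_continuous _ _ _ _)).
have d2 : mdist (g2 r) (g2 t) @[r --> t] --> (0 : R)%R.
  rewrite -(mdistxx (g2 t)).
  exact: (@cvg_comp _ _ _ g2 (fun x : X => mdist x (g2 t)) _ _ _ (c2 t) (@mdist_continuous _ _ _ _)).
have e2 : (0 < e / 2)%R by rewrite divr_gt0.
move/cvgrPdist_le : d1 => /(_ _ e2) N1; move/cvgrPdist_le : d2 => /(_ _ e2) N2.
near=> r.
have h1 : (`|0 - mdist (g1 r) (g1 t)| <= e / 2)%R by near: r.
have h2 : (`|0 - mdist (g2 r) (g2 t)| <= e / 2)%R by near: r.
move: h1 h2; rewrite sub0r normrN (ger0_norm (mdist_ge0 _ _)).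
rewrite sub0r normrN (ger0_norm (mdist_ge0 _ _)) => h1 h2.
have := mdist_triangleB (g1 t) (g1 r) (g2 t); have := mdist_triangleB (g2 t) (g2 r) (g1 r).
rewrite (metric_sym (g2 t) (g2 r)) (metric_sym (g1 t) (g1 r)).
rewrite (metric_sym (g2 t) (g1 r)) (metric_sym (g2 r) (g1 r)).
by rewrite !ler_norml => /andP[? ?] /andP[? ?]; apply/andP; split; lra.
Unshelve. all: by end_near. Qed.

Lemma measurable_increment gam (a b T h : R) : ac_on a T gam -> (a <= b)%R ->
  (0 <= h)%R -> (b + h <= T)%R ->
  measurable_fun `[a, b] (fun s : R => mdist (gam (s + h)%R) (gam s)).
Proof.
move=> acT ab h0 bT; have aT : (a <= T)%R by lra.
have cg := ac_on_continuous_clamp aT acT.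
have shc : continuous (fun s : R => s + h : R)%R.
  by move=> s; apply: cvgD; [exact: cvg_id|exact: cvg_cst].
have cgh : continuous (fun s : R => (gam \o clamp a T) (s + h)%R).
  by move=> s; exact: (@continuous_comp _ _ _ _ (gam \o clamp a T) s (shc s) (cg _)).
have cm := mdist_continuous2 cgh cg.
apply: (eq_measurable_fun (fun s : R => mdist ((gam \o clamp a T) (s + h)%R) ((gam \o clamp a T) s))).
  move=> s; rewrite inE/= in_itv/= => /andP[as_ sb].
  by rewrite !clamp_id//; lra.
by apply: measurable_funTS; exact: continuous_measurable_fun.
Qed.

(** Packages a flow on [[a, T]] into real functions: [c] is a lower bound of the energy,
[F] the primitive of [E \o gam - c] that vanishes at [a], and [N] dominates the
increments of [gam]. The last clause is [evi_integrated]; it also shows that [F] is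
finite. *)
Lemma evi_energy_primitive x gam (a T ca v : R) : evi_flow E lambda x gam ->
  (0 < a)%R -> (a < T)%R -> E (gam a) = ca%:E ->
  exists (c : R) (F N : R -> R),
  [/\ [/\ (c <= v)%R, (c <= ca)%R,
          forall r, (a <= r <= T)%R -> c%:E <= E (gam r) &
          measurable_fun `[a, T] (fun r => E (gam r) - c%:E)],
      [/\ continuous N, nondecreasing N, nondecreasing F, F a = 0%R &
          forall r, (0 <= F r)%R],
      forall s t, (a <= s)%R -> (s <= t)%R -> (t <= T)%R ->
        (F t)%:E = (F s)%:E + \int[mu]_(r in `[s, t]) (E (gam r) - c%:E) &
      forall s t cs, (a <= s)%R -> (s < t)%R -> (t <= T)%R -> E (gam s) = cs%:E ->
        (mdist (gam t) (gam s) ^+ 2 + 2 * (F t - F s) <=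
          2 * (t - s) * (cs - c) + `|lambda| * (t - s) * (N t - N s) ^+ 2)%R].
Proof.
move=> evi a0 aT Ea; have [acg _ _] := evi.
have acT := acg a T a0 aT.
have [N [cN Nnd gN]] := ac_on_modulus acT.
have cg := ac_on_continuous_clamp (ltW aT) acT.
have [c [cE cv cca]] : exists c,
    [/\ forall r, c%:E <= E ((gam \o clamp a T) r), (c <= v)%R & (c <= ca)%R].
  have [c0 c0E] := E_bounded_below (ac_on_dist_bounded (ltW aT) acT).
  exists (Num.min c0 v); split=> [r||]; last 2 first.
  - by rewrite ge_min lexx orbT.
  - rewrite ge_min; apply/orP; left; rewrite -lee_fin -Ea.
    by apply: c0E; exists a => //=; rewrite clamp_id// ltW.
  apply: (@le_trans _ _ c0%:E); first by rewrite lee_fin ge_min lexx.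
  by apply: c0E; exists r.
have {}cE r : (a <= r <= T)%R -> c%:E <= E (gam r).
  by move=> /andP[ar rT]; have := cE r; rewrite /= clamp_id.
pose f r := E (gam r) - c%:E.
have f0 r : (a <= r <= T)%R -> 0 <= f r by move=> arT; rewrite sube_ge0// cE.
have mf : measurable_fun `[a, T] f.
  apply: (eq_measurable_fun (fun r => E ((gam \o clamp a T) r) - c%:E)).
    by move=> r; rewrite inE/= in_itv/= => /andP[ar rT]; rewrite /f clamp_id.
  apply: measurable_funTS; apply: emeasurable_funB => //.
  exact: (measurable_energy E_lsc cg).
have sub s t : (a <= s)%R -> (t <= T)%R -> `[s, t]%classic `<=` (`[a, T]%classic : set R).
  by move=> as_ tT; apply: subset_itv; rewrite bnd_simp.
have incr s t cs : (a <= s)%R -> (s < t)%R -> (t <= T)%R -> E (gam s) = cs%:E ->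
    (mdist (gam t) (gam s) ^+ 2)%:E + 2%:E * \int[mu]_(r in `[s, t]) f r <=
    (2 * (t - s) * (cs - c) + `|lambda| * (t - s) * (N t - N s) ^+ 2)%:E.
  move=> as_ st tT Es; have s0 : (0 < s)%R by exact: lt_le_trans as_.
  apply: (@evi_integrated _ _ E lambda E_proper x gam s t cs c (N t - N s)%R evi s0 st Es).
  - by apply: measurable_funS mf => //; exact: sub.
  - by move=> r /andP[sr rt]; rewrite cE// (le_trans as_ sr) (le_trans rt).
  - move=> r /andP[sr rt]; rewrite metric_sym.
    apply: le_trans (gN s r as_ sr (le_trans rt tT)) _.
    by rewrite lerD2r Nnd.
have IaT : \int[mu]_(r in `[a, T]) f r < +oo.
  have := incr a T ca (lexx _) aT (lexx _) Ea.
  have : 0 <= (mdist (gam T) (gam a) ^+ 2)%:E by rewrite lee_fin sqr_ge0.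
  case: (integral _ _ _) => [i| |] // _; first by rewrite ltry.
  by rewrite gt0_muley ?lte_fin.
have I0 s t : (a <= s)%R -> (t <= T)%R -> 0 <= \int[mu]_(r in `[s, t]) f r.
  move=> as_ tT; apply: integral_ge0 => r /(sub _ _ as_ tT).
  by rewrite /= in_itv; exact: f0.
have Ifin s t : (a <= s)%R -> (t <= T)%R -> \int[mu]_(r in `[s, t]) f r \is a fin_num.
  move=> as_ tT; rewrite ge0_fin_numE; last exact: I0.
  apply: le_lt_trans IaT; apply: ge0_subset_integral => //; exact: sub.
pose F r := fine (\int[mu]_(q in `[a, clamp a T r]) f q).
have FE s t : (a <= s)%R -> (s <= t)%R -> (t <= T)%R ->
    (F t)%:E = (F s)%:E + \int[mu]_(r in `[s, t]) f r.
  move=> as_ st tT.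
  rewrite /F (clamp_id as_ (le_trans st tT)) (clamp_id (le_trans as_ st) tT).
  rewrite !fineK ?Ifin//; last exact: le_trans tT.
  apply: ge0_integral_itv_split => //; first by apply: measurable_funS mf => //; exact: sub.
  by move=> r /andP[ar rt]; rewrite f0// ar (le_trans rt).
exists c, F, N; split=> //; last first.
  move=> s t cs as_ st tT Es; have := incr s t cs as_ st tT Es.
  have := FE s t as_ (ltW st) tT.
  case: (integral _ _ _) => [i| |] // [->].
  by rewrite -EFinM -EFinD lee_fin (addrC (F s)) addrK.
split=> //.
- move=> s t st; rewrite /F.
  apply: fine_le; [by apply: Ifin => //; exact: clamp_le (ltW aT)..|].
  have cT := clamp_le t (ltW aT).
  apply: ge0_subset_integral => //.
  + by apply: measurable_funS mf => //; exact: sub.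
  + by move=> r; rewrite /= in_itv/= => /andP[ar rt]; rewrite f0// ar (le_trans rt).
  + by apply: subset_itvl; rewrite bnd_simp clamp_homo.
- by rewrite /F (clamp_id (lexx a) (ltW aT)) set_itv1 integral_set1.
- by move=> r; rewrite /F fine_ge0// I0// clamp_le// ltW.
Qed.

(** Apply the last clause of [evi_energy_primitive] on [[s, s + h]] and integrate in [s].
Writing [F'] for the energy above [c], the sum of [2 h F' s - 2 (F (s + h) - F s)]
telescopes to the difference of twice the integrals of [F - F a] over [[a, a + h]] and
of [F - F b] over [[b, b + h]]. The first is at most about [h ^+ 2 (ca - c)], again by the
evolution inequality started at [a]; the second is at least about [h ^+ 2 (v - c)], by
lower semicontinuity at [b]. The term in [lambda] has order [h] times
[(N (s + h) - N s) ^+ 2], which is negligible by uniform continuity of [N]. *)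
Lemma evi_increment_sq_le x gam (a b ca v d : R) : evi_flow E lambda x gam ->
  (0 < a)%R -> (a < b)%R -> E (gam a) = ca%:E -> v%:E < E (gam b) -> (0 < d)%R ->
  exists2 h0 : R, (0 < h0)%R & forall h, (0 < h)%R -> (h <= h0)%R ->
    \int[mu]_(s in `[a, b]) (mdist (gam (s + h)%R) (gam s) ^+ 2)%:E <=
    (h ^+ 2 * (ca - v + d))%:E.
Proof.
move=> evi a0 ab Ea vE d0.
have [T TE] : exists T, T = (b + 1)%R by eexists.
have aT : (a < T)%R by rewrite TE; lra.
have bT : (b <= T)%R by rewrite TE lerDl.
have acT : ac_on a T gam by have [acg _ _] := evi; exact: acg.
have [c [F [N [[cv cca cE mf] [cN Nnd Fnd Fa F0] FE incr]]]] := evi_energy_primitive v evi a0 aT Ea.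
have [V VE] : exists V, V = (N T - N a)%R by eexists.
have V0 : (0 <= V)%R by rewrite VE subr_ge0 Nnd// ltW.
(* D is chosen so that the two errors, D / 2 and D V, add up to at most d. *)
have [D DE] : exists D, D = (d / (1 + V))%R by eexists.
have D0 : (0 < D)%R by rewrite DE divr_gt0// ltr_wpDr.
have DV : (D * (1 + V) = d)%R by rewrite DE divfK// gt_eqF// ltr_wpDr.
have [om [om0 om1 lom]] : exists om : R, [/\ (0 < om)%R, (om <= 1)%R & (`|lambda| * om <= D)%R].
  have l1 : (0 < `|lambda| + 1)%R by rewrite ltr_wpDl.
  exists (Num.min (1 : R)%R (D / (`|lambda| + 1))%R); split.
  - by rewrite lt_min ltr01 divr_gt0.
  - by rewrite ge_min lexx.
  apply: (@le_trans _ _ (`|lambda| * (D / (`|lambda| + 1)))%R).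
    by rewrite ler_wpM2l// ge_min lexx orbT.
  by rewrite mulrCA ger_pMr// ler_pdivrMr// mul1r lerDl.
have [h1 h10 H1] := continuous_uniform_increment a b cN om0.
have [h2 h20 H2] : exists2 h2, (0 < h2)%R & forall r, (b <= r <= b + h2)%R -> v%:E <= E (gam r).
  have gb : gam r @[r --> b] --> gam b by exact: evi_flow_cvg evi (lt_trans a0 ab).
  have [e /= e0 He] : \forall r \near b, v%:E < E (gam r) by exact: gb _ (lsc_near E_lsc vE).
  exists (e / 2)%R; first by rewrite divr_gt0.
  move=> r /andP[br re]; apply/ltW/He; rewrite /= distrC ger0_norm; clear - br re e0; lra.
exists (Num.min h1 (Num.min h2 1))%R; first by rewrite !lt_min h10 h20 ltr01.
move=> h hp; rewrite !le_min => /and3P[hh1 hh2 hh3].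
have bhT : (b + h <= T)%R by rewrite TE lerD2l.
have pointwise s : (a <= s <= b)%R ->
    (mdist (gam (s + h)%R) (gam s) ^+ 2)%:E + (2 * F (s + h) + D * h * N s)%:E <=
    (2 * F s + D * h * N (s + h))%:E + (2 * h)%:E * (E (gam s) - c%:E).
  move=> /andP[as_ sb].
  have [Es|Efin] := eqVneq (E (gam s)) +oo.
    by rewrite Es addye// gt0_muley ?addey ?leey// lte_fin mulr_gt0.
  have [cs Es] : exists cs, E (gam s) = cs%:E.
    by move: Efin (E_proper (gam s)); case: (E (gam s)) => [cs| |]// _ _; exists cs.
  have ssh : (s < s + h)%R by rewrite ltrDl.
  have k0 : (0 <= N (s + h) - N s)%R by rewrite subr_ge0 Nnd// ltW.
  have kom : (N (s + h) - N s <= om)%R by apply: H1.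
  have shT : (s + h <= T)%R by apply: le_trans bhT; rewrite lerD2r.
  have := incr s (s + h)%R cs as_ ssh shT Es.
  rewrite Es (addrC s h) addrK -?EFinB -!EFinM -!EFinD lee_fin.
  have : (`|lambda| * h * (N (h + s) - N s) ^+ 2 <= D * h * (N (h + s) - N s))%R.
    rewrite (addrC s h) in k0 kom; move: k0 kom; set k := (N _ - N s)%R => k0 kom.
    rewrite [leLHS](_ : _ = h * k * (`|lambda| * k))%R; last by ring.
    rewrite [leRHS](_ : _ = h * k * D)%R; last by ring.
    rewrite ler_wpM2l ?mulr_ge0 ?(ltW hp)//; apply: le_trans lom.
    by rewrite ler_wpM2l.
  clear; move: (mdist _ _ ^+ 2)%R (F _) (F s) (N _) (N s) => q F1 F2 N1 N2.
  rewrite !mulrBr; lra.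
pose M r := (N (clamp a T r) - N a)%R.
have M0 r : (0 <= M r)%R by rewrite subr_ge0 Nnd// clamp_ge.
have Mnd : nondecreasing M by move=> s t st; rewrite lerD2r Nnd// clamp_homo.
have ME r : (a <= r)%R -> (r <= T)%R -> M r = (N r - N a)%R by move=> ar rT; rewrite /M clamp_id.
have Dh0 : (0 <= D * h)%R by rewrite mulr_ge0// ltW.
have mF (s t : R) : measurable_fun `[s, t] (fun r : R => (2 * F r)%:E).
  apply: measurable_funTS; apply/measurable_EFinP; apply: measurable_funM => //.
  exact: nondecreasing_measurable.
have mL (B C s t : R) : measurable_fun `[s, t] (fun r : R => (B + C * r)%:E).
  by apply: measurable_funTS; apply/measurable_EFinP; apply: measurable_funD.
(* Near a the primitive F grows at most like the energy at a. *)
have alle : \int[mu]_(r in `[a, (a + h)%R]) (2 * F r)%:E <= ((ca - c + D / 2) * h ^+ 2)%:E.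
  pose K := (ca - c + D / 2)%R.
  have -> : ((ca - c + D / 2) * h ^+ 2)%:E =
      \int[mu]_(r in `[a, (a + h)%R]) (- (2 * K * a) + 2 * K * r)%:E.
    by rewrite integral_linear ?lerDl ?(ltW hp)// /K; congr EFin; field.
  apply: ge0_le_integral => //.
  - by move=> r _; rewrite lee_fin mulr_ge0.
  - exact: mF.
  - exact: mL.
  move=> r; rewrite /= in_itv/= => /andP[]; rewrite le_eqVlt => /predU1P[<- _|ar rah].
    by rewrite lee_fin Fa mulr0 addNr.
  have rT : (r <= T)%R by apply: le_trans rah _; apply: le_trans bhT; rewrite lerD2r ltW.
  have hk0 : (0 <= N r - N a)%R by rewrite subr_ge0 Nnd// ltW.
  have hk : (N r - N a <= om)%R.
    have := @H1 (r - a)%R a; rewrite (_ : (a + (r - a) = r)%R); last by ring.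
    apply; rewrite ?lexx ?subr_gt0 ?(ltW ab)//.
    by apply: le_trans hh1; rewrite lerBlDl.
  have := incr a r ca (lexx _) ar rT Ea; rewrite Fa subr0.
  have D1 : (0 <= mdist (gam r) (gam a) ^+ 2)%R by exact: sqr_ge0.
  have : (`|lambda| * (r - a) * (N r - N a) ^+ 2 <= D * (r - a))%R.
    rewrite mulrAC ler_wpM2r ?subr_ge0 ?(ltW ar)//.
    apply: le_trans lom; rewrite ler_wpM2l// expr2.
    by apply: (le_trans _ hk); rewrite ler_piMr// (le_trans hk).
  rewrite lee_fin /K; move: D1; move: (mdist _ _ ^+ 2)%R (`|lambda| * _ * _)%R => q w; clear.
  rewrite !(mulrDl, mulrDr, mulrBr, mulrBl); lra.
(* Near b it grows at least like v, by lower semicontinuity. *)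
have bele : (2 * F b * h + (v - c) * h ^+ 2)%:E <= \int[mu]_(r in `[b, (b + h)%R]) (2 * F r)%:E.
  pose L := (2 * (v - c))%R.
  have L0 : (0 <= L)%R by rewrite mulr_ge0// subr_ge0.
  have -> : (2 * F b * h + (v - c) * h ^+ 2)%:E =
      \int[mu]_(r in `[b, (b + h)%R]) (2 * F b - L * b + L * r)%:E.
    by rewrite integral_linear ?lerDl ?(ltW hp)// /L; congr EFin; field.
  apply: ge0_le_integral => //.
  - move=> r; rewrite /= in_itv/= => /andP[br _]; rewrite lee_fin -addrA addr_ge0 ?mulr_ge0//.
    by rewrite addrC -mulrBr mulr_ge0// subr_ge0.
  - exact: mL.
  - exact: mF.
  move=> r; rewrite /= in_itv/= => /andP[br rbh].
  have rT : (r <= T)%R by exact: le_trans bhT.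
  have := FE b r (ltW ab) br rT.
  have : ((v - c) * (r - b))%:E <= \int[mu]_(q in `[b, r]) (E (gam q) - c%:E).
    have -> : ((v - c) * (r - b))%:E = \int[mu]_(q in `[b, r]) (v - c + 0 * q)%:E.
      by rewrite integral_linear// !mul0r addr0.
    apply: ge0_le_integral => //.
    + by move=> q _; rewrite mul0r addr0 lee_fin subr_ge0.
    + exact: mL.
    + apply: measurable_funS mf => //; apply: subset_itv; rewrite bnd_simp//; exact: ltW.
    move=> q; rewrite /= in_itv/= => /andP[bq qr].
    have vq : v%:E <= E (gam q).
      by apply: H2; rewrite bq (le_trans qr)// (le_trans rbh)// lerD2l.
    by rewrite mul0r addr0 EFinD; exact: leeD2r.
  case: (integral _ _ _) => [i| |] //; rewrite lee_fin => li [->].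
  rewrite lee_fin /L; move: li; clear; rewrite !(mulrBl, mulrBr, mulrDr); lra.
have Dh : (0 <= 2 * h)%R by rewrite mulr_ge0// ltW.
have If : \int[mu]_(s in `[a, b]) (E (gam s) - c%:E) = (F b)%:E.
  by rewrite (FE a b (lexx _) (ltW ab) bT) Fa add0e.
have H := @telescoping_integral_le R a b h (2 * h)%R (F b) _ _
  (fun s => 2 * F s)%R (fun s => D * h * M s)%R
  (fun s => (mdist (gam (s + h)%R) (gam s) ^+ 2)%:E) (fun s => E (gam s) - c%:E)
  (ltW ab) hp Dh _ _ _ _ _ _ _ _ If _ alle bele.
apply: le_trans (H _ _ _ _ _ _ _ _ _) _ => {H}.
- by move=> r; rewrite mulr_ge0.
- by move=> s t st; rewrite ler_wpM2l// Fnd.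
- by move=> r; rewrite mulr_ge0.
- by move=> s t st; rewrite ler_wpM2l// Mnd.
- apply/measurable_EFinP; apply: measurable_funX.
  exact: (measurable_increment acT (ltW ab) (ltW hp) bhT).
- by move=> s; rewrite lee_fin sqr_ge0.
- by apply: measurable_funS mf => //; apply: subset_itvl; rewrite bnd_simp.
- by move=> s /andP[as_ sb]; rewrite sube_ge0// cE// as_ (le_trans sb).
- move=> s /andP[as_ sb]; have := pointwise s; rewrite as_ sb => /(_ isT).
  have shT : (s + h <= T)%R by apply: le_trans bhT; rewrite lerD2r.
  rewrite !ME ?(le_trans sb)//; last by rewrite (le_trans as_)// lerDl ltW.
  clear; case: (_ * (E _ - _)) => [w| |]; last 2 first.
  - by move=> _; rewrite addey ?leey.
  - by rewrite addeNy leeNy_eq -EFinD.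
  rewrite -!EFinD !lee_fin; rewrite !mulrBr; lra.
have Vb : (N (b + h) - N a <= V)%R by rewrite VE lerD2r Nnd.
rewrite lee_fin ME//; last by rewrite (le_trans (ltW ab))// lerDl ltW.
apply: (@le_trans _ _ (h ^+ 2 * (ca - v + D / 2 + D * V))%R); last first.
  by rewrite ler_wpM2l ?sqr_ge0// -DV -addrA lerD2l mulrDr mulr1 lerD2r ler_pdivrMr// ler_pMr// ler1n.
have : (h * (D * h * (N (b + h) - N a)) <= h * (D * h * V))%R by rewrite ler_wpM2l ?(ltW hp)// ler_wpM2l.
set X1 := (h * _)%R; clearbody X1; move=> H.
apply: (@le_trans _ _ ((ca - c + D / 2) * h ^+ 2 - (2 * F b * h + (v - c) * h ^+ 2) + h * (D * h * V) + 2 * h * F b)%R).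
  by rewrite lerD2r lerD2l.
by rewrite le_eqVlt; apply/orP; left; apply/eqP; field.
Qed.

End energy_dissipation.

Section speed.
Context {R : realType} {X : metricType R}.
Local Notation mu := (@lebesgue_measure R).
Variables (E : X -> \bar R) (lambda : R).
Hypothesis E_proper : forall x, E x != -oo%E.
Hypothesis E_lsc : lower_semicontinuous E.
Hypothesis E_bounded_below : bounded_below_on_bounded E.
Hypothesis E_evi : forall x, exists g, evi_flow E lambda x g.
Implicit Types (x y z : X) (gam : R -> X).
Local Open Scope ereal_scope.

Lemma limn_einf_le (u : (\bar R)^nat) (l : \bar R) :
  (\forall k \near \oo, u k <= l) -> limn_einf u <= l.
Proof.
move=> ul; rewrite limn_einf_lim; apply: lime_le; first exact: is_cvg_einfs.
near=> m; apply: (@le_trans _ _ (u m)); last by near: m.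
by apply: ereal_inf_lbound; exists m => /=.
Unshelve. all: by end_near. Qed.

(** Fatou's lemma in [evi_increment_sq_le]. It is the energy dissipation inequality,
with an arbitrary [v] below the energy at [b] since that energy is not yet known to be
finite. *)
Lemma speed_sq_le x gam (a b ca v : R) (n : R -> R) : evi_flow E lambda x gam ->
  (0 < a)%R -> (a < b)%R -> E (gam a) = ca%:E -> v%:E < E (gam b) ->
  {ae mu, forall t : R, (a < t < b)%R ->
    ((mdist (gam (t + h)) (gam t) / `|h|)%R @[h --> (0%R : R)^'] --> n t)} ->
  \int[mu]_(t in `[a, b]) (n t ^+ 2)%:E <= (ca - v)%:E.
Proof.
move=> evi a0 ab Ea vE nlim.
have [acg _ _] := evi; have acT := acg a (b + 1)%R a0 ltac:(lra).
pose hk (k : nat) : R := (k.+1%:R^-1)%R.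
have hk0 k : (0 < hk k)%R by rewrite invr_gt0.
have hk1 k : (hk k <= 1)%R by rewrite invf_le1 ?ler1n.
have chk : hk k @[k --> \oo] --> (0 : R)%R by exact: cvg_harmonic.
pose q k s := ((hk k)^-1 ^+ 2 * mdist (gam (s + hk k)) (gam s) ^+ 2)%R.
have mq k : measurable_fun `[a, b] (EFin \o q k).
  apply/measurable_EFinP; apply: measurable_funM => //.
  apply: measurable_funX.
  apply: (measurable_increment acT (ltW ab) (ltW (hk0 k))).
  by rewrite lerD2l.
have q0 k s : 0 <= (EFin \o q k) s by rewrite lee_fin mulr_ge0 ?sqr_ge0.
have [N [mN N0 NP]] := ae_null (ae_and (ae_and (ae_neq a) (ae_neq b)) nlim).
have nq : \int[mu]_(t in `[a, b]) (n t ^+ 2)%:E =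
    \int[mu]_(t in `[a, b]) limn_einf (fun k => (EFin \o q k) t).
  apply: (ge0_eq_integral_null mN N0) => t.
  - by rewrite lee_fin sqr_ge0.
  - move=> _; rewrite limn_einf_lim; apply: lime_ge; first exact: is_cvg_einfs.
    by apply: nearW => k; apply: le_ereal_inf_tmp => _ [m _ <-]; exact: q0.
  rewrite /= in_itv/= => /andP[at_ tb] /NP[[ta tb'] lt].
  have {}lt := lt _; apply: esym; apply: (cvg_limn_einf_sup _).1.
  have abt : (a < t < b)%R by rewrite !lt_neqAle eq_sym ta at_ tb' tb.
  have ck : (mdist (gam (t + hk k)) (gam t) / `|hk k|)%R @[k --> \oo] --> n t.
    apply: (cvg_comp _ _ _ (lt abt)) => A A0.
    have : \forall m \near \oo, (hk m != 0)%R -> A (hk m) by exact: (chk _ A0).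
    suff : (\forall m \near \oo, (hk m != 0)%R -> A (hk m)) -> \forall m \near \oo, A (hk m) by [].
    by apply: filterS => m; apply; rewrite gt_eqF.
  have qr : q k t @[k --> \oo] --> (n t ^+ 2)%R.
    rewrite expr2; apply: cvg_trans (cvgM ck ck); apply: near_eq_cvg; apply: nearW => k.
    by rewrite /= gtr0_norm// /q; ring.
  by apply/fine_cvgP; split; [exact: nearW|exact: qr].
rewrite nq; apply: le_trans (fatou mu _ mq (fun k s _ => q0 k s)) _ => //.
apply/lee_addgt0Pr => d d0; apply: limn_einf_le.
have [h0 h00 H] := evi_increment_sq_le E_proper E_lsc E_bounded_below evi a0 ab Ea vE d0.
have : \forall k \near \oo, (hk k < h0)%R.
  by move/cvgrPdist_lt : chk => /(_ _ h00); apply: filterS => k; rewrite sub0r normrN gtr0_norm.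
apply: filterS => k kh.
have hkne : (hk k != 0)%R by rewrite gt_eqF.
have -> : \int[mu]_(t in `[a, b]) (EFin \o q k) t =
    ((hk k)^-1 ^+ 2)%:E * \int[mu]_(t in `[a, b]) (mdist (gam (t + hk k)%R) (gam t) ^+ 2)%:E.
  have md : measurable_fun `[a, b] (fun t : R => (mdist (gam (t + hk k)%R) (gam t) ^+ 2)%:E).
    apply/measurable_EFinP; apply: measurable_funX.
    by apply: (measurable_increment acT (ltW ab) (ltW (hk0 k))); rewrite lerD2l.
  rewrite -ge0_integralZl//; first by move=> t _; rewrite lee_fin sqr_ge0.
  by rewrite lee_fin sqr_ge0.
rewrite exprVn lee_pdivrMl ?exprn_gt0// -EFinD -EFinM.
exact: (H (hk k) (hk0 k) (ltW kh)).
Qed.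

End speed.

(** * Speed and slope of a flow from its starting point *)

Section flow_speed.
Context {R : realType} {X : metricType R}.
Local Notation mu := (@lebesgue_measure R).
Variables (E : X -> \bar R) (lambda : R).
Hypothesis E_proper : forall x, E x != -oo%E.
Hypothesis E_lsc : lower_semicontinuous E.
Hypothesis E_bounded_below : bounded_below_on_bounded E.
Hypothesis E_evi : forall x, exists g, evi_flow E lambda x g.
Implicit Types (x y z : X) (gam : R -> X).
Local Open Scope ereal_scope.

(** A curve of speed [nu] at time [s] moves by at most [(nu + d) h] in a short time [h], so
[slope_of_short_time] gives the global form of the slope bound. *)
Lemma slope_le_speed x gam (s c nu : R) : evi_flow E lambda x gam -> (0 < s)%R ->
  E (gam s) = c%:E ->
  (mdist (gam (s + h)) (gam s) / `|h|)%R @[h --> (0%R : R)^'] --> nu ->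
  slope E (gam s) <= nu%:E.
Proof.
move=> evi s0 Es qn.
have nu0 : (0 <= nu)%R.
  apply: (ler_cvg_to (cvg_cst (0 : R)%R) qn); apply: nearW => h.
  by rewrite divr_ge0 ?mdist_ge0.
apply/(slope_leP E_proper E_lsc E_evi Es nu0) => z; rewrite Es.
have := E_proper z; case Ez : (E z) => [cz| |] // _; last by rewrite addye ?leey.
rewrite -EFinD lee_fin; apply/ler_addgt0Pr => e e0.
pose d := (e / (mdist (gam s) z + 1))%R.
have D0 := mdist_ge0 (gam s) z.
have d0 : (0 < d)%R by rewrite divr_gt0// ltr_wpDl.
have gs : gam r @[r --> s^'+] --> gam s by apply: cvg_at_right_filter; exact: evi_flow_cvg evi s0.
have short h0 : (0 < h0)%R ->
    exists h, [/\ (0 < h)%R, (h < h0)%R & (mdist (gam (s + h)) (gam s) <= (nu + d) * h)%R].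
  move=> h00; move/cvgrPdist_le : qn => /(_ _ d0)[r /= r0 Hr].
  pose h := (Num.min r h0 / 2)%R.
  have m0 : (0 < Num.min r h0)%R by rewrite lt_min r0.
  have mr : (Num.min r h0 <= r)%R by rewrite ge_min lexx.
  have mh : (Num.min r h0 <= h0)%R by rewrite ge_min lexx orbT.
  have hp : (0 < h)%R by rewrite divr_gt0.
  exists h; split=> //; first by rewrite /h; lra.
  have := Hr h; rewrite /= sub0r normrN gtr0_norm// => /(_ _ _)/le_trans.
  have hr : (h < r)%R by rewrite /h; lra.
  have := Hr h; rewrite /= sub0r normrN (gtr0_norm hp) => /(_ hr); rewrite gt_eqF// => /(_ isT).
  rewrite ler_norml => /andP[H _] _; rewrite -ler_pdivrMr//; lra.
have := slope_of_short_time E_proper E_lsc evi (ltW s0) gs Es (addr_ge0 nu0 (ltW d0)) short Ez.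
have : (d * mdist (gam s) z <= e)%R.
  by rewrite /d mulrAC ler_pdivrMr ?ltr_wpDl// ler_wpM2l ?(ltW e0)// lerDl.
rewrite mulrDl; lra.
Qed.

(** Otherwise the energy exceeds [E x] by [d] for a short time, and the evolution
inequality with [z = x] makes the squared distance to [x] negative. *)
Lemma energy_near_start x gam (cx d a1 : R) : evi_flow E lambda x gam ->
  E x = cx%:E -> (0 < d)%R -> (0 < a1)%R ->
  exists a, [/\ (0 < a)%R, (a < a1)%R & E (gam a) <= (cx + d)%:E].
Proof.
move=> evi Ex d0 a10; have [_ gx _] := evi; apply: contrapT => no.
have big a : (0 < a)%R -> (a < a1)%R -> (cx + d)%:E < E (gam a).
  by move=> a0 aa1; rewrite ltNge; apply/negP => Ea; apply: no; exists a.
have cd2 : (mdist (gam r) x ^+ 2)%R @[r --> (0%R : R)^'+] --> (0 : R)%R.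
  have cd : mdist (gam r) x @[r --> (0%R : R)^'+] --> (0 : R)%R.
    suff : mdist (gam r) x @[r --> (0%R : R)^'+] --> mdist x x by rewrite mdistxx.
    apply: (@cvg_comp _ _ _ gam (fun y : X => mdist y x) _ _ _ gx).
    exact: mdist_continuous.
  have cd2 := cvgM cd cd; rewrite mulr0 in cd2; exact: cd2.
have K0 : (0 < d / (`|lambda| + 1))%R by rewrite divr_gt0// ltr_wpDl.
move/cvgrPdist_le : cd2 => /(_ _ K0) /near_right_itv [t1 t10 H1].
pose t := (Num.min t1 a1 / 2)%R.
have m0 : (0 < Num.min t1 a1)%R by rewrite lt_min t10.
have mt1 : (Num.min t1 a1 <= t1)%R by rewrite ge_min lexx.
have ma1 : (Num.min t1 a1 <= a1)%R by rewrite ge_min lexx orbT.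
have t0 : (0 < t)%R by rewrite divr_gt0.
have tt1 : (t <= t1)%R by rewrite /t; lra.
have ta1 : (t < a1)%R by rewrite /t; lra.
have := @evi_bound _ _ E lambda E_proper x gam x cx 0%R t x (- (d / 2))%R 0%R evi (lexx _) t0 gx Ex.
rewrite mdistxx expr0n/= !subr0 => H.
have : (mdist (gam t) x ^+ 2 <= - (d * t))%R.
  apply: le_trans (H _) _; last by rewrite mul0r addr0; lra.
  apply: aeW => r /andP[r0 rt] fE.
  have := big r r0 (le_lt_trans rt ta1); rewrite -{1}(fineK fE) lte_fin => e1.
  have := H1 r r0; rewrite add0r => /(_ (le_trans rt tt1)).
  rewrite sub0r normrN ger0_norm ?sqr_ge0// ler_pdivlMr ?ltr_wpDl// => dd.
  have : (- (lambda / 2 * mdist (gam r) x ^+ 2) <= d / 2)%R.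
    have : (- (lambda * mdist (gam r) x ^+ 2) <= d)%R.
      apply: le_trans (ler_norm _) _; rewrite normrN normrM (ger0_norm (sqr_ge0 _)).
      apply: le_trans dd; rewrite mulrC ler_wpM2l ?sqr_ge0//; lra.
    lra.
  rewrite mul0r addr0; lra.
apply/negP; rewrite -ltNge; apply: lt_le_trans (sqr_ge0 _).
by rewrite oppr_lt0 mulr_gt0.
Qed.


Lemma ac_on_ae_speed a b gam (n : R -> R) : (a < b)%R -> ac_on a b gam ->
  {ae mu, forall t : R, (a < t < b)%R ->
    ((mdist (gam (t + h)) (gam t) / `|h|)%R @[h --> (0%R : R)^'] --> n t)} ->
  forall s t, (a <= s)%R -> (s <= t)%R -> (t <= b)%R ->
    (mdist (gam s) (gam t))%:E <= \int[mu]_(r in `[s, t]) (`|n r|%R)%:E.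
Proof.
move=> ab ac nlim s t as_ st tb.
have [m [m0 mi gm mlim]] := metric_derivative ab ac.
have mii : mu.-integrable `[s, t] (EFin \o m) by exact: (integrable_sub_itv _ mi).
have [N [mN N0 NP]] := ae_null (ae_and (ae_and (ae_neq a) (ae_neq b)) (ae_and nlim mlim)).
have <- : \int[mu]_(r in `[s, t]) (m r)%:E = \int[mu]_(r in `[s, t]) (`|n r|%R)%:E.
  apply: (ge0_eq_integral_null mN N0) => r.
  - by rewrite lee_fin.
  - by rewrite lee_fin.
  rewrite /= in_itv/= => /andP[sr rt] /NP[[ra rb] [nl ml]].
  have abr : (a < r < b)%R.
    by rewrite !lt_neqAle eq_sym ra rb (le_trans as_ sr) (le_trans rt tb).
  have nm : n r = m r by apply: (cvg_unique _ (nl abr) (ml abr)).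
  by rewrite nm ger0_norm.
rewrite -(fineK (integrable_fin_num _ mii))// lee_fin.
exact: gm.
Qed.

(** The upper limit of the difference quotients along the steps [1 / (k + 1)] is
measurable and agrees with the speed almost everywhere. Absolute continuity is assumed
only away from time 0, as it is for a flow. *)
Lemma measurable_speed gam (T : R) : continuous (gam \o clamp 0 T) ->
  (forall a, (0 < a)%R -> (a < T)%R -> ac_on a T gam) ->
  exists n : R -> R, [/\ measurable_fun setT n,
    (forall t, 0 <= n t)%R &
    {ae mu, forall t : R, (0 < t < T)%R ->
      ((mdist (gam (t + h)) (gam t) / `|h|)%R @[h --> (0%R : R)^'] --> n t)}].
Proof.
move=> cg ac.
pose hk (k : nat) : R := (k.+1%:R^-1)%R.
have hk0 k : (0 < hk k)%R by rewrite invr_gt0.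
have chk : hk k @[k --> \oo] --> (0 : R)%R by exact: cvg_harmonic.
pose g := gam \o clamp 0 T.
pose q k s := ((hk k)^-1 * mdist (g (s + hk k)) (g s))%R.
have mq k : measurable_fun setT (EFin \o q k).
  apply/measurable_EFinP; apply: measurable_funM => //.
  apply: continuous_measurable_fun; apply: mdist_continuous2 => // s.
  have shc : continuous (fun s : R => s + hk k : R)%R.
    by move=> r; apply: cvgD; [exact: cvg_id|exact: cvg_cst].
  exact: (@continuous_comp _ _ _ _ g s (shc s) (cg _)).
pose sg t := limn_esup (fun k => (EFin \o q k) t).
have msg : measurable_fun setT sg by exact: measurable_fun_limn_esup.
exists (fun t => fine (sg t)); split.
- exact: measurableT_comp.
- move=> t; apply: fine_ge0; apply: le_trans (limn_einf_sup _).
  rewrite limn_einf_lim; apply: lime_ge; first exact: is_cvg_einfs.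
  apply: nearW => k; apply: le_ereal_inf_tmp => _ [m _ <-].
  by rewrite /= lee_fin mulr_ge0// ?mdist_ge0// invr_ge0 ltW.
have lim_ae (k : nat) : {ae mu, forall t : R, (hk k < t < T)%R -> exists l : R,
    (mdist (gam (t + h)) (gam t) / `|h|)%R @[h --> (0%R : R)^'] --> l}.
  have [kT|Tk] := ltP (hk k) T; last first.
    by apply: aeW => t /andP[kt tT]; have := lt_trans kt tT; rewrite ltNge Tk.
  have [m [_ _ _ ml]] := metric_derivative kT (ac _ (hk0 k) kT).
  by apply: ae_imp ml => t H kt; exists (m t); exact: H.
have : {ae mu, forall t : R, forall k : nat, (hk k < t < T)%R -> exists l : R,
    (mdist (gam (t + h)) (gam t) / `|h|)%R @[h --> (0%R : R)^'] --> l}.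
  exact/ae_foralln.
apply: ae_imp => t H /andP[t0 tT].
have [k kt] : exists k, (hk k < t)%R.
  move/cvgrPdist_lt : chk => /(_ _ t0)[k _ /(_ k (leqnn k))].
  by rewrite sub0r normrN gtr0_norm// => kt; exists k.
have [|l ll] := H k; first by rewrite kt.
suff -> : fine (sg t) = l by [].
suff -> : sg t = l%:E by [].
apply: (cvg_limn_einf_sup _).2; apply/fine_cvgP; split; first exact: nearW.
have ck : (mdist (gam (t + hk k)) (gam t) / `|hk k|)%R @[k --> \oo] --> l.
  apply: (cvg_comp _ _ _ ll) => A A0.
  have : \forall m \near \oo, (hk m != 0)%R -> A (hk m) by exact: (chk _ A0).
  suff : (\forall m \near \oo, (hk m != 0)%R -> A (hk m)) -> \forall m \near \oo, A (hk m) by [].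
  by apply: filterS => m; apply; rewrite gt_eqF.
apply: cvg_trans ck; apply: near_eq_cvg.
have Tt : (0 < T - t)%R by rewrite subr_gt0.
move/cvgrPdist_lt : chk => /(_ _ Tt); apply: filterS => m.
rewrite sub0r normrN gtr0_norm// => mT.
have h0m := hk0 m.
by rewrite /q /g /= !clamp_id; [rewrite mulrC|lra..].
Qed.

End flow_speed.

Section increasing_union.
Context d (T : measurableType d) (R : realType) (mu : {measure set T -> \bar R}).
Local Open Scope ereal_scope.

Lemma ge0_integral_bigcup_le (F : (set T)^nat) (f : T -> \bar R) (c : \bar R) :
  nondecreasing_seq F -> (forall k, measurable (F k)) ->
  (forall k, measurable_fun (F k) f) -> (forall x, 0 <= f x) ->
  (forall k, \int[mu]_(x in F k) f x <= c) ->
  \int[mu]_(x in \bigcup_k F k) f x <= c.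
Proof.
move=> ndF mF mf f0 Fc.
have cF : \int[mu]_(x in F k) f x @[k --> \oo] --> \int[mu]_(x in \bigcup_k F k) f x.
  by apply: ge0_nondecreasing_set_cvg_integral => // k x _; exact: f0.
rewrite -(cvg_lim _ cF)//; apply: lime_le; first by apply: cvgP cF.
exact: nearW.
Qed.

End increasing_union.

Section flow_profile.
Context {R : realType} {X : metricType R}.
Local Notation mu := (@lebesgue_measure R).
Variables (E : X -> \bar R) (lambda : R).
Hypothesis E_proper : forall x, E x != -oo%E.
Hypothesis E_lsc : lower_semicontinuous E.
Hypothesis E_bounded_below : bounded_below_on_bounded E.
Hypothesis E_evi : forall x, exists g, evi_flow E lambda x g.
Implicit Types (x y z : X) (gam : R -> X).
Local Open Scope ereal_scope.
Local Notation S := (evi_semigroup E lambda).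

Lemma evi_semigroup_flow x : exists2 gam, evi_flow E lambda x gam &
  forall t : R, t != 0%R -> S t x = gam t.
Proof.
exists (xget (fun=> x) (evi_flow E lambda x)); first by apply: xgetPex; exact: E_evi.
by move=> t t0; rewrite /evi_semigroup (negbTE t0).
Qed.

Lemma evi_semigroup0 x : S 0%R x = x.
Proof. by rewrite /evi_semigroup eqxx. Qed.

Lemma evi_semigroup_near x gam (t : R) : (forall t : R, t != 0%R -> S t x = gam t) ->
  (0 < t)%R -> \forall r \near t, S r x = gam r.
Proof.
move=> Sg t0; near=> r; apply: Sg; apply: lt0r_neq0; near: r.
exact: lt_nbhsr.
Unshelve. all: by end_near. Qed.

Lemma evi_semigroup_continuous x (T : R) : (0 < T)%R ->
  continuous ((fun t => S t x) \o clamp 0 T).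
Proof.
move=> T0 t; have [gam evi Sg] := evi_semigroup_flow x; have [_ gx _] := evi.
have u0 : (0 <= clamp 0 T t)%R by exact: clamp_ge.
have cl := @continuous_clamp R 0 T t.
move: u0; rewrite le_eqVlt => /predU1P[u0|u0]; last first.
  have cS : S r x @[r --> clamp 0 T t] --> S (clamp 0 T t) x.
    rewrite (Sg (clamp 0 T t)); last by rewrite gt_eqF.
    have gu : gam r @[r --> clamp 0 T t] --> gam (clamp 0 T t) by exact: evi_flow_cvg evi u0.
    move=> V /gu; apply: filterS2 (evi_semigroup_near Sg u0).
    by move=> r /= ->.
  exact: (@cvg_comp _ _ _ (clamp 0 T) (fun r => S r x) _ _ _ cl cS).
move=> V; rewrite /= -u0 evi_semigroup0 => Vx.
have [d /= d0 dV] := gx _ Vx.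
have : \forall r \near t, (`|clamp 0 T t - clamp 0 T r| < d)%R.
  by move/cvgrPdist_lt : cl; exact.
apply: filterS => r; rewrite -u0 sub0r normrN => rd.
have [r0|r0] := eqVneq (clamp 0 T r) 0%R.
  by rewrite /= r0 evi_semigroup0; exact: nbhs_singleton.
rewrite /= Sg//; apply: dV; rewrite /= ?sub0r ?normrN//.
by rewrite lt_neqAle eq_sym r0 clamp_ge.
Qed.

(** Absolute continuity up to time 0 is not part of the definition of a flow; for
starting points of finite energy it follows from [flow_profile]. *)
Lemma evi_semigroup_ac x (a T : R) : (0 < a)%R -> (a < T)%R ->
  ac_on a T (fun t => S t x).
Proof.
move=> a0 aT; have [gam [acg _ _] Sg] := evi_semigroup_flow x.
have [m mi gm] := acg a T a0 aT; exists m => // s t as_ st tT.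
by rewrite !Sg; [exact: gm| |]; rewrite gt_eqF//; lra.
Qed.

(** Dissipation from time 0: [speed_sq_le] on [[a, T]], where [a] tends to 0 along times
at which the energy is close to [E x]. The energy at [T] is finite, as [v] in
[speed_sq_le] could otherwise be taken arbitrarily large. *)
Lemma flow_profile x (T cx : R) : (0 < T)%R -> E x = cx%:E ->
  exists (n : R -> R) (e1 : R), [/\ measurable_fun setT n, (forall t, 0 <= n t)%R,
    {ae mu, forall t : R, (0 < t < T)%R ->
      ((mdist (S (t + h) x) (S t x) / `|h|)%R @[h --> (0%R : R)^'] --> n t)
      /\ slope E (S t x) <= (n t)%:E},
    E (S T x) = e1%:E &
    \int[mu]_(t in `[0%R, T]) (n t ^+ 2)%:E <= (cx - e1)%:E].
Proof.
move=> T0 Ex; have [gam evi Sg] := evi_semigroup_flow x; have [acg gx eviz] := evi.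
have [n [mn n0 nS]] := measurable_speed (@evi_semigroup_continuous x T T0) (fun a a0 aT => @evi_semigroup_ac x a T a0 aT).
have nlim : {ae mu, forall t : R, (0 < t < T)%R ->
    ((mdist (gam (t + h)) (gam t) / `|h|)%R @[h --> (0%R : R)^'] --> n t)}.
  apply: ae_imp nS => t H /andP[t0 tT]; apply: cvg_trans (H _); last by rewrite t0.
  apply: near_eq_cvg; near=> h.
  have : (`|h| < t)%R by near: h; exact: dnbhs0_lt.
  rewrite ltr_norml => /andP[th _].
  by rewrite !Sg// gt_eqF//; lra.
have STg : S T x = gam T by rewrite Sg// gt_eqF.
have bound (v d : R) : v%:E < E (S T x) -> (0 < d)%R ->
    \int[mu]_(t in `[0%R, T]) (n t ^+ 2)%:E <= (cx + d - v)%:E.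
  move=> vE d0.
  have mn2 (i : interval R) : measurable_fun [set` i] (fun t => (n t ^+ 2)%:E).
    by apply: measurable_funTS; apply/measurable_EFinP; exact: measurable_funX.
  have n20 t : 0 <= (n t ^+ 2)%:E by rewrite lee_fin sqr_ge0.
  have each a0 : (0 < a0)%R -> (a0 < T)%R ->
      \int[mu]_(t in `[a0, T]) (n t ^+ 2)%:E <= (cx + d - v)%:E.
    move=> a00 a0T; have [a [ap aa0 Ea]] := energy_near_start E_proper evi Ex d0 a00.
    have [ca Eca] : exists ca, E (gam a) = ca%:E.
      by move: Ea (E_proper (gam a)); case: (E (gam a)) => [ca| |]// _ _; exists ca.
    move: Ea; rewrite Eca lee_fin => ca_le.
    have nlima : {ae mu, forall t : R, (a < t < T)%R ->
        ((mdist (gam (t + h)) (gam t) / `|h|)%R @[h --> (0%R : R)^'] --> n t)}.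
      apply: ae_imp nlim => t H /andP[at_ tT]; apply: H.
      by rewrite tT (lt_trans ap at_).
    rewrite STg in vE.
    have := speed_sq_le E_proper E_lsc E_bounded_below evi ap (lt_trans aa0 a0T) Eca vE nlima.
    move=> H; apply: (@le_trans _ _ (ca - v)%:E); last by rewrite lee_fin lerD2r.
    apply: le_trans H; apply: ge0_subset_integral => //; first exact: mn2.
    by apply: subset_itvr; rewrite bnd_simp ltW.
  pose ak (k : nat) : R := (T / k.+2%:R)%R.
  have ak0 k : (0 < ak k)%R by rewrite divr_gt0.
  have akT k : (ak k < T)%R.
    by rewrite ltr_pdivrMr// ltr_pMr// ltr1n.
  pose F k := `[ak k, T]%classic : set R.
  have ndF : nondecreasing_seq F.
    move=> k m km; apply/subsetPset; apply: subset_itvr; rewrite bnd_simp.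
    by rewrite ler_pM2l// lef_pV2 ?posrE// ler_nat !ltnS.
  have UF : \bigcup_k F k = `]0%R, T]%classic.
    apply/seteqP; split=> [t [k _]|t].
      by rewrite /F /= !in_itv/= => /andP[akt ->]; rewrite (lt_le_trans (ak0 k)).
    rewrite /= in_itv/= => /andP[t0 tT].
    have tT0 : (0 < t / T)%R by rewrite divr_gt0.
    have chk : (k.+1%:R^-1)%R @[k --> \oo] --> (0 : R)%R by exact: cvg_harmonic.
    move/cvgrPdist_lt : chk => /(_ _ tT0)[k _ /(_ k (leqnn k))].
    rewrite sub0r normrN gtr0_norm ?invr_gt0// => kt; exists k => //.
    rewrite /F /= in_itv/= tT andbT /ak mulrC -ler_pdivlMr//.
    by apply: le_trans (ltW kt); rewrite lef_pV2 ?posrE// ler_nat.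
  rewrite -integral_itv_obnd_cbnd; last exact: mn2.
  rewrite -UF; apply: ge0_integral_bigcup_le => // k.
  - exact: measurable_itv.
  - exact: mn2.
  - exact: each.
have I0 : 0 <= \int[mu]_(t in `[0%R, T]) (n t ^+ 2)%:E.
  by apply: integral_ge0 => t _; rewrite lee_fin sqr_ge0.
have [e1 e1E] : exists e1, E (S T x) = e1%:E.
  case e : (E (S T x)) (E_proper (S T x)) => [e1| |] // _; first by exists e1.
  have := bound (cx + 2)%R 1%R; rewrite e ltry => /(_ isT ltr01)/(le_trans I0).
  by rewrite lee_fin; lra.
clear I0; exists n, e1; split => //; last first.
  apply/lee_addgt0Pr => d d0.
  apply: (le_trans (bound (e1 - d / 2)%R (d / 2)%R _ _)).
  - by rewrite e1E lte_fin; lra.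
  - by rewrite divr_gt0.
  - by rewrite -EFinD lee_fin; lra.
apply: ae_imp (ae_and (ae_and nS nlim) (eviz x)) => t [[H1 H2] H3] /andP[t0 tT].
have t0T : (0 < t < T)%R by rewrite t0.
split; first exact: H1.
have Sgt : S t x = gam t by rewrite Sg// gt_eqF.
have [_] := H3 t0; rewrite Ex Sgt.
case e : (E (gam t)) (E_proper (gam t)) => [et| |] // _ _.
apply: (slope_le_speed E_proper E_lsc E_evi evi t0 e (H2 t0T)).
Unshelve. all: by end_near. Qed.

End flow_profile.

(** * Reparametrized flows are optimal *)

Section reparametrized_flow.
Context {R : realType} {X : metricType R}.
Local Notation mu := (@lebesgue_measure R).
Variables (E : X -> \bar R) (lambda : R).
Hypothesis E_proper : forall x, E x != -oo%E.
Hypothesis E_lsc : lower_semicontinuous E.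
Hypothesis E_bounded_below : bounded_below_on_bounded E.
Hypothesis E_evi : forall x, exists g, evi_flow E lambda x g.
Implicit Types (x y z : X) (gam : R -> X).
Local Open Scope ereal_scope.
Local Notation S := (evi_semigroup E lambda).

Lemma affine_preimage_cc (al be s t : R) : (al != 0)%R -> (s <= t)%R ->
  affine al be @^-1` `[Num.min (affine al be s) (affine al be t),
                        Num.max (affine al be s) (affine al be t)] = `[s, t]%classic.
Proof.
move=> al0 st; rewrite /affine; apply/seteqP.
have [al_neg|al_pos|al_eq] := ltgtP al 0%R; last by rewrite al_eq eqxx in al0.
- have h : (al * t + be <= al * s + be)%R by rewrite lerD2r ler_nM2l.
  by rewrite (min_r h) (max_l h); split=> r; rewrite /= !in_itv/= !lerD2r !ler_nM2l// andbC.
- have h : (al * s + be <= al * t + be)%R by rewrite lerD2r ler_pM2l.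
  by rewrite (min_l h) (max_r h); split=> r; rewrite /= !in_itv/= !lerD2r !ler_pM2l.
Qed.

(** For a positive initial time this is absolute continuity; the value 0 is reached by
continuity. *)
Lemma evi_semigroup_increment x (T : R) (n : R -> R) : (0 < T)%R ->
  measurable_fun setT n -> (forall t, 0 <= n t)%R ->
  {ae mu, forall t : R, (0 < t < T)%R ->
    ((mdist (S (t + h) x) (S t x) / `|h|)%R @[h --> (0%R : R)^'] --> n t)} ->
  forall p q, (0 <= p)%R -> (p <= q)%R -> (q <= T)%R ->
    (mdist (S p x) (S q x))%:E <= \int[mu]_(r in `[p, q]) (n r)%:E.
Proof.
move=> T0 mn n0 nlim.
have pos p q : (0 < p)%R -> (p <= q)%R -> (q <= T)%R ->
    (mdist (S p x) (S q x))%:E <= \int[mu]_(r in `[p, q]) (n r)%:E.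
  rewrite [(p <= q)%R]le_eqVlt => p0 /predU1P[<- _|pq qT].
    by rewrite mdistxx; apply: integral_ge0 => r _; rewrite lee_fin.
  have pT : (p < T)%R by exact: lt_le_trans qT.
  have nl : {ae mu, forall t : R, (p < t < T)%R ->
      ((mdist (S (t + h) x) (S t x) / `|h|)%R @[h --> (0%R : R)^'] --> n t)}.
    by apply: ae_imp nlim => t H /andP[pt tT]; apply: H; rewrite tT (lt_trans p0).
  have ac := @evi_semigroup_ac R X E lambda E_evi x p T p0 pT.
  have := ac_on_ae_speed pT ac nl (lexx p) (ltW pq) qT.
  by under eq_integral do rewrite ger0_norm//.
move=> p q; rewrite [(0 <= p)%R]le_eqVlt => /predU1P[<-|p0]; last exact: pos.
rewrite [(0 <= q)%R]le_eqVlt => /predU1P[<- _|q0 qT].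
  by rewrite mdistxx; apply: integral_ge0 => r _; rewrite lee_fin.
have I0 : 0 <= \int[mu]_(r in `[0%R, q]) (n r)%:E.
  by apply: integral_ge0 => r _; rewrite lee_fin.
have le r : (0 < r)%R -> (r <= q)%R ->
    (mdist (S r x) (S q x))%:E <= \int[mu]_(r in `[0%R, q]) (n r)%:E.
  move=> r0 rq; apply: le_trans (pos r q r0 rq qT) _.
  apply: ge0_subset_integral => //.
  - by apply: measurable_funTS; exact/measurable_EFinP.
  - by move=> t _; rewrite lee_fin.
  - by apply: subset_itvr; rewrite bnd_simp ltW.
move: I0 le; case: (\int[mu]_(r in `[0%R, q]) (n r)%:E) => [i| |] // _ le; last by rewrite leey.
rewrite lee_fin.
have cl0 : clamp 0 T 0%R = 0%R :> R by rewrite clamp_id// ltW.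
have cS : mdist ((fun t => S t x) (clamp 0 T r)) (S q x) @[r --> (0%R : R)^'+] --> mdist (S 0%R x) (S q x).
  have c0 := @evi_semigroup_continuous R X E lambda E_evi x T T0 0%R.
  rewrite /continuous_at /= cl0 in c0.
  have c0r := cvg_at_right_filter c0.
  apply: (@cvg_comp _ _ _ _ (fun y : X => mdist y (S q x)) _ _ _ c0r).
  exact: mdist_continuous.
apply: (ler_cvg_to cS (cvg_cst i)); near=> r.
have r0 : (0 < r)%R by near: r; exact: nbhs_right_gt.
have rq : (r <= q)%R by apply: ltW; near: r; exact: nbhs_right_lt.
rewrite clamp_id ?(ltW r0)//; last exact: le_trans qT.
by rewrite -lee_fin; exact: le.
Unshelve. all: by end_near. Qed.

(** The reparametrized curve has speed [T n] and slope at most [n], both taken at the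
affine time. The action and [T ^+ 2] times the slope action are then both at most
[T / 2] times the integral of [n ^+ 2] over [[0, T]], and that integral is at most
[cx - e1] by [flow_profile]. Thus Young's inequality loses nothing along the flow. *)
Lemma affine_flow_cost x (T cx e1 al be : R) : (0 < T)%R -> E x = cx%:E ->
  E (S T x) = e1%:E -> (`|al| = T)%R ->
  affine al be @^-1` `[0%R, T] = `[0%R, 1%R]%classic ->
  action_eps E T (fun t => S (affine al be t) x) <= (T * (cx - e1))%:E.
Proof.
move=> T0 Ex ET alT pre01.
have al0 : (al != 0)%R by rewrite -normr_gt0 alT.
have [n [e1' [mn n0 nae]]] := flow_profile E_proper E_lsc E_bounded_below E_evi T0 Ex.
rewrite ET => -[<-] In.
pose c t := S (affine al be t) x; rewrite -/c.
have af01 t : (0 <= t <= 1)%R -> (0 <= affine al be t <= T)%R.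
  move=> t01; have : (affine al be @^-1` `[0%R, T]) t by rewrite pre01 /= in_itv.
  by rewrite /= in_itv.
have mna : measurable_fun setT (fun t => n (affine al be t)).
  by apply: measurableT_comp => //; exact: measurable_affine.
pose J := \int[mu]_(t in `[0%R, 1%R]) (n (affine al be t) ^+ 2)%:E.
have JE : \int[mu]_(t in `[0%R, T]) (n t ^+ 2)%:E = T%:E * J.
  rewrite (@ge0_integral_affine R al be `[0%R, T]%classic (fun t => (n t ^+ 2)%:E))//.
  - by rewrite alT pre01.
  - by apply: measurable_funTS; apply/measurable_EFinP; exact: measurable_funX.
  - by move=> t _; rewrite lee_fin sqr_ge0.
have [j jE j0] : exists2 j : R, J = j%:E & (0 <= j)%R.
  have J0 : 0 <= J by apply: integral_ge0 => t _; rewrite lee_fin sqr_ge0.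
  move: In J0; rewrite JE; case: (J) => [j| |] //; last by rewrite gt0_muley ?lte_fin.
  by rewrite lee_fin => _ j0; exists j.
have nai : mu.-integrable `[0%R, 1%R] (EFin \o (fun t => n (affine al be t))).
  apply/integrableP; split; first by apply: measurable_funTS; exact/measurable_EFinP.
  apply: (@le_lt_trans _ _ (\int[mu]_(t in `[0%R, 1%R]) (1%:E + (n (affine al be t) ^+ 2)%:E))).
    apply: ge0_le_integral => //.
    - by apply: measurable_funTS; apply: measurableT_comp => //; exact/measurable_EFinP.
    - apply: measurable_funTS; apply: emeasurable_funD => //; apply/measurable_EFinP.
      exact: measurable_funX.
    - move=> t _; rewrite /= ger0_norm// -EFinD lee_fin; have := n0 (affine al be t).
      move: (n _) => w w0; have := sqr_ge0 (w - 1)%R; rewrite sqrrB1; lra.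
  rewrite ge0_integralD//.
  - by rewrite integral_cst//= lebesgue_measure_itv/= lte_fin ltr01 mul1e -EFinB -/J jE -EFinD ltry.
  - by move=> t _; rewrite lee_fin sqr_ge0.
  - by apply: measurable_funTS; apply/measurable_EFinP; exact: measurable_funX.
have acc : ac_on 0%R 1%R c.
  exists (fun t => T * n (affine al be t))%R; first exact: integrable_EFinZ.
  move=> s t s0 st t1.
  have afs : (0 <= affine al be s <= T)%R by apply: af01; rewrite s0 (le_trans st).
  have aft : (0 <= affine al be t <= T)%R by apply: af01; rewrite t1 (le_trans s0).
  pose p := Num.min (affine al be s) (affine al be t).
  pose q := Num.max (affine al be s) (affine al be t).
  have -> : mdist (c s) (c t) = mdist (S p x) (S q x).
    rewrite /p /q; have [h|h] := leP (affine al be s) (affine al be t).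
      by rewrite /c.
    by rewrite metric_sym.
  have nlim : {ae mu, forall t : R, (0 < t < T)%R ->
    ((mdist (S (t + h) x) (S t x) / `|h|)%R @[h --> (0%R : R)^'] --> n t)}.
    by apply: ae_imp nae => r H r0T; exact: (H r0T).1.
  apply: (@le_trans _ _ (\int[mu]_(r in `[p, q]) (n r)%:E)).
    apply: (evi_semigroup_increment T0 mn n0 nlim).
    - by rewrite /p le_min (andP afs).1 (andP aft).1.
    - by rewrite /p /q ge_min le_max lexx.
    - by rewrite /q ge_max (andP afs).2 (andP aft).2.
  rewrite (@ge0_integral_affine R al be `[p, q]%classic (fun t => (n t)%:E))//.
  - rewrite affine_preimage_cc// alT -ge0_integralZl//.
    + by apply: measurable_funTS; exact/measurable_EFinP.
    + by move=> r _; rewrite lee_fin.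
    + by rewrite lee_fin ltW.
  - by apply: measurable_funTS; exact/measurable_EFinP.
  - by move=> r _; rewrite lee_fin.
have [N [mN N0 NP]] := ae_null (ae_and (ae_and (ae_neq (0 : R)%R) (ae_neq T)) nae).
have aegood : {ae mu, forall t : R, (0 <= t <= 1)%R ->
    ((mdist (c (t + h)%R) (c t) / `|h|)%R @[h --> (0%R : R)^'] --> (T * n (affine al be t))%R)
    /\ slope E (c t) <= (n (affine al be t))%:E}.
  have [mN' N0'] := @null_set_affine R al be N al0 mN N0.
  exists (affine al be @^-1` N); split=> // t; apply: contra_notP => /NP[[an0 anT] H].
  move=> /af01/andP[a0 aT].
  have [|H1 H2] := H; first by rewrite !lt_neqAle eq_sym an0 anT a0 aT.
  split=> //.
  have ah : (al * h)%R @[h --> (0%R : R)^'] --> (0%R : R)^'.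
    move=> A A0; have cah : (al * h)%R @[h --> (0%R : R)] --> (al * 0)%R.
      by apply: cvgM; [exact: cvg_cst|exact: cvg_id].
    rewrite mulr0 in cah.
    have : \forall h \near (0%R : R), (al * h != 0)%R -> A (al * h)%R by exact: (cah _ A0).
    suff : (\forall h \near (0%R : R), (al * h != 0)%R -> A (al * h)%R) ->
      \forall h \near (0%R : R), (h != 0)%R -> A (al * h)%R by [].
    by apply: filterS => h; rewrite mulf_eq0 (negbTE al0).
  apply: cvg_trans (cvgM (cvg_cst T) (cvg_comp _ _ ah H1)); apply: near_eq_cvg; near=> h.
  have h0 : h != 0%R by near: h; exact: nbhs_dnbhs_neq.
  rewrite /c /= (_ : affine al be (t + h) = affine al be t + al * h)%R; last by rewrite /affine; ring.
  rewrite normrM alT; field.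
  by rewrite normr_eq0 h0 gt_eqF.
have actc : action c = (2^-1)%:E * \int[mu]_(t in `[0%R, 1%R]) ((T * n (affine al be t)) ^+ 2)%:E.
  apply: (@action_density _ _ c (fun t => T * n (affine al be t))%R acc).
  by apply: ae_imp aegood => t H /andP[t0 t1]; apply: (H _).1; rewrite !ltW.
have JT : \int[mu]_(t in `[0%R, 1%R]) ((T * n (affine al be t)) ^+ 2)%:E = (T ^+ 2)%:E * J.
  rewrite /J -ge0_integralZl//.
  - by apply: eq_integral => t _; rewrite exprMn EFinM.
  - by apply: measurable_funTS; apply/measurable_EFinP; exact: measurable_funX.
  - by move=> t _; rewrite lee_fin sqr_ge0.
  - by rewrite lee_fin sqr_ge0.
have slc : slope_action E c <= (2^-1)%:E * J.
  rewrite /slope_action lee_wpmul2l ?lee_fin ?invr_ge0//.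
  have [N' [mN' N0' good]] := ae_null aegood.
  apply: (ge0_le_integral_null mN' N0') => t.
  - by move=> _; rewrite expe_ge0// slope_ge0.
  - by move=> _; rewrite lee_fin sqr_ge0.
  rewrite /= in_itv/= => t01 Nt; have := (good t Nt t01).2.
  have := slope_ge0 E (c t); case: (slope E (c t)) => [w| |] //.
  rewrite -EFinM !lee_fin => w0 wn; rewrite -expr2.
  by rewrite ler_pXn2r ?nnegrE.
rewrite JE jE in In; rewrite /action_eps actc JT jE; rewrite jE in slc.
move: In slc; rewrite -EFinM lee_fin => In slc; move: slc; have := slope_action_ge0 E c.
case: (slope_action E c) => [w| |] //; rewrite -EFinM !lee_fin => w0 wj.
apply: (@le_trans _ _ (T * (T * j))%R); last by rewrite ler_wpM2l// ltW.
have : (T ^+ 2 * w <= T ^+ 2 * (2^-1 * j))%R by rewrite ler_wpM2l// sqr_ge0.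
rewrite (_ : T * (T * j) = 2^-1 * (T ^+ 2 * j) + T ^+ 2 * (2^-1 * j))%R; last by field.
by rewrite lerD2l.
Unshelve. all: by end_near. Qed.

End reparametrized_flow.

Section minimizing_curves.
Context {R : realType} {X : metricType R}.
Local Notation mu := (@lebesgue_measure R).
Variables (E : X -> \bar R) (lambda : R).
Hypothesis E_proper : forall x, E x != -oo%E.
Hypothesis E_lsc : lower_semicontinuous E.
Hypothesis E_dom : dom E !=set0.
Hypothesis E_bounded_below : bounded_below_on_bounded E.
Hypothesis E_evi : forall x, exists g, evi_flow E lambda x g.
Implicit Types (x y z : X) (gam : R -> X).
Local Open Scope ereal_scope.
Local Notation S := (evi_semigroup E lambda).

(** At almost every time the evolution inequality with [z] in the domain makes the energy
finite, and by [speed_sq_le] it stays finite afterwards. *)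
Lemma flow_energy_finite x (T : R) : (0 < T)%R -> exists e, E (S T x) = e%:E.
Proof.
move=> T0; have [gam evi Sg] := evi_semigroup_flow E_evi x; have [acg _ eviz] := evi.
have [z zE] := E_dom.
have [N [mN N0 NP]] := ae_null (eviz z).
have [a [a0 aT Na]] : exists a, [/\ (0 < a)%R, (a < T)%R & ~ N a].
  apply: contrapT => no.
  have sub : (`]0%R, T[%classic : set R) `<=` N.
    move=> a; rewrite /= in_itv/= => /andP[a0 aT]; apply: contrapT => Na.
    by apply: no; exists a.
  have : \int[mu]_(a in `]0%R, T[) (1%R : R)%:E = \int[mu]_(a in `]0%R, T[) (0%R : R)%:E.
    apply: (ge0_eq_integral_null mN N0) => a.
    - by rewrite lee_fin.
    - by rewrite lee_fin.
    - by move=> /sub.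
  rewrite integral0 integral_cst//= lebesgue_measure_itv/= lte_fin T0 mul1e -EFinB subr0.
  by move=> [T00]; rewrite T00 ltxx in T0.
have [_ ez] := NP a Na a0.
have [ca Ea] : exists ca, E (gam a) = ca%:E.
  move: ez (E_proper (gam a)); case: (E (gam a)) => [ca| |]//; first by exists ca.
  by rewrite addey// leye_eq => /eqP zoo; move: zE; rewrite /dom/= zoo.
rewrite Sg ?gt_eqF//.
case e : (E (gam T)) (E_proper (gam T)) => [w| |] // _; first by exists w.
have [n [n0 _ _ nlim]] := metric_derivative aT (acg a T a0 aT).
have := @speed_sq_le _ _ E lambda E_proper E_lsc E_bounded_below x gam a T ca (ca + 1)%R n evi a0 aT Ea.
rewrite e ltry => /(_ isT nlim).
have : 0 <= \int[mu]_(t in `[a, T]) (n t ^+ 2)%:E.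
  by apply: integral_ge0 => t _; rewrite lee_fin sqr_ge0.
by move=> /le_trans/[apply]; rewrite lee_fin; lra.
Qed.

Lemma flow_energy_gap x (T : R) : (0 < T)%R ->
  energy_gap E x (S T x) = E x - E (S T x).
Proof.
move=> T0; have [e ET] := flow_energy_finite x T0.
rewrite /energy_gap ET andbF; have := E_proper x; case Ex : (E x) => [cx| |] // _.
rewrite gee0_abs//.
have [n [e1 [_ _ _]]] := flow_profile E_proper E_lsc E_bounded_below E_evi T0 Ex.
rewrite ET => -[<-]; apply: le_trans.
by apply: integral_ge0 => t _; rewrite lee_fin sqr_ge0.
Qed.

Lemma energy_gapC x y : energy_gap E x y = energy_gap E y x.
Proof.
rewrite /energy_gap andbC; case: ifP => // _.
by case: (E x) (E_proper x) => [a| |]//; case: (E y) (E_proper y) => [b| |]//; rewrite -!EFinB !abse_EFin distrC.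
Qed.

Lemma affine_flow_continuous x (T al be : R) : (0 < T)%R ->
  affine al be @^-1` `[0%R, T] = `[0%R, 1%R]%classic ->
  {within `[0%R, 1%R], continuous (fun t => S (affine al be t) x)}.
Proof.
move=> T0 pre01.
have cS := @evi_semigroup_continuous R X E lambda E_evi x T T0.
have ca : continuous (affine al be : R -> R).
  by move=> t; apply: cvgD; [apply: cvgM; [exact: cvg_cst|exact: cvg_id]|exact: cvg_cst].
have cc : continuous (((fun t => S t x) \o clamp 0 T) \o affine al be).
  by move=> t; exact: (@continuous_comp _ _ _ (affine al be) _ t (ca t) (cS _)).
apply: (@subspace_eq_continuous _ _ _ (((fun t => S t x) \o clamp 0 T) \o affine al be)).
  move=> t; rewrite inE => t01; have : (affine al be @^-1` `[0%R, T]) t by rewrite pre01.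
  by rewrite /= in_itv/= => /andP[a0 aT]; rewrite clamp_id.
exact: continuous_subspaceT.
Qed.

Lemma affine_flow_action x (T al be : R) : (0 < T)%R -> (`|al| = T)%R ->
  affine al be @^-1` `[0%R, T] = `[0%R, 1%R]%classic ->
  action_eps E T (fun t => S (affine al be t) x) <= T%:E * (E x - E (S T x)).
Proof.
move=> T0 alT pre01; have [e ET] := flow_energy_finite x T0; rewrite ET.
have := E_proper x; case Ex : (E x) => [cx| |] // _; last first.
  by rewrite gt0_muley ?leey// lte_fin.
exact: (affine_flow_cost E_proper E_lsc E_bounded_below E_evi T0 Ex ET alT pre01).
Qed.

Lemma minimizer_of_le (T : R) x y g : (0 < T)%R -> curves x y g ->
  action_eps E T g <= T%:E * energy_gap E x y ->
  minimizer E T x y g /\ min_cost E T x y = T%:E * energy_gap E x y.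
Proof.
move=> T0 gxy gle.
have lb := energy_gap_le_min_cost E_proper E_lsc E_dom E_bounded_below E_evi x y T0.
have ub : min_cost E T x y <= action_eps E T g by apply: ereal_inf_lbound; exists g.
split; last by apply/eqP; rewrite eq_le lb (le_trans ub).
split; first exact: gxy.
move=> h hxy; apply: (le_trans gle); apply: (le_trans lb).
by apply: ereal_inf_lbound; exists h.
Qed.

Lemma forward_flow_minimizer x (T : R) : (0 < T)%R ->
  minimizer E T x (S T x) (fun t => S (T * t)%R x) /\
  min_cost E T x (S T x) = T%:E * energy_gap E x (S T x).
Proof.
move=> T0.
have cE : (fun t => S (T * t)%R x) = (fun t => S (affine T 0 t) x).
  by apply/funext => t; rewrite /affine addr0.
have pre01 : affine T 0 @^-1` `[0%R, T] = `[0%R, 1%R]%classic.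
  apply/seteqP; split=> t; rewrite /affine /= !in_itv/= addr0 pmulr_rge0// ger_pMr//.
apply: minimizer_of_le => //; last first.
  by rewrite cE flow_energy_gap//; apply: affine_flow_action => //; rewrite gtr0_norm.
split; last by rewrite mulr0 mulr1 evi_semigroup0.
by rewrite cE; apply: affine_flow_continuous pre01.
Qed.

Lemma backward_flow_minimizer y (T : R) : (0 < T)%R ->
  minimizer E T (S T y) y (fun t => S (T * (1 - t))%R y) /\
  min_cost E T (S T y) y = T%:E * energy_gap E y (S T y).
Proof.
move=> T0; rewrite energy_gapC.
have cE : (fun t => S (T * (1 - t))%R y) = (fun t => S (affine (- T) T t) y).
  by apply/funext => t; congr (S _ y); rewrite /affine; ring.
have pre01 : affine (- T) T @^-1` `[0%R, T] = `[0%R, 1%R]%classic.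
  apply/seteqP; split=> t; rewrite /affine /= !in_itv/= (_ : - T * t + T = T * (1 - t))%R; last ring.
    by rewrite pmulr_rge0// ger_pMr// => /andP[h1 h2]; apply/andP; split; lra.
    ring.
  by rewrite pmulr_rge0// ger_pMr// => /andP[h1 h2]; apply/andP; split; lra.
apply: minimizer_of_le => //; last first.
  rewrite cE energy_gapC flow_energy_gap//; apply: affine_flow_action => //.
  by rewrite normrN gtr0_norm.
split; last by rewrite subr0 subrr mulr0 mulr1 evi_semigroup0.
by rewrite cE; apply: affine_flow_continuous pre01.
Qed.

End minimizing_curves.

Local Open Scope ereal_scope.

Theorem proposition4p7 (R : realType) (X : metricType R) (E : X -> \bar R)
    (lambda eps : R)
    (X_complete : complete_space X) (X_separable : separable_space X)
    (E_proper : forall x, E x != -oo)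
    (E_lsc : lower_semicontinuous E)
    (E_dense : closure (dom E) = [set: X])
    (E_bounded_below : bounded_below_on_bounded E)
    (E_evi : forall x, exists g, evi_flow E lambda x g)
    (eps_gt0 : (0 < eps)%R) :
  let S := evi_semigroup E lambda in
  (forall x y, eps%:E * energy_gap E x y <= min_cost E eps x y) /\
  (forall x y, y = S eps x \/ x = S eps y ->
     min_cost E eps x y = eps%:E * energy_gap E x y) /\
  (forall x y, y = S eps x ->
     minimizer E eps x y (fun t => S (eps * t)%R x) /\
     min_cost E eps x y = eps%:E * (E x - E (S eps x))) /\
  (forall x y, x = S eps y ->
     minimizer E eps x y (fun t => S (eps * (1 - t))%R y) /\
     min_cost E eps x y = eps%:E * (E y - E (S eps y))).
Proof.
move=> S; case: (pselect (dom E !=set0)) => [E_dom|no]; last first.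
  have noX (x : X) : False.
    have : closure (dom E) x by rewrite E_dense.
    move=> /(_ setT) [|z [zE _]]; first exact: filterT.
    by apply: no; exists z.
  by split; [|split; [|split]] => x; case: (noX x).
split; first by move=> x y; exact: energy_gap_le_min_cost.
split.
  move=> x y [->|->]; first by have [] := forward_flow_minimizer E_proper E_lsc E_dom E_bounded_below E_evi x eps_gt0.
  rewrite energy_gapC//.
  by have [] := backward_flow_minimizer E_proper E_lsc E_dom E_bounded_below E_evi y eps_gt0.
have gap x : energy_gap E x (S eps x) = E x - E (S eps x).
  exact (flow_energy_gap E_proper E_lsc E_dom E_bounded_below E_evi x eps_gt0).
split=> x y ->; rewrite -gap.
  exact (forward_flow_minimizer E_proper E_lsc E_dom E_bounded_below E_evi x eps_gt0).
exact (backward_flow_minimizer E_proper E_lsc E_dom E_bounded_below E_evi y eps_gt0).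
Qed.
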